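(* Let $\lambda=(\lambda_1,\dots,\lambda_r)$ be a multidimensional real parameter with $\lambda_2\le 0$, and let $\lambda\mapsto f_\lambda$ be a $C^1$-smooth family of $C^3$-smooth circle maps. Assume that the family is monotonic with respect to $\lambda_1$, i.e. $\frac{df_\lambda}{d\lambda_1}>0$, and that $f_\lambda$ is a multicritical circle map for $\lambda_2=0$ and a circle diffeomorphism for $\lambda_2<0$. Then for any irrational $\alpha$, the Arnold $\alpha$-tongue $\{\lambda\mid\rho(f_\lambda)=\alpha\}$ is given by a function $\lambda_1=a(\lambda_2,\dots,\lambda_r)$ that is continuously differentiable at $0$. Its derivative $L_wa$ in the direction of $w\in\mathbb R^{r-1}$ satisfies $$L_wa\cdot\int_{\mathbb R/\mathbb Z}\frac{df_\lambda}{d\lambda_1}(f^{-1}(x))\,d\mu_f(x)=-\int_{\mathbb R/\mathbb Z}(L_wf_\lambda)(f^{-1}(x))\,d\mu_f(x),$$ where $f=f_\lambda$ is the map of the family at the corresponding point $\lambda=(a(\lambda_2,\dots,\lambda_r),\lambda_2,\dots,\lambda_r)$ of the tongue, $\mu_f$ is the unique $(-1)$-measure of $f$, and $L_wf_\lambda$ is the derivative of $f_\lambda$ with respect to $(\lambda_2,\dots,\lambda_r)$ in the direction $w$.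
   Context: The space of $C^3$-smooth circle maps is considered with the norm $\|f\|_{C^3}=\sum_{i=0}^3\|f^{(i)}\|_\infty$. Multicritical circle map: an orientation-preserving $C^3$-smooth circle homeomorphism $f$ of $\mathbb R/\mathbb Z$ such that $f'>0$ everywhere except finitely many points, and on a neighborhood of each of these points $c_n$ one has $f(x)=f(c_n)+\psi_n(x)|\psi_n(x)|^{d_n-1}$, where $\psi_n$ is a $C^3$-smooth diffeomorphism; the number $d_n$ is called the order of the critical point $c_n$. Circle diffeomorphisms are orientation-preserving. The rotation number of an orientation-preserving circle homeomorphism $f$ is $\rho(f)=\lim_{n\to\infty}F^n(x)/n\in\mathbb R/\mathbb Z$ (taken mod 1), where $F$ is a lift of $f$ to $\mathbb R$. $(-1)$-measure of $f$: a Borel probability measure $\mu$ on $\mathbb R/\mathbb Z$ such that $\int\phi\,d\mu=\int f'(f^{-1}(x))\,\phi(f^{-1}(x))\,d\mu(x)$ for every continuous function $\phi$. Every $C^2$-smooth circle diffeomorphism and every $C^3$-smooth multicritical circle map with irrational rotation number has a unique $(-1)$-measure, denoted $\mu_f$. *)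

(* Defs.v *)
From HB Require Import structures.
From mathcomp Require Import all_boot all_order all_algebra.
From mathcomp Require Import all_classical all_reals all_analysis.
Set Implicit Arguments.
Unset Strict Implicit.
Unset Printing Implicit Defensive.
Import Order.TTheory GRing.Theory Num.Theory.
Import numFieldNormedType.Exports.
Local Open Scope classical_set_scope.
Local Open Scope ring_scope.

(* Conventions for the circle R/Z.  A map f of R/Z homotopic to the identity is
   given by a lift F : R -> R, F (x + 1) = F x + 1, and a function on R/Z by a
   1-periodic function on R; lifts F and F + k, with k an integer, give the same
   f.  A Borel measure on R/Z is given by the Borel measure on R, carried by the
   fundamental domain [0, 1[, that corresponds to it under the measurable
   bijection [0, 1[ -> R/Z. *)

Definition C3_on (R : realType) (U : set R) (f : R -> R) : Prop :=
  (forall (i : nat) x, (i < 3)%N -> U x -> derivable (derive1n i f) x 1) /\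
  (forall x, U x -> {for x, continuous (derive1n 3 f)}).

(* [sup] is 0 on unbounded sets; the norm is only applied to 1-periodic C^3
   functions, whose derivatives up to order 3 are bounded. *)
Definition C3norm (R : realType) (f : R -> R) : R :=
  \sum_(i < 4) sup (range (fun x => `|derive1n i f x|)).

Definition C3_circle_function (R : realType) (h : R -> R) : Prop :=
  C3_on setT h /\ forall x, h (x + 1) = h x.

Definition C3_circle_map (R : realType) (F : R -> R) : Prop :=
  C3_on setT F /\ forall x, F (x + 1) = F x + 1.

(* The lifts of the orientation-preserving homeomorphisms of R/Z. *)
Definition circle_homeo (R : realType) (F : R -> R) : Prop :=
  [/\ continuous F, {homo F : x y / x < y} & forall x, F (x + 1) = F x + 1].

Definition inv_map (R : realType) (F : R -> R) (y : R) : R :=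
  xget 0 [set x | F x = y].

Definition circle_diffeo (R : realType) (F : R -> R) : Prop :=
  [/\ circle_homeo F, C3_on setT F & C3_on setT (inv_map F)].

Definition C3_diffeo_on (R : realType) (U : set R) (psi : R -> R) : Prop :=
  [/\ C3_on U psi, open (psi @` U) &
      exists chi : R -> R, C3_on (psi @` U) chi /\
        forall x, U x -> chi (psi x) = x].

Definition power_law_at (R : realType) (F : R -> R) (c : R) : Prop :=
  exists (d : R) (psi : R -> R) (U : set R),
    [/\ open U, U c, C3_diffeo_on U psi &
        forall x, U x -> F x = F c + psi x * (`|psi x| `^ (d - 1))].

Definition critical_points (R : realType) (F : R -> R) : set R :=
  [set c | ~ 0 < derive1 F c].

Definition multicritical (R : realType) (F : R -> R) : Prop :=
  [/\ circle_homeo F, C3_on setT F,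
      finite_set (critical_points F `&` `[0, 1[%classic) &
      forall c, critical_points F c -> power_law_at F c].

(* The real rotation number of a lift (for a circle homeomorphism the limit
   exists and does not depend on the starting point); the rotation number of
   the circle map is its class modulo 1. *)
Definition rotation_number (R : realType) (F : R -> R) : R :=
  lim ((fun m : nat => iter m F 0 / m%:R) @ \oo).

Definition minus_one_measure (R : realType) (F : R -> R)
    (mu : probability (measurableTypeR R) R) : Prop :=
  mu `[0, 1[%classic = 1%E /\
  forall phi : R -> R, continuous phi -> (forall x, phi (x + 1) = phi x) ->
    \int[mu]_(x in `[0, 1[%classic) phi x =
    \int[mu]_(x in `[0, 1[%classic) (derive1 F (inv_map F x) * phi (inv_map F x)).

Definition unique_minus_one_measure (R : realType) (F : R -> R)
    (mu : probability (measurableTypeR R) R) : Prop :=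
  minus_one_measure F mu /\
  forall nu : probability (measurableTypeR R) R, minus_one_measure F nu ->
    forall A : set R, measurable A -> nu A = mu A.

(* [g] is continuously differentiable on [H] with differential [dg], for the
   norm [N] on the target.  Increments stay inside [H], so that derivatives at
   boundary points of [H] are one-sided; [dg] is determined by [g] when [H] is
   a relatively open subset of a half-space. *)
Definition C1_on (R : realType) (V : normedModType R) (W : lmodType R)
    (N : W -> R) (H : set V) (g : V -> W) (dg : V -> V -> W) : Prop :=
  [/\ forall x, H x -> linear (dg x),
      forall x, H x -> forall e : R, 0 < e ->
        \forall y \near within H (nbhs x),
          N (g y - g x - dg x (y - x)) <= e * `|y - x| &
      forall x, H x -> forall e : R, 0 < e ->
        \forall y \near within H (nbhs x),
          forall v : V, N (dg y v - dg x v) <= e * `|v|].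

(* A C^1 family of C^3 circle maps, given by its lifts; [DF l v] is the
   derivative of the family at [l] in the direction [v]. *)
Definition C1_family (R : realType) (m : nat) (L : set 'rV[R]_m)
    (F : 'rV[R]_m -> R -> R) (DF : 'rV[R]_m -> 'rV[R]_m -> R -> R) : Prop :=
  [/\ forall l, L l -> C3_circle_map (F l),
      forall l v, L l -> C3_circle_function (DF l v) &
      C1_on (@C3norm R) L F DF].

(* The parameter whose first coordinate is [t] and whose other coordinates are
   those of [s]. *)
Definition param (R : realType) (n : nat) (t : R) (s : 'rV[R]_n.+1) :
  'rV[R]_n.+2 := row_mx (t%:M : 'M[R]_1) s.

(* The lambda_2 coordinate is [l 0 1], respectively [s 0 0] when lambda_1 is
   left out. *)
Definition half_space (R : realType) (n : nat) : set 'rV[R]_n.+2 :=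
  [set l | l 0 1 <= 0].

Definition half_space' (R : realType) (n : nat) : set 'rV[R]_n.+1 :=
  [set s | s 0 0 <= 0].

Definition tongue (R : realType) (m : nat) (L : set 'rV[R]_m)
    (F : 'rV[R]_m -> R -> R) (alpha : R) : set 'rV[R]_m :=
  [set l | L l /\ exists k : int, rotation_number (F l) = alpha + k%:~R].

(* Main.v *)
Require Import Defs.
From HB Require Import structures.
From mathcomp Require Import all_boot all_order all_algebra.
From mathcomp Require Import all_classical all_reals all_analysis.
From mathcomp Require Import measurable_realfun.
From mathcomp Require Import ring lra zify.
Set Implicit Arguments.
Unset Strict Implicit.
Unset Printing Implicit Defensive.
Import Order.TTheory GRing.Theory Num.Theory.
Import numFieldNormedType.Exports.
Local Open Scope classical_set_scope.
Local Open Scope ring_scope.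

(* Let f be a map of the family with irrational rotation number, and let
   T u = (f' o f^-1) (u o f^-1), so that the (-1)-measures of f are the T-invariant probability
   measures.  The infinitesimal cross-ratio inequality [distortion_pair], which holds for
   diffeomorphisms and for multicritical maps, yields real bounds for the closest returns of f;
   with a partition of unity adapted to these returns they show that every 1-periodic continuous
   function u lies, up to an arbitrarily small error, between two functions of the form
   c + T h - h with the same constant c = lambda(u).  The functional lambda is positive, linear
   and T-invariant; it is the integral against the unique (-1)-measure of f.

   If v is the velocity of the family in a direction w, and h is a corrector for v o f^-1, then
   conjugating by x - h(x) compares f with the perturbed map, and the sign of lambda(v o f^-1)
   decides whether the rotation number increases or decreases.  Since the rotation number is
   strictly monotone in lambda_1 at irrational values, this confines the tongue to thin cones
   around the hyperplane lambda(v o f^-1) = 0.  The same correctors are nearly optimal for nearby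
   maps, whence the continuity of the derivative. *)

(** * Lifts and rotation numbers *)

(** The derivative of a multicritical map vanishes somewhere, so its iterates have no two-sided
    distortion bounds. The pair inequality survives because it only bounds the product F'(a) F'(b)
    from above, and such a bound is trivial where F' vanishes. It yields one-sided cross-ratio
    control, and all later estimates use only upper bounds on derivatives of iterates. The partition
    of unity gives at first a multiplicative statement: for w >= 0 there is m >= 0 such that, modulo
    coboundaries, w lies between m and C m + e, where C depends on the map only. This improves
    itself: applied to u minus a nearly optimal lower constant, it forces m to be nearly 0, so the
    best lower and upper constants of u coincide. The perturbation theory is then carried out with
    the continuous correctors h alone; the measure enters only to express lambda as an integral.
    Rotation numbers are compared through semiconjugacy inequalities, for which x - h(x) only has to
    stay at bounded distance from x. *)

Lemma eps_cvgP (R : realType) (f : R -> R) (x l : R) :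
  (f y @[y --> x] --> l) <->
  (forall e : R, 0 < e -> exists2 d : R, 0 < d & forall y, `|x - y| < d -> `|l - f y| < e).
Proof.
split=> [fx e e0|H].
  have /cvgrPdist_lt/(_ e e0)/nbhs_ballP[d d0 D] := fx.
  by exists d => // y xy; apply: D; rewrite -ball_normE.
apply/cvgrPdist_lt => e e0; have [d d0 D] := H e e0.
by apply/nbhs_ballP; exists d => // y; rewrite -ball_normE /=; exact: D.
Qed.

Lemma eps_continuousP (R : realType) (f : R -> R) (x : R) :
  {for x, continuous f} <->
  (forall e : R, 0 < e -> exists2 d : R, 0 < d & forall y, `|x - y| < d -> `|f x - f y| < e).
Proof. exact: eps_cvgP. Qed.

Section Lift.
Context {R : realType}.
Implicit Types (F : R -> R) (x y : R).

Lemma homeo_int F (hF : circle_homeo F) x (j : int) : F (x + j%:~R) = F x + j%:~R.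
Proof.
case: hF => _ _ F1.
have Fn (n : nat) z : F (z + n%:R) = F z + n%:R.
  elim: n z => [|n IH] z; first by rewrite !addr0.
  by rewrite -natr1 !addrA F1 IH.
case: j => n; first exact: Fn.
rewrite NegzE mulrNz; apply: (addIr n.+1%:R).
by rewrite -[LHS]Fn !subrK.
Qed.

Lemma homeo_lt F (hF : circle_homeo F) x y : (F x < F y) = (x < y).
Proof.
case: hF => _ Flt _; apply/idP/idP; last exact: Flt.
by case: (ltgtP x y) => // [/Flt h1 h2|->]; rewrite ?ltxx //; lra.
Qed.

Lemma homeo_le F (hF : circle_homeo F) x y : (F x <= F y) = (x <= y).
Proof. by rewrite !leNgt (homeo_lt hF). Qed.

Lemma homeo_iter F (hF : circle_homeo F) n : circle_homeo (iter n F).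
Proof.
elim: n => [|n [Ic Il I1]]; first by split => // x; exact: cvg_id.
case: (hF) => Fc Fl F1; split => /=.
- by move=> x; apply: continuous_comp; [exact: Ic|exact: Fc].
- by move=> x y xy; apply: Fl; exact: Il.
- by move=> x; rewrite I1 F1.
Qed.

Lemma floor_dec x : exists (j : int) (r : R), [/\ x = r + j%:~R, 0 <= r & r < 1].
Proof.
exists (Num.floor x), (x - (Num.floor x)%:~R); rewrite subrK.
have := floor_le_tmp x; have := floorD1_gt x; rewrite intrD /= => h1 h2.
split => //; lra.
Qed.

Lemma homeo_surj F (hF : circle_homeo F) y : exists x, F x = y.
Proof.
have [j [r [Er r0 r1]]] := floor_dec (y - F 0).
have [c _ cE] : exists2 c, c \in `[0, 1]%R & F c = F 0 + r.
  apply: IVT => //; first by apply: continuous_subspaceT; case: hF.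
  have F01 : F 1 = F 0 + 1 by case: hF => _ _ F1; rewrite -F1 add0r.
  by rewrite F01 ge_min le_max; apply/andP; split; apply/orP; [left|right]; lra.
exists (c + j%:~R); rewrite (homeo_int hF) cE; lra.
Qed.

Lemma inv_mapK F (hF : circle_homeo F) y : F (inv_map F y) = y.
Proof.
have [x xE] := homeo_surj hF y; rewrite /inv_map.
by case: xgetP => [z _ //|/(_ x)] /=.
Qed.

Lemma inv_mapE F (hF : circle_homeo F) x : inv_map F (F x) = x.
Proof.
have := inv_mapK hF (F x).
by case: (ltgtP (inv_map F (F x)) x) => //; rewrite -(homeo_lt hF) => + E; rewrite E ltxx.
Qed.

Lemma homeo_inv F (hF : circle_homeo F) : circle_homeo (inv_map F).
Proof.
have iK := inv_mapK hF; have iE := inv_mapE hF.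
have ilt : {homo inv_map F : x y / x < y} by move=> x y xy; rewrite -(homeo_lt hF) !iK.
have i1 x : inv_map F (x + 1) = inv_map F x + 1.
  by case: (hF) => _ _ F1; rewrite -{1}(iK x) -F1 iE.
split=> // y; apply/eps_continuousP => e e0.
set x := inv_map F y.
have h1 : F (x - e) < F x by rewrite (homeo_lt hF); lra.
have h2 : F x < F (x + e) by rewrite (homeo_lt hF); lra.
rewrite iK in h1 h2.
exists (Num.min (y - F (x - e)) (F (x + e) - y)); first by rewrite lt_min; apply/andP; split; lra.
move=> z; rewrite lt_min !ltr_norml => /andP[/andP[a1 a2] /andP[a3 a4]].
have : inv_map F z < x + e by rewrite -(homeo_lt hF) iK; lra.
have : x - e < inv_map F z by rewrite -(homeo_lt hF) iK; lra.
by move=> b1 b2; apply/andP; split; lra.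
Qed.

Lemma iter_inv_mapK F (hF : circle_homeo F) n y : iter n F (iter n (inv_map F) y) = y.
Proof. by elim: n y => // n IH y; rewrite iterSr /= inv_mapK. Qed.

Lemma iter_inv_mapE F (hF : circle_homeo F) n y : iter n (inv_map F) (iter n F y) = y.
Proof. by elim: n y => // n IH y; rewrite iterSr /= inv_mapE. Qed.

Lemma homeo_disp F (hF : circle_homeo F) x : `|F x - x - F 0| <= 1.
Proof.
have [j [r [-> r0 r1]]] := floor_dec x; rewrite (homeo_int hF).
have F01 : F 1 = F 0 + 1 by case: hF => _ _ F1; rewrite -F1 add0r.
have : F 0 <= F r by rewrite (homeo_le hF).
have : F r <= F 1 by rewrite (homeo_le hF) ltW.
by rewrite F01 => h1 h2; rewrite ler_norml; apply/andP; split; lra.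
Qed.

(** By [homeo_disp] for F^m, each of the n applications of F^m displaces its point by F^m(0) up to
    an error 1. *)
Lemma iter_iter_bound F (hF : circle_homeo F) m n :
  `|iter (n * m) F 0 - n%:R * iter m F 0| <= n%:R.
Proof.
elim: n => [|n IH]; first by rewrite mul0r subrr normr0.
rewrite mulSn iterD -natr1 mulrDl mul1r.
have := homeo_disp (homeo_iter hF m) (iter (n * m) F 0).
move: IH; rewrite !ler_norml => /andP[a1 a2] /andP[a3 a4].
by apply/andP; split; lra.
Qed.

(** Both quotients are compared with F^(n m)(0) / (m n), which is symmetric in m and n. *)
Lemma rotation_quotient_bound F (hF : circle_homeo F) m n : (0 < m)%N -> (0 < n)%N ->
  `|iter m F 0 / m%:R - iter n F 0 / n%:R| <= m%:R^-1 + n%:R^-1.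
Proof.
move=> m0 n0.
have mR : 0 < m%:R :> R by rewrite ltr0n.
have nR : 0 < n%:R :> R by rewrite ltr0n.
have H1 := iter_iter_bound hF m n; have H2 := iter_iter_bound hF n m.
rewrite mulnC in H2.
have -> : iter m F 0 / m%:R - iter n F 0 / n%:R =
  ((iter (n * m) F 0 - m%:R * iter n F 0) - (iter (n * m) F 0 - n%:R * iter m F 0)) / (m%:R * n%:R).
  by field; rewrite !lt0r_neq0.
rewrite normrM [X in _ * X]gtr0_norm ?invr_gt0 ?mulr_gt0// ler_pdivrMr ?mulr_gt0//.
have -> : (m%:R^-1 + n%:R^-1) * (m%:R * n%:R) = m%:R + n%:R :> R.
  by field; rewrite !lt0r_neq0.
by apply: (le_trans (ler_normB _ _)); rewrite lerD.
Qed.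

(** The quotient bound is a Cauchy estimate, so [lim] is a genuine limit; letting n tend to infinity
    in it leaves the error 1 / m. *)
Lemma rotation_number_approx F (hF : circle_homeo F) m :
  `|iter m F 0 - m%:R * rotation_number F| <= 1.
Proof.
have cv : cvg ((fun m : nat => iter m F 0 / m%:R) @ \oo).
  apply: cauchy_cvg; apply/cauchy_ballP => e e0.
  rewrite near_map2.
  have [N N0 HN] : exists2 N : nat, (0 < N)%N & forall n : nat, (N <= n)%N -> n%:R^-1 < e / 2.
    exists (Num.bound (2 / e)).+1 => // n Nn.
    have h : 2 / e < n%:R.
      apply: (lt_le_trans (archi_boundP _)); first by rewrite divr_ge0 // ltW.
      by rewrite ler_nat (leq_trans _ Nn).
    rewrite -[ltRHS]invrK ltf_pV2 ?posrE ?invr_gt0 ?divr_gt0//; first by rewrite invf_div.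
    by rewrite (lt_trans _ h) // divr_gt0.
  exists ([set n | (N <= n)%N], [set n | (N <= n)%N]); first by split; exists N.
  move=> [a b] /= [Na Nb]; rewrite -ball_normE /=.
  apply: (le_lt_trans (rotation_quotient_bound hF _ _)); rewrite ?(leq_trans N0)//.
  by have := HN _ Na; have := HN _ Nb; lra.
case: m => [|m]; first by rewrite mul0r subrr normr0 ler01.
have m0 : 0 < m.+1%:R :> R by rewrite ltr0n.
suff H : `|iter m.+1 F 0 / m.+1%:R - rotation_number F| <= m.+1%:R^-1.
  have -> : iter m.+1 F 0 - m.+1%:R * rotation_number F =
     m.+1%:R * (iter m.+1 F 0 / m.+1%:R - rotation_number F).
    by field; rewrite addrC natr1 lt0r_neq0.
  by rewrite normrM gtr0_norm // -[leRHS](mulfV (lt0r_neq0 m0)) ler_pM2l.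
have cvN : (fun n : nat => m.+1%:R^-1 + n.+1%:R^-1 : R) @ \oo --> (m.+1%:R^-1 : R).
  rewrite -[X in _ --> X]addr0; apply: cvgD; first exact: cvg_cst.
  exact: cvg_harmonic.
have cvL : (fun n : nat => `|iter m.+1 F 0 / m.+1%:R - iter n.+1 F 0 / n.+1%:R|) @ \oo -->
    `|iter m.+1 F 0 / m.+1%:R - rotation_number F|.
  apply: cvg_norm; apply: cvgB; first exact: cvg_cst.
  by rewrite -(@cvg_shiftS _ (fun n : nat => iter n F 0 / n%:R)) in cv *.
apply: (ler_cvg_to cvL cvN); near=> n.
exact: rotation_quotient_bound.
Unshelve. all: by end_near. Qed.
End Lift.

(** Turns an inequality between n-th iterates, with an error independent of n, into one between
    rotation numbers. *)
Lemma archi_le0 (R : realType) (a B : R) : (forall n : nat, n%:R * a <= B) -> a <= 0.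
Proof.
move=> H; rewrite leNgt; apply/negP => a0.
have [B0|B0] := ltP B 0; first by have := H 0%N; rewrite mul0r; lra.
have := archi_boundP (divr_ge0 B0 (ltW a0)); rewrite ltr_pdivrMr // => h.
by have := H (Num.bound (B / a)); lra.
Qed.

Section RotationNumber.
Context {R : realType}.
Implicit Types (F G : R -> R) (x y : R).

Lemma iter_disp F (hF : circle_homeo F) m x :
  `|iter m F x - x - m%:R * rotation_number F| <= 2.
Proof.
have := homeo_disp (homeo_iter hF m) x; have := rotation_number_approx hF m.
rewrite !ler_norml => /andP[a1 a2] /andP[a3 a4]; apply/andP; split; lra.
Qed.

Lemma iter_int F (hF : circle_homeo F) m x (j : int) :
  iter m F (x + j%:~R) = iter m F x + j%:~R.
Proof. exact: homeo_int (homeo_iter hF m) _ _. Qed.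

Lemma iter_intB F (hF : circle_homeo F) m x (j : int) :
  iter m F (x - j%:~R) = iter m F x - j%:~R.
Proof. by rewrite -mulrNz (iter_int hF) mulrNz. Qed.

Lemma iter_lt F (hF : circle_homeo F) m x y : (iter m F x < iter m F y) = (x < y).
Proof. exact: homeo_lt (homeo_iter hF m) _ _. Qed.

Lemma iter_le F (hF : circle_homeo F) m x y : (iter m F x <= iter m F y) = (x <= y).
Proof. exact: homeo_le (homeo_iter hF m) _ _. Qed.

Lemma iter_ge_mul F (hF : circle_homeo F) q (p : int) x n :
  x + p%:~R <= iter q F x -> x + n%:R * p%:~R <= iter (n * q) F x.
Proof.
move=> H; elim: n => [|n IH]; first by rewrite mul0r addr0.
rewrite mulSn addnC iterD -natr1 mulrDl mul1r.
have : iter (n * q) F (x + p%:~R) <= iter (n * q) F (iter q F x) by rewrite (iter_le hF).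
by rewrite (iter_int hF) -iterD; lra.
Qed.

Lemma iter_le_mul F (hF : circle_homeo F) q (p : int) x n :
  iter q F x <= x + p%:~R -> iter (n * q) F x <= x + n%:R * p%:~R.
Proof.
move=> H; elim: n => [|n IH]; first by rewrite mul0r addr0.
rewrite mulSn addnC iterD -natr1 mulrDl mul1r.
have : iter (n * q) F (iter q F x) <= iter (n * q) F (x + p%:~R) by rewrite (iter_le hF).
by rewrite (iter_int hF) -iterD; lra.
Qed.

Lemma rotation_number_ge F (hF : circle_homeo F) q (p : int) x :
  x + p%:~R <= iter q F x -> p%:~R <= q%:R * rotation_number F.
Proof.
move=> H; rewrite -subr_le0; apply: (@archi_le0 _ _ 2) => n.
have := iter_ge_mul hF n H; have := iter_disp hF (n * q) x.
rewrite natrM ler_norml => /andP[a1 a2] h; lra.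
Qed.

Lemma rotation_number_le F (hF : circle_homeo F) q (p : int) x :
  iter q F x <= x + p%:~R -> q%:R * rotation_number F <= p%:~R.
Proof.
move=> H; rewrite -subr_le0; apply: (@archi_le0 _ _ 2) => n.
have := iter_le_mul hF n H; have := iter_disp hF (n * q) x.
rewrite natrM ler_norml => /andP[a1 a2] h; lra.
Qed.

(** The monotonicity of G carries the inequality to iterates, and the bound on phi - id carries it
    to rotation numbers. No monotonicity or continuity is asked of phi, which suits the maps x -
    h(x) used below. *)
Lemma rotation_number_semiconj F G (hF : circle_homeo F) (hG : circle_homeo G)
  (phi : R -> R) (B : R) : (forall x, `|phi x - x| <= B) ->
  (forall x, phi (F x) <= G (phi x)) -> rotation_number F <= rotation_number G.
Proof.
move=> phiB H; rewrite -subr_le0; apply: (@archi_le0 _ _ (4 + 2 * B)) => n.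
have : phi (iter n F 0) <= iter n G (phi 0).
  elim: n => // n IH; apply: (le_trans (H _)) => /=.
  by rewrite (homeo_le hG).
have := iter_disp hF n 0; have := iter_disp hG n (phi 0).
have := phiB 0; have := phiB (iter n F 0).
rewrite !ler_norml => /andP[a1 a2] /andP[a3 a4] /andP[a5 a6] /andP[a7 a8] h; lra.
Qed.

Lemma rotation_number_semiconj_ge F G (hF : circle_homeo F) (hG : circle_homeo G)
  (phi : R -> R) (B : R) : (forall x, `|phi x - x| <= B) ->
  (forall x, G (phi x) <= phi (F x)) -> rotation_number G <= rotation_number F.
Proof.
move=> phiB H; rewrite -subr_le0; apply: (@archi_le0 _ _ (4 + 2 * B)) => n.
have : iter n G (phi 0) <= phi (iter n F 0).
  elim: n => // n IH; apply: (le_trans _ (H _)) => /=.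
  by rewrite (homeo_le hG).
have := iter_disp hF n 0; have := iter_disp hG n (phi 0).
have := phiB 0; have := phiB (iter n F 0).
rewrite !ler_norml => /andP[a1 a2] /andP[a3 a4] /andP[a5 a6] /andP[a7 a8] h; lra.
Qed.

Lemma iter_stable F (hF : circle_homeo F) m x (e : R) : 0 < e ->
  exists2 d : R, 0 < d & forall G, (forall y, `|F y - G y| <= d) ->
    `|iter m F x - iter m G x| <= e.
Proof.
elim: m e => [|m IH] e e0; first by exists 1 => // G _; rewrite subrr normr0 ltW.
have Fc : {for iter m F x, continuous F} by case: hF => + _ _; exact.
have e2 : 0 < e / 2 by rewrite divr_gt0.
have [d1 d10 D1] := (eps_continuousP _ _).1 Fc _ e2.
have d2 : 0 < d1 / 2 by rewrite divr_gt0.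
have [d3 d30 D3] := IH _ d2.
exists (Num.min d3 (e / 2)); first by rewrite lt_min d30.
move=> G HG /=.
have h : `|iter m F x - iter m G x| < d1.
  apply: (le_lt_trans (D3 G _)); last by lra.
  by move=> y; apply: (le_trans (HG y)); rewrite ge_min lexx.
have := D1 _ h; have := HG (iter m G x); rewrite le_min => /andP[_].
rewrite !ler_norml !ltr_norml => /andP[a1 a2] /andP[a3 a4]; apply/andP; split; lra.
Qed.

Lemma rotation_number_continuous F (hF : circle_homeo F) (e : R) : 0 < e ->
  exists2 d : R, 0 < d & forall G, circle_homeo G -> (forall y, `|F y - G y| <= d) ->
    `|rotation_number F - rotation_number G| <= e.
Proof.
(* The 3 counts three errors of size 1: m times each rotation number is replaced by the m-th iterate
   at 0, and the two iterates differ by at most 1. *)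
move=> e0; pose m := (Num.bound (3 / e)).+1.
have m0 : 0 < m%:R :> R by rewrite ltr0n.
have me : 3 < m%:R * e.
  rewrite -ltr_pdivrMr //; apply: (lt_le_trans (archi_boundP _)).
    by rewrite divr_ge0 // ltW.
  by rewrite ler_nat.
have [d d0 D] := iter_stable hF m 0 (ltr01 : 0 < 1 :> R).
exists d => // G hG /D.
have := rotation_number_approx hF m; have := rotation_number_approx hG m.
rewrite !ler_norml => /andP[a1 a2] /andP[a3 a4] /andP[a5 a6].
by apply/andP; split; rewrite -(ler_pM2l m0); lra.
Qed.

Lemma iter_gt_rotation F (hF : circle_homeo F) r (s : int) x :
  s%:~R < r%:R * rotation_number F -> x + s%:~R < iter r F x.
Proof. by move=> H; rewrite ltNge; apply/negP => /(rotation_number_le hF); lra. Qed.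

Lemma iter_lt_rotation F (hF : circle_homeo F) r (s : int) x :
  r%:R * rotation_number F < s%:~R -> iter r F x < x + s%:~R.
Proof. by move=> H; rewrite ltNge; apply/negP => /(rotation_number_ge hF); lra. Qed.

(** For i <= i' everything reduces to how far F^(i' - i) moves the single point F^i x, compared with
    the integer j' - j; the rotation number decides this. The other case is symmetric. *)
Lemma orbit_order F (hF : circle_homeo F) i i' (j j' : int) x :
  i%:R * rotation_number F - j%:~R < i'%:R * rotation_number F - j'%:~R ->
  iter i F x - j%:~R < iter i' F x - j'%:~R.
Proof.
move=> H; case: (leqP i i') => ii'.
  have := @iter_gt_rotation F hF (i' - i) (j' - j) (iter i F x).
  by rewrite natrB // -iterD subnK // intrB; lra.
have := @iter_lt_rotation F hF (i - i') (j - j') (iter i' F x).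
by rewrite natrB ?(ltnW ii') // -iterD subnK ?(ltnW ii') // intrB; lra.
Qed.

(** Equality of the two rotation values would make the rotation number rational, unless i = i' and
    then j = j'. *)
Lemma orbit_order_le F (hF : circle_homeo F) i i' (j j' : int) x :
  irrational (rotation_number F) ->
  i%:R * rotation_number F - j%:~R <= i'%:R * rotation_number F - j'%:~R ->
  iter i F x - j%:~R <= iter i' F x - j'%:~R.
Proof.
move=> irr; rewrite le_eqVlt => /orP[/eqP E|/(orbit_order hF)]; last by move=> /(_ x)/ltW.
have {}E : (i%:R - i'%:R) * rotation_number F = (j - j')%:~R by rewrite intrB; lra.
have [ii'|ii'] := eqVneq i i'.
  move: E; rewrite ii' subrr mul0r => /esym/eqP; rewrite intr_eq0 subr_eq0 => /eqP ->.
  by [].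
exfalso; apply: irr; apply/rationalP.
have ne : i%:R - i'%:R != 0 :> R by rewrite subr_eq0 eqr_nat.
have E' : rotation_number F = (j - j')%:~R / (i%:R - i'%:R) by rewrite -E; field.
have [lt|le] := ltnP i i'.
  exists (j' - j), (i' - i)%N; rewrite E' natrB ?(ltnW lt) // !intrB.
  have ne' : i'%:R - i%:R != 0 :> R by rewrite subr_eq0 eqr_nat eq_sym.
  by field; rewrite ne ne'.
by exists (j - j'), (i - i')%N; rewrite E' natrB.
Qed.

End RotationNumber.

(** * Closest returns *)

Section Scales.
Context {R : realType}.
Implicit Types (a e t : R).

(* The order structure of two consecutive closest returns q < Q of the rotation by a, the first
   one on the right of the starting point. *)
Record scale a (q : nat) (p : int) (Q : nat) (P : int) : Prop := Scale {
  scale_q : (0 < q)%N;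
  scale_Q : (q < Q)%N;
  scale_pos : 0 < q%:R * a - p%:~R;
  scale_neg : Q%:R * a - P%:~R < 0;
  scale_lt : P%:~R - Q%:R * a < q%:R * a - p%:~R;
  scale_half : q%:R * a - p%:~R < 1 / 2;
  scale_best : forall (i : nat) (j : int), (0 < i < Q)%N ->
    q%:R * a - p%:~R <= `|i%:R * a - j%:~R| }.

Lemma irrational_neq a (i : nat) (j : int) : irrational a -> (0 < i)%N -> i%:R * a - j%:~R != 0.
Proof.
move=> irr i0; apply/eqP => E; apply: irr; apply/rationalP; exists j, i.
by rewrite -[j%:~R](subrK (i%:R * a)) -opprB E oppr0 add0r mulrC mulKf // pnatr_eq0 -lt0n.
Qed.

(** Repeated halving: if t is the distance from i a to an integer and k the integer part of 1 / t,
    then k t <= 1 < (k + 1) t, so one of the multiples k i and (k + 1) i brings a within t / 2 of an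
    integer. *)
Lemma dirichlet a e : irrational a -> 0 < e ->
  exists (i : nat) (j : int), (0 < i)%N /\ `|i%:R * a - j%:~R| < e.
Proof.
move=> irr e0.
have H (n : nat) : exists (i : nat) (j : int), (0 < i)%N /\ `|i%:R * a - j%:~R| <= (1 / 2) ^+ n.
  elim: n => [|n [i [j [i0 ij]]]].
    have [j [r [Er r0 r1]]] := floor_dec a.
    exists 1%N, j; split => //; rewrite mul1r expr0 ger0_norm; lra.
  set t := i%:R * a - j%:~R in ij *.
  have t0 : 0 < `|t| by rewrite normr_gt0 irrational_neq.
  have t1 : `|t| <= 1.
    by apply: (le_trans ij); apply: exprn_ile1; lra.
  have ti : 1 <= `|t|^-1 by rewrite invf_ge1.
  have /andP[] : (Num.trunc `|t|^-1)%:R <= `|t|^-1 < (Num.trunc `|t|^-1).+1%:R.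
    by apply: truncn_itv; rewrite invr_ge0.
  have k0 : (0 < Num.trunc `|t|^-1)%N by rewrite truncn_gt0.
  set k := Num.trunc _ in k0 *.
  rewrite -(ler_pM2r t0) -(ltr_pM2r t0) mulVf ?gt_eqF // -natr1 => k1 k2.
  (* The sign of t, taken as an integer so that it can enter the integer part of the new return. *)
  have [s [ts ss]] : exists s : int, `|t| = s%:~R * t /\ s%:~R * s%:~R = 1 :> R.
    have [t'|t'] := lerP 0 t.
      by exists 1%N%:Z; rewrite ger0_norm //; split; rewrite -[1%N%:~R]/(1 : R) mul1r.
    by exists (- 1%N%:Z); rewrite ltr0_norm // mulrNz -[1%N%:~R]/(1 : R) !mulN1r opprK.
  have s1 : `|s%:~R| = 1 :> R.
    by apply/eqP; rewrite -(@eqrXn2 _ 2) // -normrX expr2 ss normr1 expr1n.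
  have kt (m : nat) : `|(m * i)%:R * a - (m%:Z * j + s)%:~R| = `|m%:R * `|t| - 1|.
    rewrite natrM intrD intrM -[LHS]mul1r -[X in X * _]s1 -normrM; congr (`| _ |).
    rewrite ts -[X in _ = _ - X]ss /t -[(m%:Z)%:~R]/(m%:R : R); ring.
  have [h|h] := lerP (1 - k%:R * `|t|) (`|t| / 2).
    exists (k * i)%N, (k%:Z * j + s); rewrite muln_gt0 k0 i0; split => //.
    rewrite kt exprS ler0_norm; lra.
  exists (k.+1 * i)%N, (k.+1%:Z * j + s); rewrite muln_gt0 i0; split => //.
  rewrite kt -natr1 exprS ger0_norm; lra.
have [N hN] : exists N : nat, (1 / 2) ^+ N < e.
  have h2 : `|1 / 2 : R| < 1 by rewrite ger0_norm; lra.
  have /cvgrPdist_lt/(_ _ e0)[N _ HN] := cvg_expr h2.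
  have p0 : 0 <= (1 / 2 : R) ^+ N by apply: exprn_ge0; lra.
  by exists N; have := HN N (leqnn _); rewrite /= sub0r normrN ger0_norm.
have [i [j [i0 ij]]] := H N.
by exists i, j; split => //; apply: le_lt_trans hN.
Qed.

(** As e <= 1/2, an integer within e of i a is the nearest one, every other being more than 1/2
    away; this gives the last clause for the least admissible i. *)
Lemma least_return a e : irrational a -> 0 < e -> e <= 1 / 2 -> exists (i : nat) (j : int),
  [/\ (0 < i)%N, `|i%:R * a - j%:~R| < e,
      forall i' (j' : int), (0 < i' < i)%N -> e <= `|i'%:R * a - j'%:~R| &
      forall j' : int, `|i%:R * a - j%:~R| <= `|i%:R * a - j'%:~R| ].
Proof.
move=> irr e0 e1; have [i1 [j1 [i10 ij1]]] := dirichlet irr e0.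
pose P i := (0 < i)%N && `[< exists j : int, `|i%:R * a - j%:~R| < e >].
have exP : exists i, P i by exists i1; rewrite /P i10; apply/asboolP; exists j1.
case: (ex_minnP exP) => i /andP[i0 /asboolP[j ij]] imin; exists i, j; split => //.
  move=> i' j' /andP[i'0 i'i]; rewrite leNgt; apply/negP => h.
  suff : (i <= i')%N by rewrite leqNgt i'i.
  by apply: imin; rewrite /P i'0; apply/asboolP; exists j'.
move=> j'; have [->//|ne] := eqVneq j j'.
have : 1 <= `|j%:~R - j'%:~R| :> R.
  by rewrite -intrB -intr_norm ler1z -gtz0_ge1 normr_gt0 subr_eq0.
have -> : j%:~R - j'%:~R = (i%:R * a - j'%:~R) - (i%:R * a - j%:~R) by ring.
by move=> /le_trans /(_ (ler_normB _ _)); lra.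
Qed.

(** Consecutive closest returns lie on opposite sides: if Q a - P and i a - j had the same sign,
    their difference would be a return at the earlier time Q - i, shorter than |i a - j|, against
    the minimality of Q. *)
Lemma next_return a (i : nat) (j : int) : irrational a -> (0 < i)%N ->
  `|i%:R * a - j%:~R| < 1 / 2 ->
  (forall i' (j' : int), (0 < i' <= i)%N -> `|i%:R * a - j%:~R| <= `|i'%:R * a - j'%:~R|) ->
  exists (Q : nat) (P : int), [/\ (i < Q)%N, `|Q%:R * a - P%:~R| < `|i%:R * a - j%:~R|,
    forall i' (j' : int), (0 < i' < Q)%N -> `|i%:R * a - j%:~R| <= `|i'%:R * a - j'%:~R|,
    forall i' (j' : int), (0 < i' <= Q)%N -> `|Q%:R * a - P%:~R| <= `|i'%:R * a - j'%:~R| &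
    (Q%:R * a - P%:~R) * (i%:R * a - j%:~R) < 0].
Proof.
move=> irr i0 lt best; set t := i%:R * a - j%:~R in lt best *.
have t0 : 0 < `|t| by rewrite normr_gt0 irrational_neq.
have [Q [P [Q0 QP Qmin Pmin]]] := least_return irr t0 (ltW lt).
have iQ : (i < Q)%N.
  by rewrite ltnNge; apply/negP => Qi; have := best Q P; rewrite Q0 Qi leNgt QP => /(_ isT).
exists Q, P; split => //.
  move=> i' j' /andP[i'0]; rewrite leq_eqVlt => /orP[/eqP ->//|i'Q].
  by rewrite (le_trans (ltW QP)) // Qmin // i'0.
rewrite ltNge; apply/negP => h.
have : `|t| <= `|(Q - i)%:R * a - (P - j)%:~R|.
  by apply: Qmin; rewrite subn_gt0 iQ ltn_subrL i0 Q0.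
rewrite natrB ?(ltnW iQ) // intrB.
have -> : (Q%:R - i%:R) * a - (P%:~R - j%:~R) = (Q%:R * a - P%:~R) - t by rewrite /t; ring.
have T0 : Q%:R * a - P%:~R != 0 by exact: irrational_neq.
move: h QP T0; set u := _ * a - _ => h ut u0.
have [tp|tn] := ltP 0 t.
  have up : 0 < u by rewrite lt_neqAle eq_sym u0 /=; rewrite pmulr_lge0 in h.
  move: ut; rewrite (gtr0_norm up) (gtr0_norm tp) => ut.
  by rewrite ler0_norm; lra.
have {}tn : t < 0 by rewrite lt_neqAle tn andbT -normr_gt0.
have up : u < 0 by rewrite lt_neqAle u0 /=; rewrite nmulr_lge0 in h.
move: ut; rewrite (ltr0_norm up) (ltr0_norm tn) => ut.
by rewrite ger0_norm; lra.
Qed.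

(** If the first closest return found lies on the left, the next one lies on the right by
    [next_return] and starts the pair instead. *)
Lemma scale_exists a e : irrational a -> 0 < e -> exists q p Q P,
  scale a q p Q P /\ q%:R * a - p%:~R < e.
Proof.
move=> irr e0; pose e' := Num.min e (1 / 2).
have e'0 : 0 < e' by rewrite lt_min e0 /=; lra.
have [i [j [i0 ij imin jmin]]] : exists (i : nat) (j : int), [/\ (0 < i)%N,
    `|i%:R * a - j%:~R| < e',
    forall i' (j' : int), (0 < i' <= i)%N -> `|i%:R * a - j%:~R| <= `|i'%:R * a - j'%:~R| &
    0 < i%:R * a - j%:~R].
  have [i [j [i0 ij imin jmin]]] := least_return irr e'0 (ltac:(by rewrite ge_min lexx orbT)).
  have best i' (j' : int) : (0 < i' <= i)%N -> `|i%:R * a - j%:~R| <= `|i'%:R * a - j'%:~R|.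
    move=> /andP[i'0]; rewrite leq_eqVlt => /orP[/eqP ->//|i'i].
    by rewrite (le_trans (ltW ij)) // imin // i'0.
  have [tp|tn] := ltP 0 (i%:R * a - j%:~R); first by exists i, j.
  have tn' : i%:R * a - j%:~R < 0 by rewrite lt_neqAle tn andbT irrational_neq.
  have lt2 : `|i%:R * a - j%:~R| < 1 / 2.
    by apply: (lt_le_trans ij); rewrite ge_min lexx orbT.
  have [Q [P [iQ QP _ Qb sg]]] := next_return irr i0 lt2 best.
  exists Q, P; split => //; first exact: leq_trans iQ.
    exact: lt_trans QP ij.
  by rewrite nmulr_llt0 in sg.
have lt2 : `|i%:R * a - j%:~R| < 1 / 2.
  by apply: (lt_le_trans ij); rewrite ge_min lexx orbT.
have [Q [P [iQ QP Qb _ sg]]] := next_return irr i0 lt2 imin.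
move: sg ij lt2 Qb QP; rewrite pmulr_llt0 // (gtr0_norm jmin) => sg ij lt2 Qb.
rewrite (ltr0_norm sg) opprB => QP.
exists i, j, Q, P; split; last by apply: (lt_le_trans ij); rewrite ge_min lexx.
by split.
Qed.

End Scales.

(** Instead of sorting the intervals, split them at the first one, u: those on its left fit in
    [A, u.1], the others in [u.2, B], and the induction on the length applies to both groups. *)
Lemma disjoint_sum (R : realType) (V : R -> R) (s : seq (R * R)) (A B : R) :
  {homo V : x y / x <= y} -> A <= B ->
  all (fun u => [&& A <= u.1, u.1 <= u.2 & u.2 <= B]) s ->
  pairwise (fun u v => (u.2 <= v.1) || (v.2 <= u.1)) s ->
  \sum_(u <- s) (V u.2 - V u.1) <= V B - V A.
Proof.
move=> Vh; have [n] := ubnP (size s); elim: n s A B => // n IH [|u s] A B.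
  by move=> _ AB _ _; rewrite big_nil subr_ge0 Vh.
rewrite ltnS /= => sn AB /andP[/and3P[u1 u2 u3] sAB] /andP[us ps].
rewrite big_cons (bigID (fun v => v.2 <= u.1)) /= -!(big_filter s).
have szn (P : pred (R * R)) : (size [seq x <- s | P x] < n)%N.
  by apply: leq_ltn_trans sn; rewrite size_filter count_size.
have h1 : \sum_(i <- [seq v <- s | v.2 <= u.1]) (V i.2 - V i.1) <= V u.1 - V A.
  apply: IH => //; last by rewrite pairwise_filter.
  apply/allP => v; rewrite mem_filter => /andP[vu vs].
  by have /and3P[-> -> _] := allP sAB _ vs; rewrite vu.
have h2 : \sum_(i <- [seq v <- s | ~~ (v.2 <= u.1)]) (V i.2 - V i.1) <= V B - V u.2.
  apply: IH => //; last by rewrite pairwise_filter.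
  apply/allP => v; rewrite mem_filter => /andP[vu vs].
  have /and3P[_ -> ->] := allP sAB _ vs; rewrite !andbT.
  by have := allP us _ vs; rewrite (negbTE vu) orbF.
lra.
Qed.

Definition return_map (R : realType) (F : R -> R) (q : nat) (p : int) (x : R) : R :=
  iter q F x - p%:~R.

Section Returns.
Context {R : realType} (F : R -> R) (hF : circle_homeo F).
Local Notation a := (rotation_number F).
Context (q : nat) (p : int) (Q : nat) (P : int).
Hypotheses (irr : irrational a) (sc : scale a q p Q P).
Local Notation g := (return_map F q p).
Implicit Types (x y z : R).

Lemma return_iter i x : iter i F (g x) = g (iter i F x).
Proof. by rewrite /return_map -mulrNz (iter_int hF) -!iterD addnC. Qed.

Lemma return_homeo : circle_homeo g.
Proof.
have [c l h1] := homeo_iter hF q; split.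
- by move=> x; apply: cvgB; [exact: c|exact: cvg_cst].
- by move=> x y xy; rewrite /return_map ltrD2r; exact: l.
- by move=> x; rewrite /return_map h1; lra.
Qed.

Lemma return_int x (j : int) : g (x + j%:~R) = g x + j%:~R.
Proof. exact: (homeo_int return_homeo). Qed.

Lemma return_intB x (j : int) : g (x - j%:~R) = g x - j%:~R.
Proof. by rewrite -mulrNz return_int mulrNz. Qed.

Lemma return_le x y : (g x <= g y) = (x <= y).
Proof. exact: (homeo_le return_homeo). Qed.

Lemma return_lt x y : (g x < g y) = (x < y).
Proof. exact: (homeo_lt return_homeo). Qed.

Lemma return_gt x : x < g x.
Proof.
have := @orbit_order _ F hF 0%N q 0 p x; rewrite /= mul0r subr0 => h.
by apply: le_lt_trans (h _); rewrite ?subr0 //; exact: scale_pos sc.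
Qed.

Lemma return_iterE k x : iter k g x = iter (k * q) F x - k%:R * p%:~R.
Proof.
elim: k => [|k IH]; first by rewrite mul0r subr0.
rewrite iterS {}IH -[k%:R * _]/(k%:Z%:~R * _) -intrM -mulrNz return_int /return_map.
by rewrite -iterD mulSn mulrNz intrM -natr1 -[k%:Z%:~R]/(k%:R : R); ring.
Qed.

(** The shorter return F^Q - P moves points to the left by less, in terms of the rotation, than g
    moves them to the right ([scale_lt]). *)
Lemma last_return_ge x : x <= g (iter Q F x - P%:~R).
Proof.
rewrite return_intB /return_map -iterD.
have := @orbit_order _ F hF 0%N (q + Q) 0 (p + P) x; rewrite /= mul0r subr0 => h.
have : 0 < (q + Q)%:R * a - (p + P)%:~R.
  by have := scale_lt sc; rewrite natrD intrD; lra.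
by move=> /h; rewrite intrD; lra.
Qed.

Lemma last_return_lt x : iter Q F x - P%:~R < x.
Proof.
have := @orbit_order _ F hF Q 0%N P 0 x; rewrite /= mul0r subr0 => h.
by have := scale_neg sc => /h; lra.
Qed.

(** Start from an integer translate of x on the left of z and apply g, whose iterates advance at
    mean speed q a - p > 0; the first point at or beyond z lies in [z, g z). *)
Lemma hit_long x z : exists (i : nat) (j : int), z <= iter i F x - j%:~R < g z.
Proof.
have [j0 [r [Er r0 r1]]] := floor_dec (z - x).
pose y := x + (j0 - 1)%:~R.
have yz : y < z by rewrite /y intrB; lra.
have t0 := scale_pos sc.
have [k kz] : exists k, z <= iter k g y.
  exists (Num.bound ((z - y + 2) / (q%:R * a - p%:~R))).
  set k := Num.bound _.
  have : (z - y + 2) / (q%:R * a - p%:~R) < k%:R.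
    by apply: archi_boundP; rewrite divr_ge0 ?ltW //; lra.
  rewrite ltr_pdivrMr // => h; rewrite return_iterE.
  have := iter_disp hF (k * q) y; rewrite natrM ler_norml => /andP[h1 h2]; lra.
have [[|k'] hk kmin] := ex_minnP (ex_intro (fun k => z <= iter k g y) k kz).
  by move: hk => /=; lra.
exists (k'.+1 * q)%N, (k'.+1%:Z * p - (j0 - 1)).
have -> : iter (k'.+1 * q) F x - (k'.+1%:Z * p - (j0 - 1))%:~R = iter k'.+1 g y.
  by rewrite return_iterE /y (iter_int hF) intrB intrM -[k'.+1%:~R]/(k'.+1%:R : R); ring.
rewrite hk /= return_lt ltNge; apply/negP => /kmin; by rewrite ltnn.
Qed.

(** Take the first visit to [z', g (g z)), where z' = F^Q (g z) - P lies in [z, g z). A visit at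
    time Q or later would have a predecessor in the same window: points below g z' come from [g z, g
    (g z)) under F^Q - P, the others from [z', g z) under g. *)
Lemma hit_window x z : exists (i : nat) (j : int), (i < Q)%N /\ z <= iter i F x - j%:~R < g (g z).
Proof.
pose z' := iter Q F (g z) - P%:~R.
have zz' : z <= z' by have := last_return_ge z; rewrite /z' return_iter return_intB.
have z'g : z' < g z by exact: last_return_lt.
pose Pr i := `[< exists j : int, z' <= iter i F x - j%:~R < g (g z) >].
have exi : exists i, Pr i.
  have [i [j /andP[h1 h2]]] := hit_long x (g z).
  by exists i; apply/asboolP; exists j; rewrite h2 andbT ltW // (lt_le_trans z'g).
case: (ex_minnP exi) => i /asboolP[j /andP[h1 h2]] imin.
exists i, j; rewrite h2 (le_trans zz' h1); split => //; rewrite ltnNge; apply/negP => Qi.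
have [lt|ge] := ltP (iter i F x - j%:~R) (g z').
  suff : (i <= i - Q)%N.
    by rewrite leqNgt ltn_subrL (leq_ltn_trans _ (scale_Q sc)) // (leq_trans _ Qi) //
      (leq_ltn_trans _ (scale_Q sc)).
  apply: imin; apply/asboolP; exists (j - P).
  have E : iter i F x - j%:~R = iter Q F (iter (i - Q) F x - (j - P)%:~R) - P%:~R.
    by rewrite (iter_intB hF) -iterD subnKC // intrB; lra.
  apply/andP; split.
    by rewrite ltW //; apply: (le_lt_trans h1); rewrite E; exact: last_return_lt.
  rewrite -(iter_lt hF Q); apply: (@lt_le_trans _ _ (g z' + P%:~R)); first by lra.
  by rewrite /z' return_intB subrK !return_iter.
have qi : (q <= i)%N by rewrite (leq_trans (ltnW (scale_Q sc))).
suff : (i <= i - q)%N by rewrite leqNgt ltn_subrL (scale_q sc) (leq_trans (scale_q sc)).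
apply: imin; apply/asboolP; exists (j - p).
have E : iter i F x - j%:~R = g (iter (i - q) F x - (j - p)%:~R).
  by rewrite return_intB /return_map -iterD subnKC // intrB; lra.
by move: ge h2; rewrite E return_le return_lt => -> h2 /=; apply: lt_trans h2 (return_gt _).
Qed.

(** The intervals [F^i x, F^i (g x)] with i < Q do not overlap modulo 1, because no return at a time
    below Q is shorter than q a - p ([scale_best]). Together they therefore see at most the growth W
    of V over one period. *)
Lemma return_sum (V : R -> R) (W : R) x : {homo V : x y / x <= y} ->
  (forall x, V (x + 1) = V x + W) ->
  \sum_(0 <= i < Q) (V (iter i F (g x)) - V (iter i F x)) <= W.
Proof.
move=> Vh V1.
have Vj y (j : int) : V (y + j%:~R) = V y + j%:~R * W.
  have Vn (n : nat) z : V (z + n%:R) = V z + n%:R * W.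
    elim: n z => [|n IH] z; first by rewrite addr0 mul0r addr0.
    by rewrite -natr1 !addrA V1 IH; ring.
  case: j => n; first exact: Vn.
  rewrite NegzE mulrNz; apply: (addIr (n.+1%:R * W)).
  by rewrite -[LHS]Vn subrK -[n.+1%:~R]/(n.+1%:R : R); ring.
(* Translating by the integer part of i a brings the i-th interval into [x, x + 1]. *)
pose fl i := Num.floor (i%:R * a).
have fl1 i : 0 <= i%:R * a - (fl i)%:~R by rewrite subr_ge0 /fl floor_le_tmp.
have fl2 i : i%:R * a - (fl i)%:~R < 1.
  by have := floorD1_gt (i%:R * a); rewrite intrD -/(fl i) /=; lra.
pose I i := (iter i F x - (fl i)%:~R, iter i F (g x) - (fl i)%:~R).
have E i : (I i).2 = iter (i + q) F x - (fl i + p)%:~R.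
  by rewrite /I /= return_iter /return_map -iterD addnC intrD; lra.
have -> : \sum_(0 <= i < Q) (V (iter i F (g x)) - V (iter i F x)) =
    \sum_(u <- map I (iota 0 Q)) (V u.2 - V u.1).
  rewrite big_map /index_iota subn0; apply: eq_bigr => i _.
  by rewrite /I /= -!mulrNz !Vj; lra.
have -> : W = V (x + 1) - V x by rewrite V1; lra.
have ole := orbit_order_le hF.
apply: disjoint_sum => //; first by lra.
  apply/allP => u /mapP[i]; rewrite mem_iota add0n /= => iQ ->; rewrite E; apply/and3P; split.
  - have := @ole 0%N i 0 (fl i) x irr; rewrite /= mul0r !subr0; exact.
  - apply: ole => //; have := scale_pos sc; rewrite natrD intrD; lra.
  have := @ole (i + q)%N 0%N (fl i + p) (- 1) x irr.
  rewrite /= mulrNz mul0r opprK add0r; apply; rewrite natrD intrD -[1%:~R]/(1 : R).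
  case: i iQ => [|i] iQ; last first.
    have := scale_best sc (fl i.+1 + 1) (i := i.+1); rewrite iQ => /(_ isT).
    by rewrite intrD -[1%:~R]/(1 : R) ler0_norm; have := fl2 i.+1; lra.
  by have := scale_half sc; rewrite /fl mulr0n mul0r floor0; lra.
rewrite pairwise_map.
apply: (@sub_in_pairwise _ (mem (iota 0 Q)) [rel i j | i != j]); last 2 first.
- by apply/allP.
- by rewrite -uniq_pairwise iota_uniq.
move=> i j.
change (i \in iota 0 Q -> j \in iota 0 Q -> i != j ->
  ((I i).2 <= (I j).1) || ((I j).2 <= (I i).1)).
rewrite !mem_iota !add0n => /= iQ jQ ij; rewrite -![iter _ F (g x) - _]/(I _).2 !E /=.
wlog lij : i j iQ jQ ij / (i < j)%N.
  move=> H; have := ij; rewrite neq_ltn => /orP[h|h]; first exact: H.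
  by rewrite orbC; apply: H => //; rewrite eq_sym.
have := scale_best sc (fl j - fl i) (i := (j - i)%N).
rewrite subn_gt0 lij (leq_ltn_trans (leq_subr _ _)) // => /(_ isT).
rewrite natrB ?(ltnW lij) // intrB ler_normr => /orP[h|h].
  apply/orP; left; apply: ole => //; rewrite natrD intrD; lra.
apply/orP; right; apply: ole => //; rewrite natrD intrD; lra.
Qed.

End Returns.

(** * Cross-ratio distortion and real bounds *)

Lemma is_derive_MVT (R : realType) (f df : R -> R) (a b : R) : a <= b ->
  (forall x, a <= x <= b -> is_derive x 1 f (df x)) ->
  exists2 c, a <= c <= b & f b - f a = df c * (b - a).
Proof.
move=> ab H; have [||c cab ->] := @MVT_segment R f df a b ab.
- by move=> x /[!in_itv]/= /andP[/ltW h1 /ltW h2]; apply: H; rewrite h1 h2.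
- apply: continuous_in_subspaceT => x; rewrite inE /= in_itv /= => /H h.
  by apply: differentiable_continuous; apply/derivable1_diffP; case: h.
by exists c => //; move: cab; rewrite in_itv.
Qed.

Lemma ge0_is_derive_le (R : realType) (f df : R -> R) (a b : R) : a <= b ->
  (forall x, a <= x <= b -> is_derive x 1 f (df x)) ->
  (forall x, a <= x <= b -> 0 <= df x) -> f a <= f b.
Proof.
move=> ab H H0; have [c cab E] := is_derive_MVT ab H.
by rewrite -subr_ge0 E mulr_ge0 ?subr_ge0 // H0.
Qed.

Section CrossRatio.
Context {R : realType} (G DG : R -> R) (A B E : R).
Hypotheses (Glt : {homo G : x y / x < y})
  (dG : forall x : R, is_derive x 1 G (DG x))
  (pairE : forall a b, A <= a -> a < b -> b <= B ->
     DG a * DG b * (b - a) ^+ 2 <= E * (G b - G a) ^+ 2).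
Implicit Types (x y : R).

Let Gsub x y : x < y -> 0 < G y - G x.
Proof. by move=> xy; rewrite subr_gt0 Glt. Qed.

(** The pair inequality at (x, t), divided by both squares, compares the t-derivatives of 1 / (G t -
    G x) and 1 / (t - x); this is its integral over t in [y0, y1]. *)
Lemma one_point_bound x y0 y1 : A <= x -> x < y0 -> y0 <= y1 -> y1 <= B ->
  DG x * ((G y0 - G x)^-1 - (G y1 - G x)^-1) <= E * ((y0 - x)^-1 - (y1 - x)^-1).
Proof.
move=> Ax xy0 y01 y1B.
suff : DG x * (G y0 - G x)^-1 - E * (y0 - x)^-1 <= DG x * (G y1 - G x)^-1 - E * (y1 - x)^-1.
  by lra.
pose f t : R := DG x * (G t - G x)^-1 - E * (t - x)^-1.
pose df t : R := DG x * (- (G t - G x) ^- 2 * DG t) - E * (- (t - x) ^- 2).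
apply: (@ge0_is_derive_le R f df _ _ y01) => t /andP[t0 t1].
  have xt : x < t by exact: lt_le_trans t0.
  have Gt := Gsub xt.
  have d1 : is_derive t 1 (fun t => G t - G x) (DG t).
    by apply: is_derive_eq; ring.
  have d2 : is_derive t 1 (fun t => t - x : R) 1.
    by apply: is_derive_eq; ring.
  have := @is_deriveV _ (fun t => G t - G x) _ _ _ (lt0r_neq0 Gt) d1.
  have xt' : t - x != 0 by rewrite subr_eq0 gt_eqF.
  have := @is_deriveV _ (fun t => t - x) _ _ _ xt' d2 => h2 h1.
  by apply: is_derive_eq; rewrite /df /GRing.scale /=; ring.
have xt : x < t by exact: lt_le_trans t0.
have := pairE Ax xt (le_trans t1 y1B).
have Gt := Gsub xt; have tx : 0 < t - x by lra.
rewrite -ler_pdivlMr ?exprn_gt0 // => h.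
rewrite /df subr_ge0 mulrN mulNr mulrN lerN2.
rewrite mulrCA -ler_pdivlMl ?invr_gt0 ?exprn_gt0 // invrK.
by apply: (le_trans h); rewrite mulrAC [X in _ <= X]mulrC mulrA.
Qed.

(** Second integration, now over the point x in [a, a']: the infinitesimal inequality becomes a
    bound on the distortion of a finite cross-ratio. *)
Lemma ln_cross_ratio a a' y0 y1 : A <= a -> a <= a' -> a' < y0 -> y0 <= y1 -> y1 <= B ->
  ln (G y1 - G a') - ln (G y0 - G a') - (ln (G y1 - G a) - ln (G y0 - G a)) <=
  E * (ln (y1 - a') - ln (y0 - a') - (ln (y1 - a) - ln (y0 - a))).
Proof.
move=> Aa aa' ay0 y01 y1B.
pose f t : R := - (ln (G y1 - G t) - ln (G y0 - G t) - E * (ln (y1 - t) - ln (y0 - t))).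
pose df t : R := - (- DG t * (G y1 - G t)^-1 + DG t * (G y0 - G t)^-1
   - E * (- (y1 - t)^-1 + (y0 - t)^-1)).
suff : f a <= f a' by rewrite /f; lra.
apply: (@ge0_is_derive_le R f df _ _ aa') => t /andP[t0 t1].
  have ty0 : t < y0 by exact: le_lt_trans ay0.
  have ty1 : t < y1 by exact: lt_le_trans y01.
  have dGy y : is_derive t 1 (fun t => G y - G t) (- DG t).
    by apply: is_derive_eq; ring.
  have dy (y : R) : is_derive t 1 (fun t => y - t : R) (- 1).
    by apply: is_derive_eq; ring.
  have dl y : t < y -> is_derive t 1 (fun t => ln (G y - G t)) (- DG t * (G y - G t)^-1).
    move=> ty; have hl := is_derive1_ln (Gsub ty).
    by have := @is_derive1_comp _ _ (fun t => G y - G t) _ _ _ hl (dGy y) => h; apply: (is_derive_eq h); ring.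
  have dly (y : R) : t < y -> is_derive t 1 (fun t => ln (y - t)) (- (y - t)^-1).
    move=> ty; have hl := is_derive1_ln (ltac:(lra) : 0 < y - t).
    have := @is_derive1_comp _ _ (fun t => y - t) _ _ _ hl (dy y) => h.
    by apply: (is_derive_eq h); ring.
  have h1 := dl _ ty0; have h2 := dl _ ty1; have h3 := dly _ ty0; have h4 := dly _ ty1.
  by apply: is_derive_eq; rewrite /df /GRing.scale /=; ring.
have := @one_point_bound t y0 y1 (le_trans Aa t0) (le_lt_trans t1 ay0) y01 y1B.
by rewrite /df; lra.
Qed.

End CrossRatio.

(* [distortion_pair] is the infinitesimal cross-ratio inequality; the nondecreasing function V
   collects the distortion of F, with a jump at each critical point. *)
Record distorted (R : realType) (F V : R -> R) (W : R) : Prop := Distorted {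
  distortion_homeo : circle_homeo F;
  distortion_derivable : forall x : R, derivable F x 1;
  distortion_continuous : continuous (derive1 F : R -> R);
  distortion_homo : {homo V : x y / x <= y};
  distortion_period : forall x, V (x + 1) = V x + W;
  distortion_pair : forall a b, a < b ->
    derive1 F a * derive1 F b * (b - a) ^+ 2 <= (F b - F a) ^+ 2 * expR (V b - V a) }.
Arguments distortion_derivable {R F V W} _ _.
Arguments distortion_continuous {R F V W} _ _.

Definition iter_derive (R : realType) (F : R -> R) (i : nat) (x : R) : R :=
  \prod_(k < i) derive1 F (iter k F x).

Section Distorted.
Context {R : realType} (F V : R -> R) (W : R).
Hypothesis (dF : distorted F V W).
Implicit Types (x y : R).
Let hF := distortion_homeo dF.

Lemma distorted_derive1_ge0 x : 0 <= derive1 F x.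
Proof.
apply: (@incr_derive1_ge0 _ F setT).
- by move=> y _; exact: (distortion_derivable dF y).
- by move=> u v _ _ uv; rewrite (homeo_lt hF).
- by rewrite interiorT.
Qed.

Lemma periodic_derive1 (G : R -> R) (k : R) x : (forall x, G (x + 1) = G x + k) ->
  derive1 G (x + 1) = derive1 G x.
Proof.
move=> G1; rewrite !derive1E /derive.
suff -> : (fun h : R => h^-1 *: ((G \o shift (x + 1)) (h *: 1) - G (x + 1))) =
  (fun h => h^-1 *: ((G \o shift x) (h *: 1) - G x)) by [].
by apply/funext => h /=; rewrite addrA !G1; congr (_ *: _); lra.
Qed.

Lemma distorted_derive1_period x : derive1 F (x + 1) = derive1 F x.
Proof. by apply: (@periodic_derive1 F 1); case: hF. Qed.

Lemma derive1_int x (j : int) : derive1 F (x + j%:~R) = derive1 F x.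
Proof.
have Fn (n : nat) z : derive1 F (z + n%:R) = derive1 F z.
  elim: n z => [|n IH] z; first by rewrite !addr0.
  by rewrite -natr1 !addrA distorted_derive1_period IH.
case: j => n; first exact: Fn.
by rewrite NegzE mulrNz -[LHS](Fn n.+1) subrK.
Qed.

Lemma iter_derive_ge0 i x : 0 <= iter_derive F i x.
Proof. by apply: prodr_ge0 => k _; exact: distorted_derive1_ge0. Qed.

Lemma iter_deriveS i x : iter_derive F i.+1 x = derive1 F (iter i F x) * iter_derive F i x.
Proof. by rewrite /iter_derive big_ord_recr /= mulrC. Qed.

Lemma iter_derive_int i x (j : int) : iter_derive F i (x + j%:~R) = iter_derive F i x.
Proof. by apply: eq_bigr => k _; rewrite (iter_int hF) derive1_int. Qed.

Lemma is_derive_iter i x : is_derive x 1 (iter i F) (iter_derive F i x).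
Proof.
elim: i => [|i IH] /=.
  by rewrite /iter_derive big_ord0; exact: is_derive_id.
rewrite iter_deriveS.
apply: (@is_derive1_comp _ F (iter i F)) => //.
by rewrite derive1E; apply: derivableP; exact: (distortion_derivable dF _).
Qed.

(** The inequality is multiplicative along orbits: the squared length of the i-th image cancels
    between two consecutive steps, and the exponents add up. *)
Lemma iter_pair i a b : a < b ->
  iter_derive F i a * iter_derive F i b * (b - a) ^+ 2 <=
  (iter i F b - iter i F a) ^+ 2 *
  expR (\sum_(0 <= k < i) (V (iter k F b) - V (iter k F a))).
Proof.
move=> ab; elim: i => [|i IH].
  by rewrite big_geq // expR0 /iter_derive !big_ord0 !mul1r mulr1.
rewrite big_nat_recr //= expRD !iter_deriveS.
have ab' : iter i F a < iter i F b by rewrite (iter_lt hF).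
have h := distortion_pair dF ab'.
set a' := iter i F a in ab' h *; set b' := iter i F b in ab' IH h *.
set S := \sum_(0 <= k < i) _ in IH *.
have d0 : 0 < (b' - a') ^+ 2 by rewrite exprn_gt0 // subr_gt0.
rewrite -(ler_pM2r d0).
have -> : derive1 F a' * iter_derive F i a * (derive1 F b' * iter_derive F i b) * (b - a) ^+ 2 *
   (b' - a') ^+ 2 = (derive1 F a' * derive1 F b' * (b' - a') ^+ 2) *
   (iter_derive F i a * iter_derive F i b * (b - a) ^+ 2) by ring.
have -> : (F b' - F a') ^+ 2 * (expR S * expR (V b' - V a')) * (b' - a') ^+ 2 =
  ((F b' - F a') ^+ 2 * expR (V b' - V a')) * ((b' - a') ^+ 2 * expR S) by ring.
apply: ler_pM => //; apply: mulr_ge0; rewrite ?sqr_ge0 // mulr_ge0 //.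
- exact: distorted_derive1_ge0.
- exact: distorted_derive1_ge0.
- exact: iter_derive_ge0.
- exact: iter_derive_ge0.
Qed.

End Distorted.

Lemma ln_cross_ratioE (R : realType) (l m r : R) : 0 < l -> 0 < m -> 0 < r ->
  ln (m + r) - ln m - (ln (l + m + r) - ln (l + m)) = ln (1 + l * r / (m * (l + m + r))).
Proof.
move=> l0 m0 r0.
have -> : 1 + l * r / (m * (l + m + r)) = ((m + r) / m) / ((l + m + r) / (l + m)).
  by field; rewrite !lt0r_neq0 //; lra.
by rewrite !ln_div ?posrE ?divr_gt0 //; lra.
Qed.

(** * Comparability of consecutive closest-return gaps *)

Section RealBounds.
Context {R : realType} (F V : R -> R) (W : R).
Hypotheses (dF : distorted F V W) (irr : irrational (rotation_number F)).
Context (q : nat) (p : int) (Q : nat) (P : int).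
Hypothesis (sc : scale (rotation_number F) q p Q P).
Local Notation g := (return_map F q p).
Local Notation gap x := (return_map F q p x - x).
Implicit Types (x y z u : R).
Let hF := distortion_homeo dF.

Lemma gap_gt0 x : 0 < gap x.
Proof. by rewrite subr_gt0; exact: return_gt sc _. Qed.

Lemma gap_int x (j : int) : gap (x + j%:~R) = gap x.
Proof. by rewrite (return_int hF); lra. Qed.

Lemma gap_intB x (j : int) : gap (x - j%:~R) = gap x.
Proof. by rewrite -mulrNz gap_int. Qed.

Lemma V_iter_le i x y : x <= y -> 0 <= V (iter i F y) - V (iter i F x).
Proof. by move=> xy; rewrite subr_ge0 (distortion_homo dF) // (iter_le hF). Qed.

Lemma distortion_ge0 : 0 <= W.
Proof.
have := distortion_homo dF (ler01 : (0 : R) <= 1).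
by have := distortion_period dF 0; rewrite add0r; lra.
Qed.

(** Cut into s consecutive gaps and k blocks of Q iterates; each of the s k pieces contributes at
    most W by [return_sum]. *)
Lemma iterated_sum (k s : nat) x : 
  \sum_(0 <= i < k * Q) (V (iter i F (iter s g x)) - V (iter i F x)) <= (s * k)%:R * W.
Proof.
elim: s => [|s IH].
  by rewrite mul0n mul0r big1 // => i _; rewrite subrr.
rewrite mulSn natrD mulrDl addrC /=.
rewrite (eq_bigr (fun i => (V (iter i F (iter s g x)) - V (iter i F x)) +
  (V (iter i F (g (iter s g x))) - V (iter i F (iter s g x))))) => [|i _]; last by lra.
rewrite big_split /= lerD //.
elim: k {IH} => [|k IH]; first by rewrite big_geq // mul0r.
rewrite mulSn addnC (@big_cat_nat _ _ _ (k * Q)) //= ?leq_addr //.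
rewrite -natr1 mulrDl mul1r lerD //.
have := return_sum hF irr sc (iter (k * Q) F (iter s g x)) (distortion_homo dF)
  (distortion_period dF).
apply: le_trans; rewrite -[X in \sum_(X <= _ < _) _]add0n big_addn addKn.
rewrite le_eqVlt; apply/orP; left; apply/eqP.
by apply: eq_bigr => i _; rewrite -(return_iter hF) -!iterD.
Qed.

Lemma iterated_sum_le (k s j : nat) x y1 y2 : (j <= k * Q)%N ->
  x <= y1 -> y1 <= y2 -> y2 <= iter s g x ->
  \sum_(0 <= i < j) (V (iter i F y2) - V (iter i F y1)) <= (s * k)%:R * W.
Proof.
move=> jk xy1 y12 y2s; apply: le_trans (iterated_sum k s x).
have xs : x <= iter s g x by apply: le_trans y2s; exact: le_trans y12.
rewrite [leRHS](@big_cat_nat _ _ _ j) //= -[leLHS]addr0; apply: lerD; last first.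
  by apply: sumr_ge0 => i _; exact: V_iter_le.
apply: ler_sum => i _; rewrite lerB // (distortion_homo dF) // (iter_le hF) //.
Qed.

Lemma pair_bound (k s j : nat) x y1 y2 : (j <= k * Q)%N ->
  x <= y1 -> y1 < y2 -> y2 <= iter s g x ->
  iter_derive F j y1 * iter_derive F j y2 * (y2 - y1) ^+ 2 <=
  expR ((s * k)%:R * W) * (iter j F y2 - iter j F y1) ^+ 2.
Proof.
move=> jk xy1 y12 y2s; apply: (le_trans (iter_pair dF j y12)).
rewrite mulrC ler_wpM2r ?sqr_ge0 // ler_expR.
exact: (iterated_sum_le jk xy1 (ltW y12) y2s).
Qed.

(** For three consecutive gaps l, m, r this is l r / (m (l + m + r)). A value at least s forces both
    neighbours l and r to be at least s m; an upper bound prevents m from being short compared with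
    both. *)
Definition gap_ratio y : R := gap y * gap (g (g y)) / (gap (g y) * (gap y + gap (g y) + gap (g (g y)))).

(** The cross-ratio inequality for F^j over three consecutive gaps, which is where the 3 in the
    exponent comes from. *)
Lemma gap_ratio_iter (k j : nat) y : (j <= k * Q)%N ->
  ln (1 + gap_ratio (iter j F y)) <= expR ((3 * k)%:R * W) * ln (1 + gap_ratio y).
Proof.
move=> jk.
have g0 x := gap_gt0 x.
rewrite /gap_ratio -!ln_cross_ratioE ?g0 //.
rewrite -!(return_iter hF).
have := @ln_cross_ratio R (iter j F) (iter_derive F j) y (g (g (g y))) (expR ((3 * k)%:R * W)) _
  (is_derive_iter dF j) _ y (g y) (g (g y)) (g (g (g y))) (lexx _).
have := g0 y; have := g0 (g y); have := g0 (g (g y)) => h1 h2 h3.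
move=> /(_ _ _ (ltac:(lra)) (ltac:(lra)) (ltac:(lra)) (lexx _)) H.
set L := (X in X <= _) in H; set Rr := (X in _ <= _ * X) in H.
suff [-> ->] : (ln (iter j F (g (g y)) - iter j F (g y) + (iter j F (g (g (g y))) - iter j F (g (g y)))) -
  ln (iter j F (g (g y)) - iter j F (g y)) -
  (ln (iter j F (g y) - iter j F y + (iter j F (g (g y)) - iter j F (g y)) +
     (iter j F (g (g (g y))) - iter j F (g (g y)))) -
   ln (iter j F (g y) - iter j F y + (iter j F (g (g y)) - iter j F (g y))))) = L /\
   ln (gap (g y) + gap (g (g y))) - ln (gap (g y)) - (ln (gap y + gap (g y) + gap (g (g y))) -
   ln (gap y + gap (g y))) = Rr.
  apply: H => [u v uv|]; first by rewrite (iter_lt hF).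
  by move=> u v yu uv vy; apply: (@pair_bound k 3 j y).
rewrite /L /Rr; split.
  congr (ln _ - ln _ - (ln _ - ln _)); lra.
by congr (ln _ - ln _ - (ln _ - ln _)); lra.
Qed.

End RealBounds.

Section RealBoundsProof.
Context {R : realType} (F V : R -> R) (W : R).
Hypotheses (dF : distorted F V W) (irr : irrational (rotation_number F)).
Context (q : nat) (p : int) (Q : nat) (P : int).
Hypothesis (sc : scale (rotation_number F) q p Q P).
Local Notation g := (return_map F q p).
Local Notation gap x := (return_map F q p x - x).
Local Notation rat_ := (gap_ratio F q p).
Implicit Types (x y z u : R).
Let hF := distortion_homeo dF.
Let g0 x : 0 < gap x := gap_gt0 dF sc x.

(** The factor of [gap_ratio_iter] for times up to 7 Q, within which [gap_window] brings each of
    seven consecutive gaps onto the shortest one. *)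
Definition gap_expo : R := expR ((3 * 7)%:R * W).
(** With the shortest gap in the middle the ratio is at least 1/3; pulled back by at most 7 Q
    iterates this leaves (1 + 1/3)^(1 / gap_expo) - 1. *)
Definition gap_small : R := expR (ln (4 / 3) / gap_expo) - 1.

Let ln43 : 0 < ln (4 / 3 : R).
Proof. by apply: ln_gt0; lra. Qed.

Lemma gap_small_gt0 : 0 < gap_small.
Proof. by rewrite subr_gt0 expR_gt1 divr_gt0 ?expR_gt0. Qed.

Lemma gap_small_le1 : gap_small <= 1.
Proof.
have E1 : 1 <= gap_expo by rewrite /gap_expo -expR0 ler_expR mulr_ge0 ?(distortion_ge0 dF).
rewrite lerBlDr; apply: (@le_trans _ _ (4 / 3)); last by lra.
rewrite -[leRHS](@lnK R) ?posrE; last by lra.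
by rewrite ler_expR ler_pdivrMr ?expR_gt0 // ler_peMr // ltW.
Qed.

Lemma gap_ratio_gt0 y : 0 < rat_ y.
Proof.
have h1 := g0 y; have h2 := g0 (g y); have h3 := g0 (g (g y)).
rewrite /gap_ratio !(mulr_gt0, invr_gt0) //; lra.
Qed.

Lemma gap_ratio_back j y (c : R) : (j <= 7 * Q)%N -> 0 < c ->
  c <= rat_ (iter j F y) -> expR (ln (1 + c) / gap_expo) - 1 <= rat_ y.
Proof.
move=> jQ c0 H; rewrite lerBlDl.
rewrite -[leRHS](@lnK R) ?posrE; last by rewrite addr_gt0 // gap_ratio_gt0.
rewrite ler_expR ler_pdivrMr ?expR_gt0 // mulrC.
apply: le_trans (gap_ratio_iter dF irr sc y jQ).
rewrite ler_ln ?posrE ?lerD2l //; last by rewrite addr_gt0 // gap_ratio_gt0.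
by rewrite addr_gt0.
Qed.

Lemma gap_ratio_forth j y (c : R) : (j <= 7 * Q)%N ->
  rat_ y <= c -> rat_ (iter j F y) <= expR (gap_expo * ln (1 + c)) - 1.
Proof.
move=> jQ H; rewrite lerBrDl.
have r0 := gap_ratio_gt0.
rewrite -[leLHS](@lnK R) ?posrE; last by rewrite addr_gt0.
rewrite ler_expR; apply: (le_trans (gap_ratio_iter dF irr sc y jQ)).
rewrite ler_wpM2l ?expR_ge0 // ler_ln ?posrE ?lerD2l ?addr_gt0 //.
exact: lt_le_trans H.
Qed.

Lemma gap_min_exists : exists z, forall x, gap z <= gap x.
Proof.
have gc : continuous (fun x => gap x).
  move=> x; apply: cvgB; last exact: cvg_id.
  by case: (return_homeo hF q p) => + _ _; exact.
have [z _ zmin] := @EVT_min R (fun x => gap x) 0 1 ler01 (continuous_subspaceT gc).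
exists z => x; have [j [r [-> r0 r1]]] := floor_dec x.
by rewrite (gap_int dF); apply: zmin; rewrite in_itv /= r0 ltW.
Qed.

Section Min.
Context (z : R).
Hypothesis (zmin : forall x, gap z <= gap x).

(** The gap at g y is carried by F^j onto the shortest one, where the ratio is at least 1/3, as
    three gaps none shorter than the middle one show. Its pullback [gap_small] bounds the neighbours
    of the gap at g y from below. *)
Lemma gap_neighbours j y (k : int) : (j <= 7 * Q)%N -> iter j F (g y) = z + k%:~R ->
  gap_small * gap (g y) <= gap y /\ gap_small * gap (g y) <= gap (g (g y)).
Proof.
move=> jQ E.
have H : 1 / 3 <= rat_ (iter j F y).
  have gY : g (iter j F y) = z + k%:~R by rewrite -(return_iter hF) E.
  have a0 := g0 (iter j F y); have b0 := g0 z; have c0 := g0 (g z).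
  have := zmin (iter j F y); have := zmin (g z).
  rewrite /gap_ratio gY !(return_int hF) in a0 *.
  have -> : g z + k%:~R - (z + k%:~R) = g z - z by lra.
  have -> : g (g z) + k%:~R - (g z + k%:~R) = g (g z) - g z by lra.
  set a := z + _ - _ in a0 *; set b := g z - z in b0 *; set c := g (g z) - g z in c0 *.
  move=> bc ba.
  rewrite ler_pdivlMr; last by rewrite mulr_gt0 //; lra.
  nra.
have := gap_ratio_back jQ _ H.
have -> : 1 + 1 / 3 = 4 / 3 :> R by lra.
move=> /(_ ltac:(lra)); rewrite -/gap_small => {}H.
have a0 := g0 y; have b0 := g0 (g y); have c0 := g0 (g (g y)).
move: H; rewrite /gap_ratio.
set a := g y - _ in a0 *; set b := g (g y) - g y in b0 *; set c := g (g (g y)) - _ in c0 *.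
have abc : 0 < b * (a + b + c) by rewrite mulr_gt0 //; lra.
rewrite ler_pdivlMr // => H.
have s0 := gap_small_gt0; set s := gap_small in s0 H *.
have sb0 : 0 < s * b by rewrite mulr_gt0.
split; rewrite leNgt; apply/negP => h; move: H; apply/negP; rewrite -ltNge.
  have : a * c < s * b * c by rewrite ltr_pM2r.
  by nra.
have : a * c < a * (s * b) by rewrite ltr_pM2l.
by nra.
Qed.

(** From y, the time i followed by seven steps of g leads to z modulo the integers. The gap at g^(k
    + 1) y thus needs i + (6 - k) q <= 7 Q iterates to reach the shortest one. *)
Lemma gap_window u y i (j : int) k : iter 7 g u = z -> (i < Q)%N -> iter i F y = u + j%:~R ->
  (k < 7)%N ->
  gap_small * gap (iter k.+1 g y) <= gap (iter k g y) /\
  gap_small * gap (iter k.+1 g y) <= gap (iter k.+2 g y).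
Proof.
move=> uz iQ E k7; apply: (@gap_neighbours (i + (6 - k) * q) _ ((6 - k)%:Z * p + j)).
  rewrite -ltnS; apply: (@leq_trans (Q + 6 * Q)); last by rewrite -mulSn.
  by rewrite -addSn leq_add // leq_mul ?leq_subr // ltnW // (scale_Q sc).
rewrite addnC iterD.
have gi m v : iter i F (iter m g v) = iter m g (iter i F v).
  by elim: m v => // m IH v; rewrite iterSr IH (return_iter hF) -iterSr.
have gj m v (l : int) : iter m g (v + l%:~R) = iter m g v + l%:~R.
  exact: (homeo_int (homeo_iter (return_homeo hF q p) m)).
rewrite -iterS gi E gj (iter_int hF).
have -> : iter ((6 - k) * q) F (iter k.+1 g u) = iter (6 - k) g (iter k.+1 g u) + (6 - k)%:R * p%:~R.
  by rewrite [iter (6 - k) g _](return_iterE hF) subrK.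
by rewrite -iterD addnS subnK -1?ltnS // uz intrD intrM; lra.
Qed.

Definition ratio_bound : R := expR (gap_expo * ln (1 + 5 / gap_small ^+ 4)) - 1.

Let iter_g_surj n y : exists u, iter n g u = y.
Proof. exact: homeo_surj (homeo_iter (return_homeo hF q p) n) y. Qed.

(** Chaining [gap_window] along g^3 u, ..., g^7 u = z shows that these gaps exceed the shortest one
    by at most the factor gap_small^(-4). The window [g^3 u, g^5 u) meets the backward orbit of y
    within Q steps, and there the ratio is at most 5 / gap_small^4; it is then pushed forward to
    y. *)
Lemma gap_ratio_bound y : rat_ y <= ratio_bound.
Proof.
have [u uz] := iter_g_surj 7 z.
have [w wE] := homeo_surj (homeo_iter hF Q) y.
have [i [j [iQ /andP[h1 h2]]]] := hit_window hF sc w (iter 3 g u).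
set y' := iter i F w - j%:~R in h1 h2.
have -> : rat_ y = rat_ (iter (Q - i) F y').
  rewrite /y' (iter_intB hF) -iterD subnK ?(ltnW iQ) // wE.
  by rewrite /gap_ratio !(return_intB hF); congr (_ * _ / (_ * (_ + _ + _))); lra.
apply: gap_ratio_forth; first by apply: (leq_trans (leq_subr _ _)); rewrite leq_pmull.
have W1 k := @gap_window u u 0 0 k uz (ltac:(exact: leq_ltn_trans (leq0n _) iQ)) (esym (addr0 u)).
have [_ w3] := W1 2%N isT; have [_ w4] := W1 3%N isT; have [_ w5] := W1 4%N isT.
have [_ w6] := W1 5%N isT; rewrite uz in w6.
have s0 := gap_small_gt0; have s1 := gap_small_le1; set s := gap_small in w3 w4 w5 w6 s0 s1 *.
have gz0 := g0 z.
have T : s ^+ 4 * (g (g (g y')) - y') <= 5 * gap z.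
  have : g (g (g y')) - y' <= gap (iter 3 g u) + gap (iter 4 g u) + gap (iter 5 g u)
     + gap (iter 6 g u) + gap z.
    have : g (g (g y')) <= g (g (g (g (g (iter 3 g u))))) by rewrite !(return_le hF) ltW.
    by rewrite -uz /= in h1 h2 *; lra.
  move=> h; apply: (@le_trans _ _ (s ^+ 4 * (gap (iter 3 g u) + gap (iter 4 g u) + gap (iter 5 g u)
     + gap (iter 6 g u) + gap z))); first by rewrite ler_wpM2l // exprn_ge0 // ltW.
  have s40 k : 0 <= s ^+ k by rewrite exprn_ge0 // ltW.
  have s41 k : s ^+ k <= 1 by rewrite exprn_ile1 // ltW.
  have v6 : s * gap (iter 6 g u) <= gap z by exact: w6.
  have v5 : s ^+ 2 * gap (iter 5 g u) <= gap z.
    by apply: le_trans v6; rewrite expr2 -mulrA ler_pM2l.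
  have v4 : s ^+ 3 * gap (iter 4 g u) <= gap z.
    by apply: le_trans v5; rewrite exprSr -mulrA ler_wpM2l.
  have v3 : s ^+ 4 * gap (iter 3 g u) <= gap z.
    by apply: le_trans v4; rewrite exprSr -mulrA ler_wpM2l.
  have M i' j' v : 0 <= v -> s ^+ j' * v <= gap z -> s ^+ (i' + j') * v <= gap z.
    move=> v0; apply: le_trans; rewrite exprD -mulrA ler_piMl // mulr_ge0 //.
  have u4 := M 1%N 3%N _ (ltW (g0 _)) v4; have u5 := M 2%N 2%N _ (ltW (g0 _)) v5.
  have u6 := M 3%N 1%N _ (ltW (g0 _)) v6.
  have u7 : s ^+ 4 * gap z <= gap z by rewrite ler_piMl // ltW.
  lra.
have a0 := g0 y'; have b0 := g0 (g y'); have c0 := g0 (g (g y')); have bz := zmin (g y').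
have s40 : 0 < s ^+ 4 by rewrite exprn_gt0.
have Tb : g (g (g y')) - y' <= 5 / s ^+ 4 * gap (g y').
  rewrite mulrAC ler_pdivlMr // mulrC; apply: (le_trans T); rewrite ler_wpM2l //.
rewrite /gap_ratio.
have {}Tb : gap y' + gap (g y') + gap (g (g y')) <= 5 / s ^+ 4 * gap (g y') by lra.
set k := 5 / _ in Tb *.
set a := g y' - y' in a0 Tb *; set b := g (g y') - g y' in b0 Tb *.
set c := g (g (g y')) - g (g y') in c0 Tb *.
rewrite ler_pdivrMr; last by rewrite mulr_gt0 //; lra.
rewrite mulrA; apply: (@le_trans _ _ ((a + b + c) * (a + b + c))).
  by nra.
by rewrite ler_wpM2r //; lra.
Qed.

End Min.

(** Two losses are collected: [t], for comparing the gaps at g y, ..., g^7 y in at most six steps of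
    [gap_window], and the minimum, from [gap_cmp_step], for points lying between the g^k y. *)
Definition gap_cmp : R :=
  let t := gap_small ^+ 6 in 2 / (t * Num.min (t / 2) (t ^+ 3 / (24 * ratio_bound))).

Lemma ratio_bound_gt0 : 0 < ratio_bound.
Proof.
have s0 : 0 < 5 / gap_small ^+ 4 by rewrite divr_gt0 // exprn_gt0 // gap_small_gt0.
by rewrite subr_gt0 expR_gt1 mulr_gt0 ?expR_gt0 // ln_gt0; lra.
Qed.

(** Here b, c, d are consecutive gaps and l a reference length. If c is short, then b and d are
    long, since b + c and c + d are; the bound on b d / (c (b + c + d)) then bounds c from below. *)
Lemma gap_cmp_step (t l k b c d : R) : 0 < t -> t <= 1 -> 0 < l -> 0 < k ->
  0 < b -> 0 < c -> 0 < d -> t * l <= b + c -> t * l <= c + d ->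
  t * b <= 2 * l -> t * c <= 2 * l -> t * d <= 2 * l -> b * d <= k * (c * (b + c + d)) ->
  Num.min (t / 2) (t ^+ 3 / (24 * k)) * l <= c.
Proof.
move=> t0 t1 l0 k0 b0 c0 d0 h1 h2 h3 h4 h5 h6.
have [ct|ct] := leP (t / 2 * l) c.
  by apply: le_trans ct; rewrite ler_pM2r // ge_min lexx.
apply: (@le_trans _ _ (t ^+ 3 / (24 * k) * l)).
  by rewrite ler_pM2r // ge_min lexx orbT.
have hb : t / 2 * l <= b by lra.
have hd : t / 2 * l <= d by lra.
have tl : 0 < t / 2 * l by rewrite mulr_gt0 // divr_gt0.
have bd : (t / 2 * l) * (t / 2 * l) <= b * d by rewrite ler_pM // ltW.
have h7 : t * ((t / 2 * l) * (t / 2 * l)) <= k * c * (6 * l).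
  apply: (@le_trans _ _ (t * (k * (c * (b + c + d))))).
    by rewrite ler_pM2l //; apply: le_trans h6.
  have -> : t * (k * (c * (b + c + d))) = k * c * (t * (b + c + d)) by ring.
  by rewrite ler_pM2l ?mulr_gt0 //; lra.
have k24 : 0 < 24 * k by rewrite mulr_gt0.
have -> : t ^+ 3 / (24 * k) * l = t ^+ 3 * l / (24 * k) by ring.
rewrite ler_pdivrMr // -(ler_pM2r l0); nra.
Qed.

(** Let y be a preimage of the window next to the shortest gap. The gaps at the points g^k y are
    comparable by [gap_window]; the gap at a point v between them is at most the sum of two, and is
    bounded from below by [gap_cmp_step]. *)
Lemma real_bounds x : gap (g x) <= gap_cmp * gap x /\ gap x <= gap_cmp * gap (g x).
Proof.
have [z zmin] := gap_min_exists.
have gH := return_homeo hF q p.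
have [u uz] := homeo_surj (homeo_iter gH 7) z.
(* The lower bound for a gap also involves the preceding one, so the point is written as g x0 and
   the window is placed around x0. *)
have [x0 <-] := homeo_surj gH x.
have [i [j [iQ /andP[h1 h2]]]] := hit_window hF sc x0 (g u).
have [y yE] := homeo_surj (homeo_iter hF i) (u + j%:~R).
have yk k : iter i F (iter k g y) = iter k g u + j%:~R.
  rewrite -(homeo_int (homeo_iter gH k)) -yE.
  by elim: k => // k IH; rewrite /= (return_iter hF) IH.
have y1 : iter 1 g y <= x0 by rewrite -(iter_le hF i) yk /=; lra.
have y3 : x0 < iter 3 g y by rewrite -(iter_lt hF i) yk /=; lra.
have Wd k := @gap_window z zmin u y i j k uz iQ yE.
have s0 := gap_small_gt0; have s1 := gap_small_le1; set s := gap_small in Wd s0 s1.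
have l0 k : 0 < gap (iter k g y) by exact: g0.
have A k : (k < 7)%N -> s ^+ k * gap (iter 1 g y) <= gap (iter k.+1 g y).
  elim: k => [|k IH] k7; first by rewrite mul1r.
  rewrite exprS -mulrA; have [_ h] := Wd k (ltnW k7); apply: le_trans h.
  by rewrite ler_pM2l // IH // ltnW.
have B k : (k < 7)%N -> s ^+ k * gap (iter k.+1 g y) <= gap (iter 1 g y).
  elim: k => [|k IH] k7; first by rewrite mul1r.
  have [h _] := Wd k.+1 k7.
  apply: le_trans (IH (ltnW k7)).
  by rewrite exprSr -mulrA ler_wpM2l // exprn_ge0 // ltW.
have ts k : (k < 7)%N -> s ^+ 6 <= s ^+ k.
  by move=> k7; apply: ler_wiXn2l => //; rewrite ltW.
set t := s ^+ 6 in ts.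
have t0 : 0 < t by rewrite exprn_gt0.
have t1 : t <= 1 by rewrite exprn_ile1 // ltW.
set l := gap (iter 1 g y) in A B.
have ll0 : 0 < l by exact: l0.
have {}A k : (0 < k <= 7)%N -> t * l <= gap (iter k g y).
  by case: k => // k /= k7; apply: le_trans (A _ k7); rewrite ler_pM2r // ts.
have {}B k : (0 < k <= 7)%N -> t * gap (iter k g y) <= l.
  by case: k => // k /= k7; apply: le_trans (B _ k7); rewrite ler_pM2r // ts.
set kap := Num.min (t / 2) (t ^+ 3 / (24 * ratio_bound)).
have U v k : (0 < k < 7)%N -> iter k g y <= v -> v < iter k.+1 g y -> t * gap v <= 2 * l.
  case: k => // k /= k7 v1 v2.
  have gv : g v <= iter k.+3 g y by rewrite (return_le hF) ltW.
  have b1 := B k.+1 (ltnW k7); have b2 := B k.+2 k7.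
  have : t * gap v <= t * (gap (iter k.+1 g y) + gap (iter k.+2 g y)).
    by rewrite ler_pM2l //= in v1 v2 gv *; lra.
  by move=> /= in b1 b2 *; lra.
have core v k : (0 < k < 4)%N -> iter k g y <= v -> v < iter k.+1 g y ->
    kap * l <= gap (g v) /\ t * gap (g v) <= 2 * l.
  case: k => // k /= k4 v1 v2.
  have v3 : iter k.+2 g y <= g v by rewrite (return_le hF).
  have v4 : g v < iter k.+3 g y by rewrite (return_lt hF).
  have v5 : iter k.+3 g y <= g (g v) by rewrite (return_le hF).
  have v6 : g (g v) < iter k.+4 g y by rewrite (return_lt hF).
  have v7 : iter k.+4 g y <= g (g (g v)) by rewrite (return_le hF).
  have u1 := U (g v) k.+2 (@leq_trans 5 k.+3 7 k4 isT) v3 v4.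
  have u0 := U v k.+1 (@leq_trans 4 k.+2 7 k4 isT) v1 v2.
  have u2 := U (g (g v)) k.+3 (@leq_trans 6 k.+4 7 k4 isT) v5 v6.
  split => //.
  have a2 := A k.+2 (@leq_trans 4 k.+2 7 k4 isT).
  have a3 := A k.+3 (@leq_trans 5 k.+3 7 k4 isT).
  apply: (@gap_cmp_step t l ratio_bound (gap v) (gap (g v)) (gap (g (g v)))) => //.
  - exact: ratio_bound_gt0.
  - by move=> /= in a2 a3 v1 v2 v3 v4 v5 v6 v7 *; lra.
  - by move=> /= in a2 a3 v1 v2 v3 v4 v5 v6 v7 *; lra.
  have := gap_ratio_bound zmin v; rewrite /gap_ratio ler_pdivrMr //.
  by do ![exact: g0|apply: mulr_gt0|apply: addr_gt0].
have [k [[k0 k0'] k1 k2]] : exists k, [/\ (0 < k < 4)%N /\ (0 < k.+1 < 4)%N, iter k g y <= x0 & x0 < iter k.+1 g y].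
  have [h|h] := ltP x0 (iter 2 g y); first by exists 1%N; split => //; split.
  by exists 2%N; split => //; split.
have [c1 c2] := core x0 k k0 k1 k2.
have [c3 c4] := core (g x0) k.+1 k0'
  (ltac:(by rewrite /= (return_le hF))) (ltac:(by rewrite /= (return_lt hF))).
have kap0 : 0 < kap.
  by rewrite lt_min !divr_gt0 // ?exprn_gt0 // mulr_gt0 // ratio_bound_gt0.
have fin w w' : kap * l <= w -> t * w' <= 2 * l -> w' <= gap_cmp * w.
  move=> h3 h4; rewrite /gap_cmp -/s -/t -/kap.
  rewrite mulrAC ler_pdivlMr ?mulr_gt0 //.
  apply: (@le_trans _ _ (2 * l * kap)).
    by rewrite (_ : w' * (t * kap) = t * w' * kap); [rewrite ler_pM2r|ring].
  by rewrite (_ : 2 * l * kap = 2 * (kap * l)); [rewrite ler_pM2l|ring].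
by split; apply: fin.
Qed.
End RealBoundsProof.

(** * Derivatives of iterates, decay of the gaps, strict monotonicity of the rotation number *)

Section Fine.
Context {R : realType} (F V : R -> R) (W : R).
Hypotheses (dF : distorted F V W) (irr : irrational (rotation_number F)).
Implicit Types (x y : R).
Let hF := distortion_homeo dF.
Local Notation C := (gap_cmp W).

Lemma gap_cmp_ge1 : 1 <= C.
Proof.
have [q [p [Q [P [sc _]]]]] := scale_exists irr (ltr01 : 0 < 1 :> R).
have [h1 h2] := real_bounds dF irr sc 0.
have g0 := gap_gt0 dF sc 0; have g1 := gap_gt0 dF sc (return_map F q p 0).
rewrite leNgt; apply/negP => C1; have [C0|C0] := leP C 0.
  by move: h1; set a := return_map F q p 0 - 0 in g0 *; nra.
by move: h1 h2; set a := return_map F q p 0 - 0 in g0 *; set b := _ - return_map F q p 0 in g1 *; nra.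
Qed.

(** [one_point_bound] at x with the points g x and g (g x). As the image gaps u and v are
    comparable, 1 / u - 1 / (u + v) is at least 1 / ((1 + C) u). At critical points only such an
    upper bound on the derivative can hold. *)
Lemma iter_derive_bound q p Q P (sc : scale (rotation_number F) q p Q P) k j x : (j <= k * Q)%N ->
  iter_derive F j x * (return_map F q p x - x) <=
  expR ((2 * k)%:R * W) * (1 + C) * (return_map F q p (iter j F x) - iter j F x).
Proof.
move=> jk; have C1 := gap_cmp_ge1.
have g0 y := gap_gt0 dF sc y.
set g := return_map F q p in g0 *.
have := @one_point_bound R (iter j F) (iter_derive F j) x (g (g x)) (expR ((2 * k)%:R * W)) _
  (is_derive_iter dF j) _ x (g x) (g (g x)) (lexx _).
have h0 := g0 x; have h1 := g0 (g x).
move=> /(_ _ _ (ltac:(lra)) (ltac:(lra)) (lexx _)).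
have H1 : {homo iter j F : u v / u < v} by move=> u v; rewrite (iter_lt hF).
have H2 a b : x <= a -> a < b -> b <= g (g x) -> iter_derive F j a * iter_derive F j b * (b - a) ^+ 2 <=
    expR ((2 * k)%:R * W) * (iter j F b - iter j F a) ^+ 2.
  by move=> ax ab bx; apply: (@pair_bound _ _ _ _ dF irr _ _ _ _ sc k 2 j x).
move=> /(_ H1 H2); rewrite !(return_iter hF) -/g.
have [_ b1] := real_bounds dF irr sc (iter j F x); rewrite -/g in b1.
have g1 := g0 (iter j F x); have g2 := g0 (g (iter j F x)).
set u := g (iter j F x) - iter j F x in b1 g1 *.
set v := g (g (iter j F x)) - g (iter j F x) in b1 g2 *.
rewrite (_ : g (g (iter j F x)) - iter j F x = u + v); last by rewrite /u /v; lra.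
set a := g x - x in h0 *.
rewrite (_ : g (g x) - x = a + (g (g x) - g x)); last by rewrite /a; lra.
set b := g (g x) - g x in h1 *.
set E := expR _; set D := iter_derive F j x => H.
have E0 : 0 < E by exact: expR_gt0.
have D0 : 0 <= D by exact: iter_derive_ge0 dF _ _.
have C0 : 0 < 1 + C by lra.
have e1 : ((1 + C) * u)^-1 <= u^-1 - (u + v)^-1.
  rewrite (_ : u^-1 - (u + v)^-1 = v / (u * (u + v))); last by field; rewrite !lt0r_neq0 //; lra.
  rewrite ler_pdivlMr; last by apply: mulr_gt0 => //; exact: addr_gt0.
  have -> : ((1 + C) * u)^-1 * (u * (u + v)) = (u + v) / (1 + C).
    by rewrite invfM -mulrA mulKf ?lt0r_neq0 // mulrC.
  by rewrite ler_pdivrMr //; lra.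
have e2 : a^-1 - (a + b)^-1 <= a^-1 by rewrite lerBlDr lerDl invr_ge0 ltW // addr_gt0.
have : D * ((1 + C) * u)^-1 <= E * a^-1.
  apply: (@le_trans _ _ (E * (a^-1 - (a + b)^-1))); last by rewrite ler_pM2l.
  by apply: le_trans H; rewrite ler_wpM2l.
rewrite ler_pdivrMr ?mulr_gt0 // mulrAC ler_pdivlMr // => {}H.
by apply: (le_trans H); rewrite -mulrA.
Qed.

(** Two steps of the finer return fit into one of the coarser return; being comparable, the first
    takes at most the fraction C / (1 + C). *)
Lemma gap_shrink q p Q P q' p' Q' P' x : scale (rotation_number F) q p Q P ->
  scale (rotation_number F) q' p' Q' P' ->
  q'%:R * rotation_number F - p'%:~R < (q%:R * rotation_number F - p%:~R) / 2 ->
  return_map F q' p' x - x <= C / (1 + C) * (return_map F q p x - x).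
Proof.
move=> sc sc' lt; have C1 := gap_cmp_ge1.
have [_ h] := real_bounds dF irr sc' x.
have : return_map F q' p' (return_map F q' p' x) <= return_map F q p x.
  have := @return_iterE _ _ hF q' p' 2 x; rewrite /= => ->; rewrite /return_map.
  have := @orbit_order _ F hF (2 * q') q (2%:Z * p') p x.
  by rewrite natrM intrM => h1; apply: ltW; apply: h1; lra.
move: h; set a := return_map F q' p' x; set b := return_map F q' p' a => h1 h2.
have C0 : 0 < 1 + C by lra.
by rewrite mulrAC ler_pdivlMr //; nra.
Qed.

(** The gaps decay geometrically along scales chosen by [gap_shrink], a quantitative form of the
    absence of wandering intervals. *)
Lemma fine_scale (e : R) : 0 < e -> exists q p Q P,
  scale (rotation_number F) q p Q P /\ forall x, return_map F q p x - x < e.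
Proof.
move=> e0; have C1 := gap_cmp_ge1.
pose lam := C / (1 + C).
have H (n : nat) : exists q p Q P, scale (rotation_number F) q p Q P /\
    forall x, return_map F q p x - x <= lam ^+ n.
  elim: n => [|n [q [p [Q [P [sc h]]]]]].
    have [q [p [Q [P [sc _]]]]] := scale_exists irr (ltr01 : 0 < 1 :> R).
    exists q, p, Q, P; split=> // x; rewrite expr0.
    have := @orbit_order_le _ F hF q 0%N p (- 1) x irr.
    rewrite /= mulrNz mul0r opprK add0r -[1%:~R]/(1 : R) /return_map => h.
    have := scale_half sc => h1.
    by have := h (ltac:(lra)); lra.
  have th : 0 < (q%:R * rotation_number F - p%:~R) / 2 by rewrite divr_gt0 // (scale_pos sc).
  have [q' [p' [Q' [P' [sc' h']]]]] := scale_exists irr th.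
  exists q', p', Q', P'; split=> // x.
  apply: (le_trans (gap_shrink x sc sc' h')); rewrite exprS ler_wpM2l //.
  by rewrite divr_ge0 //; lra.
have l0 : 0 <= lam by rewrite divr_ge0 //; lra.
have l1 : `|lam| < 1 by rewrite ger0_norm // ltr_pdivrMr; lra.
have /cvgrPdist_lt/(_ _ e0)[N _ HN] := cvg_expr l1.
have [q [p [Q [P [sc h]]]]] := H N.
exists q, p, Q, P; split=> // x; apply: le_lt_trans (h x) _.
by have := HN N (leqnn _); rewrite /= sub0r normrN ger0_norm // exprn_ge0.
Qed.

(** At a scale whose gaps are all below e, F^Q - P falls short of its starting point by less than e.
    The extra e carries G^Q up to it, so rho(G) >= P / Q > rho(F). *)
Lemma rotation_number_strict_gt (G : R -> R) (e : R) : circle_homeo G -> 0 < e ->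
  (forall x, F x + e <= G x) -> rotation_number F < rotation_number G.
Proof.
move=> hG e0 FG; have [q [p [Q [P [sc h]]]]] := fine_scale e0.
have Q0 : (0 < Q)%N by exact: leq_ltn_trans (leq0n _) (scale_Q sc).
have It m y : iter m.+1 F y + e <= iter m.+1 G y.
  elim: m => [|m IH]; first exact: FG.
  apply: le_trans (FG _); rewrite lerD2r /= (homeo_le hF).
  by apply: le_trans IH; rewrite lerDl ltW.
have H : 0 + P%:~R <= iter Q G 0.
  have := It Q.-1 0; rewrite prednK // => h1.
  have := h (iter Q F 0 - P%:~R); have := last_return_ge hF sc 0; lra.
have := rotation_number_ge hG H; have := scale_neg sc => h1 h2.
by rewrite -(@ltr_pM2l _ Q%:R) ?ltr0n //; lra.
Qed.

Lemma rotation_number_strict_lt (G : R -> R) (e : R) : circle_homeo G -> 0 < e ->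
  (forall x, G x <= F x - e) -> rotation_number G < rotation_number F.
Proof.
move=> hG e0 FG; have [q [p [Q [P [sc h]]]]] := fine_scale e0.
have It m y : iter m.+1 G y <= iter m.+1 F y - e.
  elim: m => [|m IH]; first exact: FG.
  apply: (le_trans (FG _)); rewrite lerD2r /= (homeo_le hF).
  by apply: (le_trans IH) => /=; lra.
have H : iter q G 0 <= 0 + p%:~R.
  have := It q.-1 0; rewrite prednK ?(scale_q sc) // => h1.
  have := h 0; rewrite /return_map; lra.
have := rotation_number_le hG H; have := scale_pos sc => h1 h2.
by rewrite -(@ltr_pM2l _ q%:R) ?ltr0n ?(scale_q sc) //; lra.
Qed.

End Fine.

(** * Periodic functions modulo coboundaries *)

Definition cper (R : realType) (u : R -> R) : Prop :=
  (forall x : R, {for x, continuous u}) /\ forall x, u (x + 1) = u x.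

Section Cper.
Context {R : realType}.
Implicit Types (u v h : R -> R) (x y : R).

Lemma cper_cst (c : R) : cper (cst c).
Proof. by split=> // x; exact: cvg_cst. Qed.

Lemma cperD u v : cper u -> cper v -> cper (fun x => u x + v x).
Proof.
by move=> [uc u1] [vc v1]; split=> x; [apply: cvgD; [exact: uc|exact: vc]|rewrite u1 v1].
Qed.

Lemma cperM u v : cper u -> cper v -> cper (fun x => u x * v x).
Proof.
by move=> [uc u1] [vc v1]; split=> x; [apply: cvgM; [exact: uc|exact: vc]|rewrite u1 v1].
Qed.

Lemma cperZ (c : R) u : cper u -> cper (fun x => c * u x).
Proof. exact: cperM (cper_cst c). Qed.

Lemma cperB u v : cper u -> cper v -> cper (fun x => u x - v x).
Proof.
by move=> [uc u1] [vc v1]; split=> x; [apply: cvgB; [exact: uc|exact: vc]|rewrite u1 v1].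
Qed.

Lemma cper_sum (I : Type) (s : seq I) (u : I -> R -> R) : (forall i, cper (u i)) ->
  cper (fun x => \sum_(i <- s) u i x).
Proof.
move=> cu; elim: s => [|i s IH].
  by rewrite (_ : (fun _ => _) = cst 0); [exact: cper_cst|apply/funext => x; rewrite big_nil].
rewrite (_ : (fun _ => _) = (fun x => u i x + \sum_(j <- s) u j x)); last first.
  by apply/funext => x; rewrite big_cons.
exact: cperD.
Qed.

Lemma cper_comp u (H : R -> R) : cper u -> circle_homeo H -> cper (fun x => u (H x)).
Proof.
move=> [uc u1] [Hc _ H1]; split=> x; last by rewrite H1 u1.
by apply: (@continuous_comp _ _ _ H u); [exact: Hc|exact: uc].
Qed.

Lemma cper_int u x (j : int) : cper u -> u (x + j%:~R) = u x.
Proof.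
move=> [_ u1].
have Fn (n : nat) z : u (z + n%:R) = u z.
  elim: n z => [|n IH] z; first by rewrite !addr0.
  by rewrite -natr1 !addrA u1 IH.
case: j => n; first exact: Fn.
by rewrite NegzE mulrNz -[LHS](Fn n.+1) subrK.
Qed.

Lemma cper_intB u x (j : int) : cper u -> u (x - j%:~R) = u x.
Proof. by rewrite -mulrNz; exact: cper_int. Qed.

Lemma cper_ucont u (e : R) : cper u -> 0 < e ->
  exists2 d, 0 < d & forall x y, `|x - y| <= d -> `|u x - u y| <= e.
Proof.
move=> cu e0; have [uc u1] := cu.
have [d d0 H] : exists2 d, 0 < d & forall x, x \in `[0, 1]%R ->
    forall y, `|x - y| <= d -> `|u x - u y| <= e.
  have /compact_near_coveringP/(_ _ (0 : R)^'+
     (fun d x => forall y, `|x - y| <= d -> `|u x - u y| <= e) _) := @segment_compact R 0 1.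
  move=> K.
  have {}K : \forall d \near (0 : R)^'+, `[0, 1]%classic `<=`
      (fun x => forall y, `|x - y| <= d -> `|u x - u y| <= e).
    apply: K => x _.
    have e2 : 0 < e / 2 by exact: divr_gt0.
    have [d d0 D] := (eps_continuousP u x).1 (uc x) _ e2.
    near=> x' d' => y /= xy.
    have h1 : `|x - x'| < d / 2.
      near: x'; apply: (@nbhsx_ballx _ _ x (d / 2)); exact: divr_gt0.
    have h2 : d' < d / 2 by near: d'; apply: nbhs_right_lt; exact: divr_gt0.
    have h3 : `|u x - u x'| < e / 2 by apply: D; lra.
    have h4 : `|u x - u y| < e / 2.
      apply: D; rewrite (_ : x - y = (x - x') + (x' - y)); last by lra.
      by apply: (le_lt_trans (ler_normD _ _)); lra.
    rewrite (_ : u x' - u y = - (u x - u x') + (u x - u y)); last by lra.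
    apply: (le_trans (ler_normD _ _)); rewrite normrN; lra.
  near (0 : R)^'+ => d; exists d; first by [].
  move=> x x01; have : `[0, 1]%classic `<=` (fun x => forall y, `|x - y| <= d -> `|u x - u y| <= e).
    by near: d.
  by apply.
exists d => // x y xy; have [j [r [E r0 r1]]] := floor_dec x.
rewrite E (cper_int _ _ cu) -(cper_intB y j cu); apply: H.
  by rewrite in_itv /= r0 ltW.
by rewrite (_ : r - (y - j%:~R) = x - y); lra.
Unshelve. all: by end_near. Qed.

Lemma cper_bounded u : cper u -> exists2 B, 0 < B & forall x, `|u x| <= B.
Proof.
move=> cu; have [uc _] := cu.
have nc : {within `[0, 1], continuous (fun x => `|u x|)}.
  by apply: continuous_subspaceT => x; apply: cvg_norm; exact: uc.
have [c _ cmax] := EVT_max ler01 nc.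
exists (`|u c| + 1) => [|x]; first by rewrite ltr_wpDl.
have [j [r [-> r0 r1]]] := floor_dec x; rewrite (cper_int _ _ cu).
by rewrite ler_wpDr //; apply: cmax; rewrite in_itv /= r0 ltW.
Qed.

Lemma cper_min u : cper u -> exists z, forall x, u z <= u x.
Proof.
move=> cu; have [uc _] := cu.
have nc : {within `[0, 1], continuous u} by apply: continuous_subspaceT => x; exact: uc.
have [z _ zmin] := EVT_min ler01 nc.
exists z => x; have [j [r [-> r0 r1]]] := floor_dec x; rewrite (cper_int _ _ cu).
by apply: zmin; rewrite in_itv /= r0 ltW.
Qed.

Lemma clamp_continuous (u : R -> R) x : {for x, continuous u} ->
  {for x, continuous (fun y => Num.max 0 (Num.min 1 (u y)))}.
Proof.
move=> uc; apply: (@continuous_max _ _ (cst 0) (fun y => Num.min 1 (u y))).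
  exact: cvg_cst.
by apply: (@continuous_min _ _ (cst 1) u) => //; exact: cvg_cst.
Qed.

(** Obtained by clamping an affine function of cos (2 pi (y - m)), which is periodic and decreases
    with the distance from y to m + Z as long as this is at most 1/2. *)
Lemma bump_exists (m r r' : R) : 0 <= r -> r < r' -> r' <= 1 / 2 ->
  exists b, [/\ cper b, forall y, 0 <= b y <= 1,
    forall y (j : int), `|y + j%:~R - m| <= r -> b y = 1 &
    forall y, b y != 0 -> exists j : int, `|y + j%:~R - m| < r'].
Proof.
move=> r0 rr' r'h.
pose c y := cos (2 * pi * (y - m)) : R.
have c2 y (j : int) : c (y + j%:~R) = c y.
  have cn (n : nat) z : c (z + n%:R) = c z.
    elim: n z => [|n IH] z; first by rewrite addr0.
    rewrite -natr1 addrA /c (_ : 2 * pi * _ = 2 * pi * (z + n%:R - m) + pi *+ 2); last first.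
      by rewrite mulr2n; ring.
    by rewrite cosD2pi; exact: IH.
  case: j => n; first exact: cn.
  by rewrite NegzE mulrNz -[LHS](cn n.+1) subrK.
have pp : 0 < pi :> R by exact: pi_gt0.
have cabs y : c y = cos (2 * pi * `|y - m|).
  rewrite /c; case: (lerP 0 (y - m)) => h //; first by rewrite ger0_norm.
  by rewrite -cosN ltr0_norm // mulrN.
have dec : {in `[0, 1 / 2] &, forall s t : R, (cos (2 * pi * s) < cos (2 * pi * t)) = (t < s)}.
  move=> s t /[!in_itv]/= /andP[s0 s1] /andP[t0 t1].
  by rewrite ltr_cos ?in_itv /=; [rewrite ltr_pM2l // mulr_gt0| |]; nra.
pose b y := Num.max 0 (Num.min 1 ((c y - cos (2 * pi * r')) / (cos (2 * pi * r) - cos (2 * pi * r')))).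
have d0 : 0 < cos (2 * pi * r) - cos (2 * pi * r').
  by rewrite subr_gt0 dec // in_itv /=; apply/andP; split; lra.
exists b; split.
- split=> x; last by rewrite /b (_ : c (x + 1) = c x) // -(c2 x 1).
  apply: clamp_continuous; apply: cvgM; last exact: cvg_cst.
  apply: cvgB; last exact: cvg_cst.
  apply: continuous_comp; last exact: continuous_cos.
  apply: cvgM; first exact: cvg_cst.
  by apply: cvgB; [exact: cvg_id|exact: cvg_cst].
- by move=> y; rewrite /b le_max lexx /= ge_max ler01 ge_min lexx.
- move=> y j h; rewrite /b -(c2 y j) cabs.
  have : cos (2 * pi * r) <= cos (2 * pi * `|y + j%:~R - m|).
    rewrite leNgt dec ?in_itv /= -?leNgt //; first by rewrite normr_ge0 /=; lra.
    by rewrite r0 /=; lra.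
  move=> hh; rewrite (min_idPl _); first by rewrite (max_idPr _).
  by rewrite ler_pdivlMr // mul1r lerB.
- move=> y b0.
  (* The integer nearest to y - m. *)
  have [j [t [E t0 t1]]] := floor_dec (y - m + 1 / 2).
  exists (- j); rewrite mulrNz.
  have E' : y - j%:~R - m = t - 1 / 2 by lra.
  rewrite -dec ?in_itv /= ?normr_ge0 ?E' //=; last 2 first.
  + by apply/andP; split; lra.
  + by rewrite ler_norml; apply/andP; split; lra.
  rewrite -E' -cabs -mulrNz c2 ltNge; apply/negP => h.
  move/negP: b0; apply; apply/eqP; rewrite /b.
  apply/max_idPl; rewrite ge_min; apply/orP; right.
  by rewrite pmulr_lle0 ?invr_gt0 // subr_le0.
Qed.

End Cper.

(** * The transfer operator and inequalities modulo coboundaries *)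

Definition transfer (R : realType) (F u : R -> R) (x : R) : R :=
  derive1 F (inv_map F x) * u (inv_map F x).

(* u is dominated by w modulo the coboundaries h - transfer F h, which are the functions killed
   by every (-1)-measure of F. *)
Definition dominated (R : realType) (F u w : R -> R) : Prop :=
  exists2 h, cper h & forall x, u x <= w x + (h x - transfer F h x).

Section Transfer.
Context {R : realType} (F V : R -> R) (W : R).
Hypothesis (dF : distorted F V W).
Implicit Types (x y : R) (u v w h : R -> R).
Local Notation Fi := (inv_map F).
Local Notation T := (transfer F).
Local Notation dom := (dominated F).
Let hF := distortion_homeo dF.
Let hFi := homeo_inv hF.

Lemma cper_derive1 : cper (derive1 F).
Proof.
split; [exact: distortion_continuous dF|exact: distorted_derive1_period dF].
Qed.

Lemma cper_transfer u : cper u -> cper (T u).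
Proof. by move=> cu; apply: cperM; apply: cper_comp => //; exact: cper_derive1. Qed.

Lemma cper_transfer_iter u n : cper u -> cper (iter n T u).
Proof. by move=> cu; elim: n => // n; exact: cper_transfer. Qed.

Lemma transfer_iterE u n x : iter n T u x = iter_derive F n (iter n Fi x) * u (iter n Fi x).
Proof.
elim: n x => [|n IH] x; first by rewrite /iter_derive big_ord0 mul1r.
rewrite iterS {1}/transfer IH iter_deriveS -!iterSr mulrA; congr (_ * _ * _).
by rewrite [iter n.+1 _ _]iterSr (iter_inv_mapK hF).
Qed.

Lemma dominated_le u w : (forall x, u x <= w x) -> dom u w.
Proof.
move=> uw; exists (cst 0); first exact: cper_cst.
by move=> x; rewrite /transfer /= mulr0 subr0 addr0.
Qed.

Lemma dominated_trans u v w : dom u v -> dom v w -> dom u w.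
Proof.
move=> [h ch H] [k ck K]; exists (fun x => h x + k x); first exact: cperD.
by move=> x; have := H x; have := K x; rewrite /transfer mulrDr; lra.
Qed.

Lemma dominatedD u w u' w' : dom u w -> dom u' w' ->
  dom (fun x => u x + u' x) (fun x => w x + w' x).
Proof.
move=> [h ch H] [k ck K]; exists (fun x => h x + k x); first exact: cperD.
by move=> x; have := H x; have := K x; rewrite /transfer mulrDr; lra.
Qed.

Lemma dominatedZ u w (c : R) : 0 <= c -> dom u w -> dom (fun x => c * u x) (fun x => c * w x).
Proof.
move=> c0 [h ch H]; exists (fun x => c * h x); first exact: cperZ.
move=> x; have := ler_wpM2l c0 (H x); rewrite /transfer mulrDr mulrBr.
by rewrite [derive1 F _ * (_ * _)]mulrCA.
Qed.

Lemma dominated_sum (I : Type) (s : seq I) (u w : I -> R -> R) :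
  (forall i, dom (u i) (w i)) ->
  dom (fun x => \sum_(i <- s) u i x) (fun x => \sum_(i <- s) w i x).
Proof.
move=> H; elim: s => [|i s IH]; first by apply: dominated_le => x; rewrite !big_nil.
have [h ch K] := dominatedD (H i) IH; exists h => // x.
by rewrite !big_cons; exact: K.
Qed.

(** u - T^n u telescopes to h - T h with h = u + T u + ... + T^(n - 1) u. *)
Lemma dominated_transfer u n : cper u -> dom u (iter n T u).
Proof.
move=> cu; exists (fun x => \sum_(i < n) iter i T u x).
  by apply: cper_sum => i; exact: cper_transfer_iter.
move=> x; elim: n => [|n IH].
  by rewrite /transfer !big_ord0 mulr0 subr0 addr0.
have -> : T (fun z => \sum_(i < n.+1) iter i T u z) x =
    T (fun z => \sum_(i < n) iter i T u z) x + T (iter n T u) x.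
  by rewrite /transfer big_ord_recr /= mulrDr.
rewrite big_ord_recr /=; lra.
Qed.

Lemma unif_derive (e : R) : 0 < e -> exists2 d, 0 < d &
  forall x s, `|s| <= d -> `|F (x + s) - F x - derive1 F x * s| <= e * `|s|.
Proof.
move=> e0; have [d d0 D] := cper_ucont cper_derive1 e0; exists d => // x s sd.
have dd (y : R) : is_derive y 1 F (derive1 F y).
  by rewrite derive1E; apply: derivableP; exact: distortion_derivable dF _.
have [c cx ->] : exists2 c, `|x - c| <= `|s| & F (x + s) - F x = derive1 F c * s.
  have [s0|s0] := leP 0 s.
    have [|c /andP[c1 c2] E] := @is_derive_MVT R F (derive1 F) x (x + s) _ (fun y _ => dd y).
      by lra.
    exists c; last by rewrite E; congr (_ * _); lra.
    by rewrite ler_norml (ger0_norm s0); apply/andP; split; lra.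
  have [|c /andP[c1 c2] E] := @is_derive_MVT R F (derive1 F) (x + s) x _ (fun y _ => dd y).
    by lra.
  exists c; first by rewrite ler_norml (ltr0_norm s0); apply/andP; split; lra.
  by rewrite -opprB E; lra.
rewrite -mulrBl normrM ler_wpM2r // distrC; apply: D; exact: le_trans sd.
Qed.

(** If c > d, then h (F x) - F'(x) h x >= c - d everywhere. For small ep the map x + ep h x then
    shows that F + ep (c - d) / 2 has rotation number at most that of F, against strict monotonicity
    at irrational values. *)
Lemma dominated_cst (c d : R) : irrational (rotation_number F) ->
  dom (cst c) (cst d) -> c <= d.
Proof.
move=> irr [h ch H]; rewrite leNgt; apply/negP => dc.
have [B B0 HB] := cper_bounded ch.
pose k := c - d; have k0 : 0 < k by rewrite subr_gt0.
(* Since |h| <= B, this tolerance keeps the linearisation error of F at x + ep h x below half of the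
   gain ep k. *)
have e0 : 0 < k / (2 * B) by rewrite divr_gt0 // mulr_gt0.
have [dl dl0 D] := unif_derive e0.
pose ep := dl / B; have ep0 : 0 < ep by rewrite divr_gt0.
pose phi x := x + ep * h x.
pose G x := F x + ep * k / 2.
have gt0 : 0 < ep * k / 2 by rewrite divr_gt0 // mulr_gt0.
have hG : circle_homeo G.
  case: hF => Fc Fl F1; split.
  - by move=> x; apply: cvgD; [exact: Fc|exact: cvg_cst].
  - by move=> x y xy; rewrite /G ltrD2r; exact: Fl.
  - by move=> x; rewrite /G F1; lra.
have phiB x : `|phi x - x| <= dl.
  rewrite /phi addrC addKr normrM gtr0_norm //.
  by rewrite /ep mulrAC ler_pdivrMr // ler_pM2l.
have := rotation_number_strict_gt dF irr hG gt0 (fun x => lexx _).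
apply/negP; rewrite -leNgt.
apply: (rotation_number_semiconj_ge hF hG phiB) => x.
have := H (F x); rewrite /transfer (inv_mapE hF) /= => Hx.
have eh : `|ep * h x| <= dl by have := phiB x; rewrite /phi addrC addKr.
have := D x _ eh; rewrite ler_norml => /andP[_ D1].
have b1 : k / (2 * B) * `|ep * h x| <= ep * k / 2.
  rewrite normrM (gtr0_norm ep0).
  apply: (@le_trans _ _ (k / (2 * B) * (ep * B))).
    by rewrite ler_pM2l // ler_pM2l.
  rewrite le_eqVlt; apply/orP; left; apply/eqP; field.
  by rewrite lt0r_neq0.
have b2 : ep * k <= ep * (h (F x) - derive1 F x * h x) by rewrite ler_pM2l // /k; lra.
by rewrite /G /phi; nra.
Qed.

End Transfer.

(** * Towers of bumps along closest returns *)

Section Towers.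
Context {R : realType} (F V : R -> R) (W : R).
Hypotheses (dF : distorted F V W) (irr : irrational (rotation_number F)).
Context (q : nat) (p : int) (Q : nat) (P : int).
Hypothesis (sc : scale (rotation_number F) q p Q P).
Local Notation g := (return_map F q p).
Local Notation gap x := (return_map F q p x - x).
Local Notation Fi := (inv_map F).
Local Notation T := (transfer F).
Local Notation dom := (dominated F).
Local Notation C := (gap_cmp W).
Implicit Types (x y z v X : R) (i j k n : nat).
Let hF := distortion_homeo dF.
Let g0 x : 0 < gap x := gap_gt0 dF sc x.
Let C1 : 1 <= C. Proof. exact: gap_cmp_ge1 dF irr. Qed.
Let C0 : 0 < C. Proof. exact: lt_le_trans ltr01 C1. Qed.

(** Compares gaps at points at most ten gaps apart: C^10 for the whole gaps crossed and C (1 + C)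
    for the remaining fraction of one. *)
Definition local_cst : R := C ^+ 10 * (C * (1 + C)).
(** The constant of [iter_derive_bound] for times up to 3 Q, enough for the longest push, in
    [iter_derive_back]. *)
Definition slope_cst : R := expR ((2 * 3)%:R * W) * (1 + C).
Definition tower_cst : R := slope_cst * local_cst ^+ 2.

Let K3_ge : C * (1 + C) <= local_cst.
Proof. have c0 := C0; have c1 := C1; rewrite /local_cst ler_peMl ?exprn_ege1 // mulr_ge0 //; lra. Qed.

Lemma local_cst_ge1 : 1 <= local_cst.
Proof. have c1 := C1; apply: le_trans K3_ge; rewrite -[leLHS]mul1r ler_pM //; lra. Qed.
Let K3_0 : 0 < local_cst. Proof. exact: lt_le_trans ltr01 local_cst_ge1. Qed.

Lemma slope_cst_gt0 : 0 < slope_cst.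
Proof. have c1 := C1; rewrite mulr_gt0 ?expR_gt0 //; lra. Qed.

Lemma tower_cst_gt0 : 0 < tower_cst.
Proof. by rewrite mulr_gt0 ?slope_cst_gt0 // exprn_gt0. Qed.

Lemma iter_return i k x : iter i F (iter k g x) = iter k g (iter i F x).
Proof. by elim: k => // k IH; rewrite /= (return_iter hF) IH. Qed.

Lemma iter_return_le k x y : (iter k g x <= iter k g y) = (x <= y).
Proof. exact: iter_le (return_homeo hF q p) _ _ _. Qed.

Lemma iter_return_mono k l x : (k <= l)%N -> iter k g x <= iter l g x.
Proof.
elim: l => [|l IH]; first by rewrite leqn0 => /eqP ->.
rewrite leq_eqVlt => /orP[/eqP -> //|]; rewrite ltnS => /IH h.
by apply: (le_trans h) => /=; rewrite ltW // -subr_gt0 g0.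
Qed.

Lemma gap_step v w : v <= w -> w <= g v ->
  gap w <= C * (1 + C) * gap v /\ gap v <= C * (1 + C) * gap w.
Proof.
move=> vw wgv; have [a1 a2] := real_bounds dF irr sc v; have [b1 b2] := real_bounds dF irr sc w.
have e1 : g w <= g (g v) by rewrite (return_le hF).
have e2 : g (g v) <= g (g w) by rewrite !(return_le hF).
have gv := g0 v; have gw := g0 w; have c1 := C1; have c0 := C0; split.
  apply: (@le_trans _ _ ((1 + C) * gap v)); first by lra.
  by rewrite ler_pM2r // ler_peMl //; lra.
apply: (le_trans a2); rewrite -mulrA ler_pM2l //; lra.
Qed.

Lemma gap_chain k X : gap (iter k g X) <= C ^+ k * gap X /\ gap X <= C ^+ k * gap (iter k g X).
Proof.
elim: k => [|k [h1 h2]]; first by rewrite !mul1r.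
have [a1 a2] := real_bounds dF irr sc (iter k g X); split => /=.
  by apply: (le_trans a1); rewrite exprS -mulrA ler_pM2l.
by apply: (le_trans h2); rewrite exprSr -mulrA ler_wpM2l // exprn_ge0 // ltW.
Qed.

Lemma find_unit n X v : X <= v -> v <= iter n.+1 g X ->
  exists2 k, (k <= n)%N & iter k g X <= v <= iter k.+1 g X.
Proof.
move=> Xv; elim: n => [|n IH] h; first by exists 0%N => //; rewrite Xv.
have [l|l] := leP v (iter n.+1 g X).
  by have [k kn kk] := IH l; exists k => //; exact: leqW.
by exists n.+1 => //; rewrite (ltW l).
Qed.

Lemma gap_local n X v : (n <= 10)%N -> X <= v -> v <= iter n g X ->
  gap v <= local_cst * gap X /\ gap X <= local_cst * gap v.
Proof.
case: n => [_ h1 /= h2|n n10 Xv vn].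
  have -> : v = X by apply/eqP; rewrite eq_le h1 h2.
  by rewrite ler_peMl // ?local_cst_ge1 // ltW.
have [k kn /andP[k1 k2]] := find_unit Xv vn.
have [a1 a2] := gap_step k1 k2; have [b1 b2] := gap_chain k X.
have Ck : C ^+ k <= C ^+ 10.
  by apply: ler_weXn2l => //; rewrite (leq_trans kn) // ltnW.
have c1 := C1; have CC : 0 < C * (1 + C) by rewrite mulr_gt0 //; lra.
have gX := g0 X; have gv := g0 v; split.
  apply: (le_trans a1); rewrite /local_cst [C ^+ 10 * _]mulrC -[leRHS]mulrA ler_pM2l //.
  by apply: (le_trans b1); rewrite ler_pM2r.
apply: (le_trans b2); rewrite /local_cst -mulrA; apply: ler_pM => //.
- by rewrite exprn_ge0 // ltW.
- exact: ltW.
Qed.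

(** In [iter_derive_bound] the gaps at v and at its image are exchanged for those at the base point
    X and its image, each at the cost of [local_cst]. *)
Lemma iter_derive_local j n X v : (j <= 3 * Q)%N -> (n <= 10)%N -> X <= v -> v <= iter n g X ->
  iter_derive F j v * gap X <= tower_cst * gap (iter j F X).
Proof.
move=> jQ n10 Xv vn; have b := iter_derive_bound dF irr sc v jQ; rewrite -/slope_cst in b.
have [_ l1] := gap_local n10 Xv vn.
have [l2 _] : gap (iter j F v) <= local_cst * gap (iter j F X) /\
   gap (iter j F X) <= local_cst * gap (iter j F v).
  by apply: (gap_local n10); rewrite -?iter_return (iter_le hF).
have D0 := iter_derive_ge0 dF j v.
apply: (@le_trans _ _ (iter_derive F j v * (local_cst * gap v))); first by rewrite ler_wpM2l.
rewrite mulrCA /tower_cst expr2 (_ : _ * gap (iter j F X) =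
  local_cst * (slope_cst * (local_cst * gap (iter j F X)))); last by ring.
rewrite ler_pM2l //; apply: (le_trans b); rewrite ler_pM2l //; exact: slope_cst_gt0.
Qed.

Lemma gap_last X : gap (iter Q F X) <= local_cst * gap X.
Proof.
have h1 := last_return_ge hF sc X; have h2 := last_return_lt hF sc X.
have [_ h] := gap_step (ltW h2) h1.
rewrite -(gap_intB dF q p (iter Q F X) P); apply: (le_trans h).
by rewrite ler_pM2r.
Qed.

Lemma transfer_iter_le n u w : (forall z, iter_derive F n z * u z <= w (iter n F z)) ->
  forall x, iter n T u x <= w x.
Proof.
move=> H x; rewrite (transfer_iterE dF).
by apply: (le_trans (H _)); rewrite (iter_inv_mapK hF).
Qed.

Lemma transfer_iter_ge0 n u : (forall z, 0 <= u z) -> forall x, 0 <= iter n T u x.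
Proof. by move=> H x; rewrite (transfer_iterE dF) mulr_ge0 // (iter_derive_ge0 dF). Qed.

Section Bumps.
Context (X : R) (chi : R -> R).
Local Notation y k := (iter k g X).
Hypotheses (cchi : cper chi) (chi01 : forall v, 0 <= chi v <= 1)
  (chi1 : forall v (l : int), y 2 <= v + l%:~R <= y 6 -> chi v = 1)
  (chi0 : forall v, chi v != 0 -> exists l : int, y 1 <= v + l%:~R <= y 7).

Definition tower_bump i x : R := chi (iter i Fi x).
(** [up_cst i] bounds the derivative of F^i on the support of chi; [down_cst i] bounds that of F^(Q
    - i) on the support of [tower_bump i], the final gap at F^Q X being replaced by the gap at X
    through [gap_last]. Their product does not depend on i, which makes the weights of the bumps
    comparable. *)
Definition up_cst i : R := tower_cst * gap (iter i F X) / gap X.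
Definition down_cst i : R := tower_cst * local_cst * gap X / gap (iter i F X).
Definition back_cst : R := 1 + slope_cst * C ^+ 2 * (1 + tower_cst * local_cst ^+ 2).

Let chi_ge0 v : 0 <= chi v. Proof. by case/andP: (chi01 v). Qed.
Let chi_le1 v : chi v <= 1. Proof. by case/andP: (chi01 v). Qed.

Lemma cper_tower_bump i : cper (tower_bump i).
Proof. by apply: cper_comp => //; exact: homeo_iter (homeo_inv hF) i. Qed.

Lemma up_cst_gt0 i : 0 < up_cst i.
Proof. by do ![exact: g0|exact: tower_cst_gt0|apply: divr_gt0|apply: mulr_gt0]. Qed.

Lemma down_cst_gt0 i : 0 < down_cst i.
Proof. by do ![exact: g0|exact: K3_0|exact: tower_cst_gt0|apply: divr_gt0|apply: mulr_gt0]. Qed.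

Lemma up_down i : up_cst i * down_cst i = tower_cst ^+ 2 * local_cst.
Proof.
have a0 := lt0r_neq0 (g0 X); have b0 := lt0r_neq0 (g0 (iter i F X)).
by rewrite /up_cst /down_cst; field; rewrite a0 b0.
Qed.

(** T^i chi is the product of (F^i)' and chi, both taken at F^(-i) x, and the derivative is
    controlled on the support of chi. *)
Lemma dominated_up i : (i <= Q)%N -> dom chi (fun x => up_cst i * tower_bump i x).
Proof.
move=> iQ; apply: (dominated_trans (dominated_transfer dF i cchi)).
apply: dominated_le; apply: transfer_iter_le => z.
rewrite /tower_bump (iter_inv_mapE hF).
have [->|nz] := eqVneq (chi z) 0; first by rewrite !mulr0.
apply: ler_wpM2r => //; have [l /andP[l1 l2]] := chi0 nz.
rewrite -(iter_derive_int dF i z l) /up_cst ler_pdivlMr //.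
apply: (@iter_derive_local i 7) => //.
- by rewrite (leq_trans iQ) // leq_pmull.
- by apply: le_trans l1; exact: (@iter_return_mono 0 1).
Qed.

Lemma dominated_down i : (i <= Q)%N ->
  dom (tower_bump i) (fun x => down_cst i * tower_bump Q x).
Proof.
move=> iQ; apply: (dominated_trans (dominated_transfer dF (Q - i) (cper_tower_bump i))).
apply: dominated_le; apply: transfer_iter_le => z.
rewrite /tower_bump -{2}(subnKC iQ) iterD (iter_inv_mapE hF).
set t := iter i Fi z; have zE : z = iter i F t by rewrite (iter_inv_mapK hF).
have [->|nz] := eqVneq (chi t) 0; first by rewrite !mulr0.
apply: ler_wpM2r => //; have [l /andP[l1 l2]] := chi0 nz.
rewrite -(iter_derive_int dF (Q - i) z l) /down_cst ler_pdivlMr //.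
apply: (@le_trans _ _ (tower_cst * gap (iter (Q - i) F (iter i F X)))).
  apply: (@iter_derive_local (Q - i) 7) => //.
  - by rewrite (leq_trans (leq_subr _ _)) // leq_pmull.
  - rewrite zE -(iter_int hF) (iter_le hF).
    by apply: le_trans l1; exact: (@iter_return_mono 0 1).
  - by rewrite zE -(iter_int hF) -iter_return (iter_le hF).
by rewrite -iterD subnK // -mulrA ler_pM2l ?tower_cst_gt0 // gap_last.
Qed.

Lemma tower_bump_supp i x : tower_bump i x != 0 ->
  exists l : int, iter 1 g (iter i F X) <= x + l%:~R <= iter 7 g (iter i F X).
Proof.
move=> /chi0[l /andP[l1 l2]]; exists l.
rewrite -!iter_return -[x](iter_inv_mapK hF i) -(iter_int hF) !(iter_le hF).
by rewrite l1 l2.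
Qed.

End Bumps.
End Towers.

Section TowerCover.
Context {R : realType} (F V : R -> R) (W : R).
Hypotheses (dF : distorted F V W) (irr : irrational (rotation_number F)).
Context (q : nat) (p : int) (Q : nat) (P : int).
Hypothesis (sc : scale (rotation_number F) q p Q P).
Local Notation g := (return_map F q p).
Local Notation gap x := (return_map F q p x - x).
Local Notation Fi := (inv_map F).
Local Notation T := (transfer F).
Local Notation dom := (dominated F).
Local Notation C := (gap_cmp W).
Implicit Types (x y z v X : R) (i j k n : nat).
Let hF := distortion_homeo dF.
Let g0 x : 0 < gap x := gap_gt0 dF sc x.

Context (X : R) (chi : R -> R).
Local Notation y k := (iter k g X).
Hypotheses (cchi : cper chi) (chi01 : forall v, 0 <= chi v <= 1)
  (chi1 : forall v (l : int), y 2 <= v + l%:~R <= y 6 -> chi v = 1)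
  (chi0 : forall v, chi v != 0 -> exists l : int, y 1 <= v + l%:~R <= y 7).
Local Notation b := (tower_bump F chi).

Let chi_ge0 v : 0 <= chi v. Proof. by case/andP: (chi01 v). Qed.
Let chi_le1 v : chi v <= 1. Proof. by case/andP: (chi01 v). Qed.

(** F^Q - P moves to the left by at most one gap, so it carries the support [g X, g^7 X] of chi into
    [X, g^7 X]. *)
Lemma tower_bump_last_supp z : b Q z != 0 -> exists l : int, y 0 <= z + l%:~R <= y 7.
Proof.
move=> /(tower_bump_supp dF chi0)[l /andP[l1 l2]]; exists (l - P).
rewrite intrB addrA; apply/andP; split.
  rewrite lerBrDr; apply: le_trans l1 => /=.
  have := last_return_ge hF sc X; rewrite (return_intB hF) /=; lra.
rewrite lerBlDr; apply: (le_trans l2); rewrite -(iter_return dF).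
by have := last_return_lt hF sc (y 7); lra.
Qed.

Lemma iter_derive_two z : iter_derive F (2 * q) z <= slope_cst W * C ^+ 2.
Proof.
have j2 : (2 * q <= 3 * Q)%N by rewrite leq_mul // ltnW // (scale_Q sc).
have := iter_derive_bound dF irr sc z j2; rewrite -/(slope_cst W).
have -> : gap (iter (2 * q) F z) = gap (iter 2 g z).
  rewrite (return_iterE hF) -(gap_intB dF q p _ (2%:Z * p)) intrM.
  by rewrite -[2%:Z%:~R]/(2%:R : R).
have [h _] := gap_chain dF irr sc 2 z.
move=> H; rewrite -(ler_pM2r (g0 z)); apply: (le_trans H).
by rewrite -[leRHS]mulrA ler_pM2l ?(slope_cst_gt0 dF irr).
Qed.

Let N3 := (3 * (Q - q))%N.

(** F^(Q - q), corrected by P - p, moves to the left by between one and two gaps. Three applications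
    therefore send g^8 X to the right of g^2 X and g^9 X to the left of g^6 X. *)
Lemma back_shift z : y 8 <= z <= y 9 -> y 2 <= iter N3 F z - (3%:Z * (P - p))%:~R <= y 6.
Proof.
move=> /andP[z1 z2].
have s1 := scale_neg sc; have s2 := scale_lt sc; have s3 := scale_pos sc.
have qQ : (Q - q)%:R = Q%:R - q%:R :> R by rewrite natrB // ltnW // (scale_Q sc).
have Ey k : y k = iter (k * q) F X - (k%:Z * p)%:~R.
  by rewrite (return_iterE hF) intrM.
have Es k : iter N3 F (y k) - (3%:Z * (P - p))%:~R =
   iter (N3 + k * q) F X - (3%:Z * (P - p) + k%:Z * p)%:~R.
  by rewrite Ey (iter_intB hF) -iterD intrD; lra.
have z1' : iter N3 F (y 8) <= iter N3 F z by rewrite (iter_le hF).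
have z2' : iter N3 F z <= iter N3 F (y 9) by rewrite (iter_le hF).
apply/andP; split.
  apply: (@le_trans _ _ (iter N3 F (y 8) - (3%:Z * (P - p))%:~R)); last by lra.
  rewrite Es Ey; apply: (orbit_order_le hF) => //.
  rewrite /N3 natrD !natrM qQ intrD !intrM intrB -![_%:Z%:~R]/(_%:R : R); nra.
apply: (@le_trans _ _ (iter N3 F (y 9) - (3%:Z * (P - p))%:~R)); first by lra.
rewrite Es Ey; apply: (orbit_order_le hF) => //.
rewrite /N3 natrD !natrM qQ intrD !intrM intrB -![_%:Z%:~R]/(_%:R : R); nra.
Qed.

Lemma iter_derive_back z : y 8 <= z <= y 9 ->
  iter_derive F N3 z <= slope_cst W * local_cst W ^+ 2.
Proof.
move=> zz; have /andP[s1 s2] := back_shift zz; move: zz => /andP[z1 z2].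
have mono k l x (h : (k <= l)%N) : iter k g x <= iter l g x by apply: (iter_return_mono dF sc).
have j3 : (N3 <= 3 * Q)%N by rewrite leq_mul // leq_subr.
have H := iter_derive_bound dF irr sc z j3; rewrite -/(slope_cst W) in H.
have [_ h1] := @gap_local _ _ _ _ dF irr _ _ _ _ sc 9 X z isT (le_trans (mono 0%N 8%N X isT) z1) z2.
have [h2 _] := @gap_local _ _ _ _ dF irr _ _ _ _ sc 6 X _ isT (le_trans (mono 0%N 2%N X isT) s1) s2.
rewrite (gap_intB dF) in h2.
have l0 : 0 < local_cst W by apply: lt_le_trans ltr01 _; exact: local_cst_ge1 dF irr.
rewrite -(ler_pM2r (g0 z)); apply: (le_trans H); rewrite -[leRHS]mulrA ler_pM2l ?(slope_cst_gt0 dF irr) //.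
by apply: (le_trans h2); rewrite expr2 -[leRHS]mulrA ler_pM2l.
Qed.

(** Closes the cycle from the last bump to chi. The part of [b Q] not under the plateau of chi lives
    on [X, g^2 X] and [g^6 X, g^7 X]. Pushing it by F^(2 q) puts the first piece onto the plateau
    and the second on [g^8 X, g^9 X], from where F^(3 (Q - q)) brings it back to the plateau. *)
Lemma dominated_back : dom (b Q) (fun x => back_cst W * chi x).
Proof.
have K1 := slope_cst_gt0 dF irr; have K3 := local_cst_ge1 dF irr.
have C1 := gap_cmp_ge1 dF irr.
pose w1 x := b Q x * (1 - chi x).
pose w2 := iter (2 * q) T w1.
pose w3 x := w2 x * (1 - chi x).
pose w4 := iter N3 T w3.
pose A := slope_cst W * C ^+ 2; pose B := slope_cst W * local_cst W ^+ 2.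
have A0 : 0 < A by rewrite mulr_gt0 // exprn_gt0 //; lra.
have B0 : 0 < B by rewrite mulr_gt0 // exprn_gt0 //; lra.
have cb : cper (b Q) by apply: (cper_tower_bump dF).
have c1 : cper (fun x => 1 - chi x) by apply: cperB => //; exact: cper_cst.
have cw1 : cper w1 by exact: cperM.
have cw2 : cper w2 by apply: (cper_transfer_iter dF).
have cw3 : cper w3 by exact: cperM.
have b01 v : 0 <= b Q v <= 1 by exact: chi01.
have w1_01 v : 0 <= w1 v <= 1.
  have /andP[x1 x2] := b01 v; have x3 := chi_ge0 v; have x4 := chi_le1 v.
  by rewrite /w1 mulr_ge0 //=; [rewrite -[leRHS]mul1r ler_pM //; lra|lra].
have w2_ge0 : forall v, 0 <= w2 v by apply: (transfer_iter_ge0 dF) => z; case/andP: (w1_01 z).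
have w2_le v : w2 v <= A * 1.
  apply: (@transfer_iter_le _ _ _ _ dF (2 * q) w1 (fun=> A * 1)) => z.
  have /andP[x1 x2] := w1_01 z.
  by apply: ler_pM => //; [exact: (iter_derive_ge0 dF)|exact: iter_derive_two].
have w2_supp v : w2 v != 0 -> exists l : int,
    (y 2 <= v + l%:~R <= y 4) || (y 8 <= v + l%:~R <= y 9).
  rewrite /w2 (transfer_iterE dF) mulf_eq0 negb_or => /andP[_].
  set z := iter _ Fi v; have vz : v = iter (2 * q) F z by rewrite (iter_inv_mapK hF).
  rewrite /w1 mulf_eq0 negb_or => /andP[bz cz].
  have [l /andP[l1 l2]] := tower_bump_last_supp bz; exists (l - 2%:Z * p).
  have -> : v + (l - 2%:Z * p)%:~R = iter 2 g (z + l%:~R).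
    rewrite (return_iterE hF) (iter_int hF) vz intrB intrM -[2%:Z%:~R]/(2%:R : R); lra.
  have [h|h] := leP (z + l%:~R) (y 2).
    apply/orP; left; rewrite (iter_return_le dF q p 2 X) (iter_return_le dF q p 2 _ (y 2)).
    by rewrite l1 h.
  have h' : y 6 <= z + l%:~R.
    rewrite leNgt; apply/negP => h6; move: cz; rewrite (chi1 (l := l)) ?subrr ?eqxx //.
    by rewrite !ltW.
  apply/orP; right; rewrite (iter_return_le dF q p 2 (y 6)) (iter_return_le dF q p 2 _ (y 7)).
  by rewrite h' l2.
have w3_supp v : w3 v != 0 -> exists l : int, y 8 <= v + l%:~R <= y 9.
  rewrite /w3 mulf_eq0 negb_or => /andP[/w2_supp[l /orP[/andP[l1 l2]|h]] cz]; last by exists l.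
  exfalso; move: cz; rewrite (chi1 (l := l)) ?subrr ?eqxx // l1 (le_trans l2) //.
  exact: (iter_return_mono dF sc).
have w4_le v : w4 v <= B * A * chi v.
  apply: (@transfer_iter_le _ _ _ _ dF N3 w3 (fun v => B * A * chi v)) => z.
  have [->|nz] := eqVneq (w3 z) 0; first by rewrite mulr0 mulr_ge0 // ltW // mulr_gt0.
  have [l lz] := w3_supp z nz.
  rewrite (chi1 (v := iter N3 F z) (l := l - 3%:Z * (P - p))); last first.
    by have := back_shift lz; rewrite (iter_int hF) intrB addrA.
  rewrite mulr1; apply: ler_pM => //.
  - exact: (iter_derive_ge0 dF).
  - by rewrite mulr_ge0 // subr_ge0.
  - by rewrite -(iter_derive_int dF N3 z l); exact: iter_derive_back.
  - have := w2_le z; rewrite mulr1; apply: le_trans; rewrite ler_piMr //.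
    by have := chi_ge0 z; lra.
have d1 : dom w1 w2 by apply: (dominated_transfer dF).
have d3 : dom w3 w4 by apply: (dominated_transfer dF).
have e1 : dom (b Q) (fun x => chi x + w1 x).
  apply: dominated_le => x; rewrite /w1.
  have /andP[x1 x2] := b01 x; have x3 := chi_ge0 x; have x4 := chi_le1 x; nra.
have refl u : dom u u by apply: dominated_le => x.
have e2 : dom w2 (fun x => A * chi x + w3 x).
  apply: dominated_le => x; rewrite /w3.
  have x0 := w2_ge0 x; have := w2_le x; rewrite mulr1 => x1.
  have x3 := chi_ge0 x; have x4 := chi_le1 x; nra.
apply: (dominated_trans e1).
apply: (dominated_trans (dominatedD (refl chi) d1)).
apply: (dominated_trans (dominatedD (refl chi) e2)).
apply: (dominated_trans (dominatedD (refl chi) (dominatedD (refl (fun x => A * chi x)) d3))).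
apply: dominated_le => x; have := w4_le x; rewrite /back_cst -/A.
rewrite (_ : tower_cst W * local_cst W ^+ 2 = B * local_cst W ^+ 2) //.
have lc : 1 <= local_cst W ^+ 2 by rewrite exprn_ege1.
have x3 := chi_ge0 x => x5.
suff : B * A * chi x <= A * (B * local_cst W ^+ 2) * chi x by lra.
by rewrite ler_wpM2r // [B * A]mulrC ler_pM2l // ler_peMr // ltW.
Qed.

End TowerCover.

Section TowerCount.
Context {R : realType} (F V : R -> R) (W : R).
Hypotheses (dF : distorted F V W) (irr : irrational (rotation_number F)).
Context (q : nat) (p : int) (Q : nat) (P : int).
Hypothesis (sc : scale (rotation_number F) q p Q P).
Local Notation g := (return_map F q p).
Local Notation Fi := (inv_map F).
Implicit Types (x y z v X : R) (i j k n : nat).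
Let hF := distortion_homeo dF.

Context (X : R) (chi : R -> R).
Local Notation y k := (iter k g X).
Hypotheses (chi01 : forall v, 0 <= chi v <= 1)
  (chi1 : forall v (l : int), y 2 <= v + l%:~R <= y 6 -> chi v = 1)
  (chi0 : forall v, chi v != 0 -> exists l : int, y 1 <= v + l%:~R <= y 7).
Local Notation b := (tower_bump F chi).

(** The orbit of F^(-Q) x meets [g^3 X, g^5 X) at some time i < Q, so the bump of index Q - i equals
    1 at x. These indices run from 1 to Q, hence the shift [i.+1]. *)
Lemma tower_bump_cover x : 1 <= \sum_(i < Q) b i.+1 x.
Proof.
have [i [l [iQ /andP[l1 l2]]]] := hit_window hF sc (iter Q Fi x) (y 3).
have iQ' : ((Q - i).-1 < Q)%N.
  by rewrite prednK ?subn_gt0 // leq_subr.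
rewrite (bigD1 (Ordinal iQ')) //= prednK ?subn_gt0 //.
have -> : b (Q - i) x = 1.
  rewrite /tower_bump.
  have -> : iter (Q - i) Fi x = iter i F (iter Q Fi x).
    by rewrite -{2}(subnKC (ltnW iQ)) iterD (iter_inv_mapK hF).
  apply: (chi1 (l := - l)); rewrite mulrNz; apply/andP; split.
    by apply: le_trans l1; exact: (@iter_return_mono _ _ _ _ dF _ _ _ _ sc 2 3).
  apply: (le_trans (ltW l2)); exact: (@iter_return_mono _ _ _ _ dF _ _ _ _ sc 5 6).
by rewrite lerDl; apply: sumr_ge0 => k _; case/andP: (chi01 (iter k.+1 Fi x)).
Qed.

(** [return_sum] is applied to the step function V0, which jumps at the points x + l. Seven gaps are
    counted although the support of chi spans six: V0 sees jumps in intervals open on the left, and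
    the gap from X to g X makes the left end of the support count. *)
Lemma tower_bump_count x : \sum_(i < Q) b i.+1 x <= 7.
Proof.
pose V0 v : R := (Num.floor (v - x))%:~R.
have V0h : {homo V0 : u v / u <= v} by move=> u v uv; rewrite /V0 ler_int le_floor // lerB.
have V01 v : V0 (v + 1) = V0 v + 1.
  by rewrite /V0 addrAC -[X in _ + X]/(1%:~R) floorDrz ?intr_int // intrKfloor intrD.
have s7 k : \sum_(i < Q) (V0 (iter i.+1 F (y k)) - V0 (iter i.+1 F X)) <= k%:R.
  elim: k => [|k IH]; first by rewrite big1 // => i _; rewrite subrr.
  rewrite (eq_bigr (fun i : 'I_Q => (V0 (iter i.+1 F (y k.+1)) - V0 (iter i.+1 F (y k))) +
    (V0 (iter i.+1 F (y k)) - V0 (iter i.+1 F X)))) => [|i _]; last by lra.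
  rewrite big_split /= -natr1 addrC lerD //.
  have := return_sum hF irr sc (F (y k)) V0h V01; rewrite big_mkord.
  apply: le_trans; rewrite le_eqVlt; apply/orP; left; apply/eqP; apply: eq_bigr => i _.
  by rewrite -!iterSr -(return_iter hF q p 1) -!iterSr.
apply: le_trans (s7 7%N); apply: ler_sum => i _.
have mono : iter i.+1 F X <= iter i.+1 F (y 7).
  by rewrite (iter_le hF); exact: (@iter_return_mono _ _ _ _ dF _ _ _ _ sc 0 7).
have [->|nz] := eqVneq (b i.+1 x) 0; first by rewrite subr_ge0 V0h.
have [l /andP[l1 l2]] := tower_bump_supp dF chi0 nz.
have h1 : l%:~R <= V0 (iter i.+1 F (y 7)).
  by rewrite /V0 ler_int floor_ge_int_tmp (iter_return dF) lerBrDl.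
have h2 : V0 (iter i.+1 F X) + 1 <= l%:~R.
  rewrite /V0 -[X in _ + X]/(1%:~R) -intrD ler_int lezD1 floor_lt_int ltrBlDl.
  by apply: lt_le_trans l1; exact: (return_gt hF sc).
have /andP[_ h3] := chi01 (iter i.+1 Fi x).
by rewrite /tower_bump; lra.
Qed.

End TowerCount.

(** * Weights of the bumps and the two-sided estimate *)

Section CoreEstimate.
Context {R : realType} (F V : R -> R) (W : R).
Hypotheses (dF : distorted F V W) (irr : irrational (rotation_number F)).
Local Notation dom := (dominated F).
Let hF := distortion_homeo dF.

(** Modulo coboundaries chi has weight about 1 / S. Each b_i is bounded by a multiple B_i of chi
    through b_Q, and chi by a multiple A_i of b_i with A_i B_i constant, so b_i has weight B_i / S
    up to a constant depending on W only. *)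
Lemma tower_exists (e : R) : 0 < e -> exists (Q : nat) (b : nat -> R -> R) (c s : nat -> R),
  [/\ (forall i, cper (b i)) /\ (forall i x, 0 <= b i x),
      forall x, 1 <= \sum_(i < Q) b i x <= 7,
      (forall i, 0 <= c i) /\ \sum_(i < Q) c i = 1,
      forall i x, b i x != 0 -> exists l : int, `|x + l%:~R - s i| <= e &
      forall i, (i < Q)%N -> dom (cst (c i / (7 * back_cst W * (tower_cst W ^+ 2 * local_cst W)))) (b i) /\
        dom (b i) (cst (c i * (7 * back_cst W * (tower_cst W ^+ 2 * local_cst W))))].
Proof.
(* The supports span six gaps, so e / 7 makes them shorter than e; 1/8 keeps them short enough for
   [bump_exists]. *)
move=> e0; pose eta := Num.min (e / 7) (1 / 8).
have eta0 : 0 < eta by rewrite lt_min !divr_gt0.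
have [q [p [Q [P [sc fine]]]]] := fine_scale dF irr eta0.
pose g := return_map F q p; pose X : R := 0; pose y k := iter k g X.
have ylt k l v : (k < l)%N -> iter k g v < iter l g v.
  move=> kl; apply: (@lt_le_trans _ _ (iter k.+1 g v)); last exact: (iter_return_mono dF sc).
  exact: (return_gt hF sc).
have ystep k v : iter k.+1 g v - iter k g v < eta by exact: fine.
have y12 : y 1 < y 2 by exact: ylt. have y26 : y 2 < y 6 by exact: ylt.
have y67 : y 6 < y 7 by exact: ylt.
have ylen v : iter 7 g v - iter 1 g v <= 6 * eta.
  have := ystep 1%N v; have := ystep 2%N v; have := ystep 3%N v; have := ystep 4%N v.
  by have := ystep 5%N v; have := ystep 6%N v; lra.
have eta1 : eta <= e / 7 by rewrite ge_min lexx.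
have eta2 : eta <= 1 / 8 by rewrite ge_min lexx orbT.
pose m := (y 2 + y 6) / 2; pose r := (y 6 - y 2) / 2.
pose r' := r + Num.min (y 2 - y 1) (y 7 - y 6).
have rr' : r < r' by rewrite ltrDl lt_min; apply/andP; split; lra.
have min1 : Num.min (y 2 - y 1) (y 7 - y 6) <= y 2 - y 1 by rewrite ge_min lexx.
have min2 : Num.min (y 2 - y 1) (y 7 - y 6) <= y 7 - y 6 by rewrite ge_min lexx orbT.
have [chi [cchi chi01 chi1 chi0]] : exists chi, [/\ cper chi, forall v, 0 <= chi v <= 1,
    forall v (l : int), y 2 <= v + l%:~R <= y 6 -> chi v = 1 &
    forall v, chi v != 0 -> exists l : int, y 1 <= v + l%:~R <= y 7].
  have [||chi [c1 c2 c3 c4]] := @bump_exists R m r r' _ rr'.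
  - by rewrite /r; lra.
  - by rewrite /r' /r; have := ylen X; rewrite -/(y 7) -/(y 1); lra.
  exists chi; split => //.
    move=> v l /andP[v1 v2]; apply: (c3 v l).
    by rewrite ler_norml /m /r; apply/andP; split; lra.
  move=> v /c4[l]; rewrite ltr_norml /m => /andP[v1 v2]; exists l.
  by rewrite /r' /r in v1 v2; apply/andP; split; lra.
pose b i := tower_bump F chi i.+1.
pose B i := down_cst F W q p X i.+1; pose S := \sum_(i < Q) B i.
have B0 i : 0 < B i by exact: (down_cst_gt0 dF irr sc).
have Q0 : (0 < Q)%N by exact: leq_ltn_trans (leq0n _) (scale_Q sc).
have S0 : 0 < S.
  apply: (lt_le_trans (B0 0%N)); rewrite /S (bigD1 (Ordinal Q0)) //= lerDl.
  by apply: sumr_ge0 => i _; exact: ltW.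
have T0 := tower_cst_gt0 dF irr; have L1 := local_cst_ge1 dF irr.
have L0 : 0 < local_cst W by exact: lt_le_trans L1.
have K5 : 0 < back_cst W.
  rewrite /back_cst addr_gt0 // mulr_gt0 //.
    by rewrite mulr_gt0 ?(slope_cst_gt0 dF irr) // exprn_gt0 // (lt_le_trans _ (gap_cmp_ge1 dF irr)).
  by rewrite addr_gt0 // mulr_gt0 // exprn_gt0.
pose U := tower_cst W ^+ 2 * local_cst W.
have U0 : 0 < U by rewrite mulr_gt0 // exprn_gt0.
pose A i := up_cst F W q p X i.+1.
have A0 i : 0 < A i by exact: (up_cst_gt0 dF irr sc).
have AB i : A i * B i = U by exact: (up_down dF sc).
have cb i : cper (b i) by apply: (cper_tower_bump dF).
have b0 i x : 0 <= b i x by rewrite /b /tower_bump; case/andP: (chi01 (iter i.+1 (inv_map F) x)).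
have cov x := tower_bump_cover dF sc chi01 chi1 x.
have cnt x := tower_bump_count dF irr sc chi01 chi0 x.
have up i : (i < Q)%N -> dom chi (fun x => A i * b i x).
  exact: (dominated_up dF irr sc cchi chi01 chi0).
have back := dominated_back dF irr sc cchi chi01 chi1 chi0.
have down i : (i < Q)%N -> dom (b i) (fun x => B i * (back_cst W * chi x)).
  move=> iQ; apply: (dominated_trans (dominated_down dF irr sc cchi chi01 chi0 iQ)).
  exact: dominatedZ (ltW (B0 i)) back.
(* Lower bound for the weight of chi: sum over i the bounds of the b_i, which cover the circle. *)
have H1 : dom (cst 1) (fun x => S * (back_cst W * chi x)).
  apply: (@dominated_trans _ _ _ (fun x => \sum_(i < Q) b i x)).
    by apply: dominated_le => x; exact: cov.
  have -> : (fun x => S * (back_cst W * chi x)) =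
      (fun x => \sum_(i < Q) (B i * (back_cst W * chi x))).
    by apply/funext => x; rewrite /S mulr_suml.
  by apply: dominated_sum => i; exact: down.
(* Upper bound for the weight of chi: average the bounds chi <= A_i b_i with the weights B_i / S,
   using A_i B_i = U and the multiplicity 7. *)
have H2 : dom chi (cst (7 * U / S)).
  have -> : chi = (fun x => \sum_(i < Q) (B i / S * chi x)).
    by apply/funext => x; rewrite -mulr_suml -mulr_suml mulfV ?mul1r // gt_eqF.
  apply: (@dominated_trans _ _ _ (fun x => \sum_(i < Q) (B i / S * (A i * b i x)))).
    by apply: dominated_sum => i; apply: dominatedZ; [rewrite divr_ge0 // ltW|exact: up].
  apply: dominated_le => x.
  have -> : \sum_(i < Q) (B i / S * (A i * b i x)) = U / S * \sum_(i < Q) b i x.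
    by rewrite mulr_sumr; apply: eq_bigr => i _; rewrite -(AB i); ring.
  rewrite /= (_ : 7 * U / S = U / S * 7); last by ring.
  by rewrite ler_pM2l ?divr_gt0 //; exact: cnt.
pose K := 7 * back_cst W * U.
have K0 : 0 < K by apply: mulr_gt0 => //; exact: mulr_gt0.
exists Q, b, (fun i => B i / S), (fun i => iter i.+1 F (y 4)); split => //.
- by move=> x; rewrite cov cnt.
- split; first by move=> i; rewrite divr_ge0 // ltW.
  by rewrite -mulr_suml mulfV // gt_eqF.
- move=> i x nz; have [l /andP[l1 l2]] := tower_bump_supp dF chi0 nz; exists l.
  have E : iter i.+1 F (y 4) = iter 4 g (iter i.+1 F X) by rewrite /y (iter_return dF).
  have h1 : iter 1 g (iter i.+1 F X) <= iter 4 g (iter i.+1 F X) by exact: (iter_return_mono dF sc).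
  have h2 : iter 4 g (iter i.+1 F X) <= iter 7 g (iter i.+1 F X) by exact: (iter_return_mono dF sc).
  have h3 := ylen (iter i.+1 F X).
  by rewrite E ler_norml; apply/andP; split; lra.
move=> i iQ; rewrite -/U -/K; split.
  apply: (@dominated_trans _ _ _ (fun x => (A i)^-1 * (A i * b i x))); last first.
    by apply: dominated_le => x; rewrite mulKf // gt_eqF.
  apply: (@dominated_trans _ _ _ (fun x => (A i)^-1 * chi x)); last first.
    by apply: dominatedZ; [rewrite invr_ge0 ltW|exact: up].
  have kS0 : 0 < S * back_cst W by rewrite mulr_gt0.
  apply: (@dominated_trans _ _ _ (fun x => (A i * (S * back_cst W))^-1 * cst 1 x)).
    apply: dominated_le => x /=; rewrite mulr1 /K -(AB i).
    have -> : B i / S / (7 * back_cst W * (A i * B i)) = (7 * (A i * (S * back_cst W)))^-1.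
      by field; rewrite !lt0r_neq0.
    by rewrite invfM ler_piMl ?invf_le1 ?ler1n // invr_ge0 ltW // mulr_gt0.
  have := dominatedZ (_ : 0 <= (A i * (S * back_cst W))^-1) H1.
  move=> /(_ (ltac:(by rewrite invr_ge0 ltW // mulr_gt0))) h.
  apply: (dominated_trans h); apply: dominated_le => x.
  rewrite le_eqVlt; apply/orP; left; apply/eqP; field.
  by rewrite !lt0r_neq0.
apply: (dominated_trans (down i iQ)).
have h : dom (fun x => B i * back_cst W * chi x) (fun x => B i * back_cst W * (cst (7 * U / S) x)).
  by apply: dominatedZ => //; rewrite mulr_ge0 // ltW.
apply: (@dominated_trans _ _ _ (fun x => B i * back_cst W * chi x)).
  by apply: dominated_le => x; rewrite mulrA.
apply: (dominated_trans h); apply: dominated_le => x /=.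
by rewrite le_eqVlt; apply/orP; left; apply/eqP; rewrite /K; ring.
Qed.

(** On the small support of b_i the function w is nearly constant, and b_i has weight c_i up to the
    factor K; summing, w has weight M, the c_i-average of its values, up to constants. C depends
    neither on w nor on e, which is what [mean_functional_upper] exploits. *)
Theorem core_estimate : exists2 C : R, 0 < C & forall w, cper w -> (forall x, 0 <= w x) ->
  forall e, 0 < e -> exists m, [/\ 0 <= m, dom (cst m) w & dom w (cst (C * m + e))].
Proof.
have T0 := tower_cst_gt0 dF irr; have L1 := local_cst_ge1 dF irr.
pose K := 7 * back_cst W * (tower_cst W ^+ 2 * local_cst W).
have K5 : 0 < back_cst W.
  have h1 := slope_cst_gt0 dF irr; have h2 : 0 < gap_cmp W by exact: lt_le_trans (gap_cmp_ge1 dF irr).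
  have h3 : 0 < local_cst W by exact: lt_le_trans L1.
  by rewrite /back_cst; do ![exact: ltr01|assumption|apply: addr_gt0|apply: exprn_gt0|apply: mulr_gt0].
have K0 : 0 < K.
  have h3 : 0 < local_cst W by exact: lt_le_trans L1.
  by rewrite /K; do ![done|apply: exprn_gt0|apply: mulr_gt0].
exists (7 * K ^+ 2); first by rewrite mulr_gt0 // exprn_gt0.
move=> w cw w0 e e0; pose e' := e / (2 * K).
have e'0 : 0 < e' by rewrite divr_gt0 // mulr_gt0.
have [d d0 D] := cper_ucont cw e'0.
have [Q [b [c [s [[cb b0] cnt [c0 c1] supp dbd]]]]] := tower_exists d0.
rewrite -/K in dbd.
(* Truncated at 0, since [dominatedZ] multiplies by nonnegative coefficients only. *)
pose mm i := Num.max 0 (w (s i) - e').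
have mm0 i : 0 <= mm i by rewrite le_max lexx.
have lo i x : mm i * b i x <= w x * b i x.
  have [->|nz] := eqVneq (b i x) 0; first by rewrite !mulr0.
  have [l ls] := supp i x nz.
  apply: ler_wpM2r => //; rewrite ge_max w0 /= -(cper_int x l cw).
  by have := D _ _ ls; rewrite ler_norml => /andP[]; lra.
have hi i x : w x * b i x <= (mm i + 2 * e') * b i x.
  have [->|nz] := eqVneq (b i x) 0; first by rewrite !mulr0.
  have [l ls] := supp i x nz.
  apply: ler_wpM2r => //; rewrite -(cper_int x l cw).
  have : w (s i) - e' <= mm i by rewrite le_max lexx orbT.
  by have := D _ _ ls; rewrite ler_norml => /andP[]; lra.
pose M := \sum_(i < Q) mm i * c i.
have M0 : 0 <= M by apply: sumr_ge0 => i _; rewrite mulr_ge0.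
exists (M / (7 * K)); split; first by rewrite divr_ge0 // mulr_ge0 // ltW.
  apply: (@dominated_trans _ _ _ (fun x => 7^-1 * \sum_(i < Q) mm i * b i x)).
    have -> : cst (M / (7 * K)) = (fun x : R => 7^-1 * \sum_(i < Q) mm i * cst (c i / K) x).
      apply/funext => x /=; rewrite /M mulr_suml mulr_sumr; apply: eq_bigr => i _.
      by rewrite invfM; ring.
    apply: dominatedZ => //; apply: dominated_sum => i; apply: dominatedZ => //.
    by have [] := dbd i (ltn_ord i).
  apply: dominated_le => x; rewrite ler_pdivrMl //.
  apply: (@le_trans _ _ (w x * \sum_(i < Q) b i x)).
    by rewrite mulr_sumr; apply: ler_sum => i _.
  by rewrite [7 * _]mulrC; apply: ler_wpM2l => //; case/andP: (cnt x).
apply: (@dominated_trans _ _ _ (fun x => \sum_(i < Q) (mm i + 2 * e') * b i x)).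
  apply: dominated_le => x; apply: (@le_trans _ _ (w x * \sum_(i < Q) b i x)).
    by rewrite ler_peMr //; case/andP: (cnt x).
  by rewrite mulr_sumr; apply: ler_sum => i _.
have -> : cst (7 * K ^+ 2 * (M / (7 * K)) + e) =
    (fun x : R => \sum_(i < Q) (mm i + 2 * e') * cst (c i * K) x).
  apply/funext => x /=.
  rewrite (eq_bigr (fun i : 'I_Q => K * (mm i * c i) + 2 * e' * K * c i)) => [|i _]; last by ring.
  rewrite big_split /= -!mulr_sumr c1 -/M mulr1 /e'; field.
  by rewrite lt0r_neq0.
apply: dominated_sum => i; apply: dominatedZ; first by rewrite addr_ge0 // mulr_ge0 // ltW.
by have [] := dbd i (ltn_ord i).
Qed.
End CoreEstimate.

(** * The mean functional *)

Definition mean_functional (R : realType) (F u : R -> R) : R :=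
  sup [set c | dominated F (cst c) u].

Section MeanFunctional.
Context {R : realType} (F V : R -> R) (W : R).
Hypotheses (dF : distorted F V W) (irr : irrational (rotation_number F)).
Local Notation dom := (dominated F).
Local Notation T := (transfer F).
Local Notation lam := (mean_functional F).
Implicit Types (u w h : R -> R).

Let domset u := [set c | dom (cst c) u].

Lemma domset_has_sup u : cper u -> has_sup (domset u).
Proof.
move=> cu; have [B B0 HB] := cper_bounded cu; split.
  by exists (- B); apply: dominated_le => x /=; have := HB x; rewrite ler_norml => /andP[].
exists B => c /= H; apply: (dominated_cst dF irr); apply: (dominated_trans H).
by apply: dominated_le => x /=; have := HB x; rewrite ler_norml => /andP[].
Qed.

Lemma mean_functional_lower u (e : R) : cper u -> 0 < e -> dom (cst (lam u - e)) u.
Proof.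
move=> cu e0; have [c /= cE lt] := sup_adherent e0 (domset_has_sup cu).
by apply: (dominated_trans _ cE); apply: dominated_le => x /=; exact: ltW.
Qed.

Lemma mean_functional_ub u (c : R) : cper u -> dom (cst c) u -> c <= lam u.
Proof. by move=> cu H; apply: ub_le_sup => //; case: (domset_has_sup cu). Qed.

(** Self-improvement of [core_estimate]: u minus a lower constant optimal up to d is, after adding a
    coboundary, a function w >= 0. Its lower constant m cannot exceed d, by the definition of the
    supremum, so its upper constant C m + e / 2 is at most e. *)
Lemma mean_functional_upper u (e : R) : cper u -> 0 < e -> dom u (cst (lam u + e)).
Proof.
move=> cu e0; have [C C0 core] := core_estimate dF irr.
pose d := e / (2 * C); have d0 : 0 < d by rewrite divr_gt0 // mulr_gt0.
have [h ch H] := mean_functional_lower cu d0.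
pose w x := u x - (lam u - d) + (h x - T h x).
have cw : cper w.
  apply: cperD; first by apply: cperB => //; exact: cper_cst.
  by apply: cperB => //; exact: (cper_transfer dF).
have w0 x : 0 <= w x by have := H x; rewrite /w /=; lra.
have e2 : 0 < e / 2 by rewrite divr_gt0.
have [m [m0 [k ck K] [k' ck' K']]] := core w cw w0 _ e2.
have md : m <= d.
  have : m + (lam u - d) <= lam u.
    apply: mean_functional_ub => //; exists (fun x => h x + k x); first exact: cperD.
    by move=> x; have := K x; rewrite /w /transfer mulrDr /=; lra.
  by lra.
have Cd : C * d = e / 2 by rewrite /d; field; rewrite lt0r_neq0.
have Cm : C * m <= C * d by rewrite ler_pM2l.
exists (fun x => k' x - h x); first exact: cperB.
by move=> x; have := K' x; rewrite /w /transfer mulrBr /=; lra.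
Qed.

Lemma mean_functional_le_cst u (c : R) : cper u -> (forall e, 0 < e -> dom u (cst (c + e))) ->
  lam u <= c.
Proof.
move=> cu H; apply/ler_addgt0Pr => e e0; have e2 : 0 < e / 2 by rewrite divr_gt0.
have := dominated_cst dF irr (dominated_trans (mean_functional_lower cu e2) (H _ e2)).
lra.
Qed.

Lemma mean_functional_ge_cst u (c : R) : cper u -> (forall e, 0 < e -> dom (cst (c - e)) u) ->
  c <= lam u.
Proof.
move=> cu H; apply/ler_addgt0Pr => e e0; have e2 : 0 < e / 2 by rewrite divr_gt0.
have := dominated_cst dF irr (dominated_trans (H _ e2) (mean_functional_upper cu e2)).
lra.
Qed.

Lemma mean_functional_dominated u w : cper u -> cper w -> dom u w -> lam u <= lam w.
Proof.
move=> cu cw H; apply: mean_functional_le_cst => // e e0.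
exact: dominated_trans H (mean_functional_upper cw e0).
Qed.

Lemma mean_functional_le u w : cper u -> cper w -> (forall x, u x <= w x) -> lam u <= lam w.
Proof. by move=> cu cw H; apply: mean_functional_dominated => //; exact: dominated_le. Qed.

Lemma mean_functional_cst (c : R) : lam (cst c) = c.
Proof.
have cc := cper_cst c; apply/eqP; rewrite eq_le; apply/andP; split.
  by apply: mean_functional_le_cst => // e e0; apply: dominated_le => x /=; lra.
by apply: mean_functional_ge_cst => // e e0; apply: dominated_le => x /=; lra.
Qed.

Lemma mean_functionalD u w : cper u -> cper w -> lam (fun x => u x + w x) = lam u + lam w.
Proof.
move=> cu cw; have cuw := cperD cu cw; apply/eqP; rewrite eq_le; apply/andP; split.
  apply: mean_functional_le_cst => // e e0; have e2 : 0 < e / 2 by rewrite divr_gt0.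
  apply: (dominated_trans (dominatedD (mean_functional_upper cu e2) (mean_functional_upper cw e2))).
  by apply: dominated_le => x /=; lra.
apply: mean_functional_ge_cst => // e e0; have e2 : 0 < e / 2 by rewrite divr_gt0.
apply: (dominated_trans _ (dominatedD (mean_functional_lower cu e2) (mean_functional_lower cw e2))).
by apply: dominated_le => x /=; lra.
Qed.

Lemma mean_functionalN u : cper u -> lam (fun x => - u x) = - lam u.
Proof.
move=> cu; have cN : cper (fun x => - u x).
  by rewrite (_ : (fun x => - u x) = (fun x => (cst 0 x : R) - u x)); [apply: cperB => //; exact: cper_cst
    |apply/funext => x /=; rewrite sub0r].
have := mean_functionalD cu cN.
rewrite (_ : (fun x => u x + - u x) = cst 0); last by apply/funext => x; rewrite subrr.
by rewrite mean_functional_cst; lra.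
Qed.

Lemma mean_functionalZ (c : R) u : cper u -> lam (fun x => c * u x) = c * lam u.
Proof.
have pos (d : R) v : 0 < d -> cper v -> lam (fun x => d * v x) = d * lam v.
  move=> d0 cv; have cd := cperZ d cv; apply/eqP; rewrite eq_le; apply/andP; split.
    apply: mean_functional_le_cst => // e e0; have e2 : 0 < e / d by rewrite divr_gt0.
    apply: (dominated_trans (dominatedZ (ltW d0) (mean_functional_upper cv e2))).
    by apply: dominated_le => x /=; rewrite mulrDr mulrCA mulfV ?mulr1 // gt_eqF.
  apply: mean_functional_ge_cst => // e e0; have e2 : 0 < e / d by rewrite divr_gt0.
  apply: (dominated_trans _ (dominatedZ (ltW d0) (mean_functional_lower cv e2))).
  by apply: dominated_le => x /=; rewrite mulrBr mulrCA mulfV ?mulr1 // gt_eqF.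
move=> cu; have [c0|c0|->] := ltgtP c 0; last 2 first.
- exact: pos.
- rewrite mul0r (_ : (fun x => 0 * u x) = cst 0) ?mean_functional_cst //.
  by apply/funext => x; rewrite mul0r.
rewrite (_ : (fun x => c * u x) = (fun x => - (- c * u x))).
  rewrite mean_functionalN; last exact: cperZ.
  by rewrite pos ?oppr_gt0 // mulNr opprK.
by apply/funext => x; rewrite mulNr opprK.
Qed.

Lemma mean_functional_transfer u : cper u -> lam (T u) = lam u.
Proof.
move=> cu; have ct := cper_transfer dF cu; apply/eqP; rewrite eq_le; apply/andP; split.
  apply: mean_functional_dominated => //.
  exists (fun x => - u x); last by move=> x; rewrite /transfer mulrN; lra.
  rewrite (_ : (fun x => - u x) = (fun x => -1 * u x)); first exact: cperZ.
  by apply/funext => x; rewrite mulN1r.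
exact: mean_functional_dominated cu ct (dominated_transfer dF 1 cu).
Qed.

Lemma mean_functional_gt0 u : cper u -> (forall x, 0 < u x) -> 0 < lam u.
Proof.
move=> cu u0; have [z zmin] := cper_min cu; apply: (lt_le_trans (u0 z)).
by rewrite -(mean_functional_cst (u z)); apply: mean_functional_le => //; exact: cper_cst.
Qed.

End MeanFunctional.

(** * Distortion of multicritical maps *)

Section PairInequalities.
Context {R : realType}.
Implicit Types (a b c d s t x y : R).

Lemma sinh_ge d r : 1 <= d -> 0 <= r ->
  d * (expR r - expR (- r)) <= expR (d * r) - expR (- (d * r)).
Proof.
move=> d1 r0.
pose f r := expR (d * r) - expR (- (d * r)) - d * (expR r - expR (- r)).
pose df r := d * (expR (d * r) + expR (- (d * r))) - d * (expR r + expR (- r)).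
suff : f 0 <= f r by rewrite /f !(mulr0, oppr0, expR0, subrr); lra.
apply: (@ge0_is_derive_le R f df 0 r r0) => x /andP[x0 _].
  have h1 : is_derive x 1 (fun x => expR (d * x)) (d * expR (d * x)).
    have h := @is_derive1_comp _ expR (fun x => d * x) x (expR (d * x)) d (is_derive_expR _) _.
    rewrite mulrC; apply: h; apply: is_derive_eq; rewrite /GRing.scale /=; ring.
  have h2 : is_derive x 1 (fun x => expR (- (d * x))) (- d * expR (- (d * x))).
    have h := @is_derive1_comp _ expR (fun x => - (d * x)) x (expR (- (d * x))) (- d) (is_derive_expR _) _.
    rewrite mulrC; apply: h; apply: is_derive_eq; rewrite /GRing.scale /=; ring.
  have h3 : is_derive x 1 (fun x => expR (- x)) (- expR (- x)).
    have h := @is_derive1_comp _ expR (fun x => - x) x (expR (- x)) (- 1) (is_derive_expR _) _.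
    by rewrite -mulrN1; apply: h; apply: is_derive_eq.
  by apply: is_derive_eq; rewrite /df /GRing.scale /=; ring.
have d0 : 0 < d by lra.
have xd : x <= d * x by rewrite ler_peMl.
rewrite /df -mulrBr mulr_ge0 ?(ltW d0) //.
set u := d * x in xd *.
have E (v : R) : expR v * expR (- v) = 1 by rewrite -expRD subrr expR0.
have e1 : expR x <= expR u by rewrite ler_expR.
have e2 : 1 <= expR x by rewrite -expR0 ler_expR.
have e3 := E x; have e4 := E u.
have n1 : 0 < expR (- x) by exact: expR_gt0. have n2 : 0 < expR (- u) by exact: expR_gt0.
have n3 : expR (- x) <= 1 by rewrite -expR0 ler_expR; lra.
have n4 : expR (- u) <= 1 by rewrite -expR0 ler_expR; lra.
rewrite (_ : _ - _ = (expR u - expR x) * (1 - expR (- x) * expR (- u))); last first.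
  have h1 : expR u * (expR (- x) * expR (- u)) = expR (- x) by rewrite mulrCA e4 mulr1.
  have h2 : expR x * (expR (- x) * expR (- u)) = expR (- u) by rewrite mulrA e3 mul1r.
  by rewrite mulrBr mulr1 mulrBl h1 h2; lra.
by rewrite mulr_ge0 ?subr_ge0 //; nra.
Qed.

(** With s = e^(m + r) and t = e^(m - r) this is the square of d sinh r <= sinh (d r). Powers with d
    >= 1 have nonpositive Schwarzian derivative, whence no distortion factor. *)
Lemma pow_pair d s t : 1 <= d -> 0 < t -> t <= s ->
  d ^+ 2 * (s `^ (d - 1) * t `^ (d - 1)) * (s - t) ^+ 2 <= (s `^ d - t `^ d) ^+ 2.
Proof.
move=> d1 t0 ts; have s0 : 0 < s by exact: lt_le_trans ts.
rewrite /powR !gt_eqF //.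
set u := ln s; set v := ln t.
have su : s = expR u by rewrite lnK.
have tv : t = expR v by rewrite lnK.
pose r := (u - v) / 2; pose m := (u + v) / 2.
have r0 : 0 <= r by rewrite divr_ge0 // subr_ge0 ler_ln.
have um : u = m + r by rewrite /m /r; lra.
have vm : v = m - r by rewrite /m /r; lra.
have h := sinh_ge d1 r0.
have pos : 0 <= d * (expR r - expR (- r)).
  by rewrite mulr_ge0 ?subr_ge0 ?ler_expR; lra.
rewrite su tv um vm.
have -> : expR (d * (m + r)) - expR (d * (m - r)) = expR (d * m) * (expR (d * r) - expR (- (d * r))).
  by rewrite [RHS]mulrBr -!expRD; congr (expR _ - expR _); ring.
have -> : d ^+ 2 * (expR ((d - 1) * (m + r)) * expR ((d - 1) * (m - r))) *
  (expR (m + r) - expR (m - r)) ^+ 2 = (expR (d * m) * (d * (expR r - expR (- r)))) ^+ 2.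
  have -> : expR (m + r) - expR (m - r) = expR m * (expR r - expR (- r)).
    by rewrite mulrBr -!expRD.
  have -> : expR ((d - 1) * (m + r)) * expR ((d - 1) * (m - r)) = (expR ((d - 1) * m)) ^+ 2.
    by rewrite expr2 -!expRD; congr expR; ring.
  have -> : expR (d * m) = expR ((d - 1) * m) * expR m.
    by rewrite -expRD; congr expR; ring.
  ring.
have A0 : 0 <= expR (d * m) * (d * (expR r - expR (- r))) by rewrite mulr_ge0 ?expR_ge0.
have AB : expR (d * m) * (d * (expR r - expR (- r))) <=
  expR (d * m) * (expR (d * r) - expR (- (d * r))) by rewrite ler_pM2l ?expR_gt0.
by rewrite -subr_ge0 subr_sqr; apply: mulr_ge0; lra.
Qed.

(** For points on opposite sides of the critical point the larger of s and t controls everything, at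
    the price of a constant that the jump of V absorbs. *)
Lemma pow_opposite d s t : 1 <= d -> 0 < s -> 0 < t ->
  s `^ (d - 1) * t `^ (d - 1) * (s + t) ^+ 2 <= 4 * (s `^ d + t `^ d) ^+ 2.
Proof.
move=> d1; wlog ts : s t / t <= s.
  move=> H s0 t0; have [ts|/ltW st] := leP t s; first exact: H.
  by rewrite [_ `^ _ * _]mulrC [s + t]addrC [s `^ d + _]addrC; apply: H.
move=> s0 t0.
have sd : s `^ d = s `^ (d - 1) * s.
  by rewrite -[X in _ * X](powRr1 (ltW s0)) -powRD ?subrK // (lt0r_neq0 s0) implybT.
have p1 : 0 < s `^ (d - 1) by exact: powR_gt0.
have p2 : 0 < t `^ (d - 1) by exact: powR_gt0.
have p3 : 0 < t `^ d by exact: powR_gt0.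
have p12 : t `^ (d - 1) <= s `^ (d - 1).
  by apply: ge0_ler_powR; rewrite ?nnegrE; lra.
set A := s `^ (d - 1) in sd p1 p12 *; set B := t `^ (d - 1) in p2 p12 *.
apply: (@le_trans _ _ (A * A * (4 * s ^+ 2))).
  have h1 : A * B <= A * A by rewrite ler_pM2l.
  have h2 : (s + t) ^+ 2 <= 4 * s ^+ 2 by nra.
  by apply: ler_pM => //; [rewrite mulr_ge0 // ltW|exact: sqr_ge0].
rewrite (_ : A * A * (4 * s ^+ 2) = 4 * (A * s) ^+ 2); last by ring.
rewrite ler_pM2l // -sd -subr_ge0 subr_sqr; apply: mulr_ge0; first by lra.
have : 0 < s `^ d by exact: powR_gt0.
lra.
Qed.

(** The mean slope is some df c >= k, and df a, df b exceed it by at most the factor 1 + (M / k) (b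
    - a); the two factors give the 2 in the exponent. *)
Lemma lipschitz_pair (f df : R -> R) a b (k M : R) : a < b -> 0 < k -> 0 <= M ->
  (forall x, a <= x <= b -> is_derive x 1 f (df x)) ->
  (forall x, a <= x <= b -> k <= df x) ->
  (forall x y, a <= x <= b -> a <= y <= b -> `|df x - df y| <= M * `|x - y|) ->
  df a * df b * (b - a) ^+ 2 <= (f b - f a) ^+ 2 * expR (2 * M / k * (b - a)).
Proof.
move=> ab k0 M0 H1 H2 H3.
have aab : a <= a <= b by rewrite lexx ltW.
have bab : a <= b <= b by rewrite lexx ltW.
have [c cab ->] := is_derive_MVT (ltW ab) H1.
have kc := H2 _ cab; have ka := H2 _ aab; have kb := H2 _ bab.
have c0 : 0 < df c by exact: lt_le_trans kc.
have key x : a <= x <= b -> df x <= df c * expR (M / k * (b - a)).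
  move=> xab; have h := H3 _ _ xab cab.
  have xc : `|x - c| <= b - a.
    by move: xab cab => /andP[? ?] /andP[? ?]; rewrite ler_norml; apply/andP; split; lra.
  have h1 : df x <= df c + M * (b - a).
    move: h; rewrite ler_norml => /andP[_ h].
    have : M * `|x - c| <= M * (b - a) by rewrite ler_wpM2l.
    lra.
  apply: (le_trans h1); apply: (@le_trans _ _ (df c * (1 + M / k * (b - a)))); last first.
    by rewrite ler_pM2l // expR_ge1Dx.
  rewrite [leRHS]mulrDr mulr1 lerD2l.
  rewrite (_ : df c * (M / k * (b - a)) = (df c / k) * (M * (b - a))); last by ring.
  by rewrite ler_peMl ?mulr_ge0 ?subr_ge0 ?(ltW ab) // ler_pdivlMr // mul1r.
have -> : (df c * (b - a)) ^+ 2 * expR (2 * M / k * (b - a)) =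
    (df c * expR (M / k * (b - a))) * (df c * expR (M / k * (b - a))) * (b - a) ^+ 2.
  have -> : expR (2 * M / k * (b - a)) = expR (M / k * (b - a)) * expR (M / k * (b - a)).
    by rewrite -expRD; congr expR; ring.
  ring.
rewrite ler_wpM2r ?sqr_ge0 //; apply: ler_pM; rewrite ?key //.
- exact: ltW (lt_le_trans k0 ka).
- exact: ltW (lt_le_trans k0 kb).
Qed.

End PairInequalities.

Section PowerLaw.
Context {R : realType} (F psi dpsi : R -> R) (c d r k K M : R).
Hypotheses (d1 : 1 <= d) (k0 : 0 < k) (M0 : 0 <= M) (psic : psi c = 0)
  (dF : forall x : R, derivable F x 1) (dFc : derive1 F c = 0)
  (dpsiE : forall x, `|x - c| < r -> is_derive x 1 psi (dpsi x))
  (dpsi_lo : forall x, `|x - c| < r -> k <= dpsi x)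
  (dpsi_hi : forall x, `|x - c| < r -> dpsi x <= K)
  (dpsi_lip : forall x y, `|x - c| < r -> `|y - c| < r -> `|dpsi x - dpsi y| <= M * `|x - y|)
  (FE : forall x, `|x - c| < r -> F x = F c + psi x * `|psi x| `^ (d - 1)).
Implicit Types (a b s t x y : R).

Let ball_itv a b x : `|a - c| < r -> `|b - c| < r -> a <= x <= b -> `|x - c| < r.
Proof.
by rewrite !ltr_norml => /andP[? ?] /andP[? ?] /andP[? ?]; apply/andP; split; lra.
Qed.

Lemma power_psi_incr a b : `|a - c| < r -> `|b - c| < r -> a <= b -> k * (b - a) <= psi b - psi a.
Proof.
move=> ac bc ab.
have [x xab ->] := is_derive_MVT ab (fun x h => dpsiE (ball_itv ac bc h)).
by rewrite ler_wpM2r ?subr_ge0 // dpsi_lo // (ball_itv ac bc xab).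
Qed.

Let cc : 0 < r -> `|c - c| < r. Proof. by rewrite subrr normr0. Qed.
Let r_gt0 x : `|x - c| < r -> 0 < r. Proof. exact: le_lt_trans. Qed.

Lemma power_psi_pos x : `|x - c| < r -> c < x -> 0 < psi x.
Proof.
move=> xc cx; have := power_psi_incr (cc (r_gt0 xc)) xc (ltW cx).
rewrite psic subr0; apply: lt_le_trans; rewrite mulr_gt0 // subr_gt0 //.
Qed.

Lemma power_psi_neg x : `|x - c| < r -> x < c -> psi x < 0.
Proof.
move=> xc cx; have := power_psi_incr xc (cc (r_gt0 xc)) (ltW cx).
rewrite psic sub0r => h; rewrite -oppr_gt0; apply: lt_le_trans h.
by rewrite mulr_gt0 // subr_gt0.
Qed.

Let powE y : 0 < y -> y * y `^ (d - 1) = y `^ d.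
Proof.
move=> y0; rewrite -[X in X * _](powRr1 (ltW y0)) -powRD ?(lt0r_neq0 y0) ?implybT //.
by congr (_ `^ _); lra.
Qed.

Lemma power_right x : `|x - c| < r -> c < x -> F x = F c + psi x `^ d.
Proof.
by move=> xc cx; rewrite FE // gtr0_norm ?powE //; exact: power_psi_pos.
Qed.

Lemma power_left x : `|x - c| < r -> x < c -> F x = F c - (- psi x) `^ d.
Proof.
move=> xc cx; have h := power_psi_neg xc cx.
by rewrite FE // ltr0_norm // -powE ?oppr_gt0 // mulNr opprK.
Qed.

Let near_ball x : `|x - c| < r -> \forall y \near x, `|y - c| < r.
Proof.
move=> xc; have e0 : 0 < r - `|x - c| by rewrite subr_gt0.
near=> y; have h : `|x - y| < r - `|x - c| by near: y; exact: nbhsx_ballx.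
rewrite (_ : y - c = - (x - y) + (x - c)); last by lra.
by apply: (le_lt_trans (ler_normD _ _)); rewrite normrN; lra.
Unshelve. all: by end_near. Qed.

Lemma power_derive_right x : `|x - c| < r -> c < x ->
  derive1 F x = d * psi x `^ (d - 1) * dpsi x.
Proof.
move=> xc cx; have p0 := power_psi_pos xc cx.
have h : is_derive x 1 (fun y => F c + psi y `^ d) (d * psi x `^ (d - 1) * dpsi x).
  have h1 := @is_derive1_comp _ (fun y => y `^ d) psi x _ _ (is_derive1_powR d p0) (dpsiE xc).
  have h2 := @is_deriveD _ _ _ (cst (F c)) _ x 1 _ _ (is_derive_cst _ _ _) h1.
  by apply: (is_derive_eq h2); rewrite add0r.
have : is_derive x 1 F (d * psi x `^ (d - 1) * dpsi x).
  apply: near_eq_is_derive h; near=> y; rewrite [F y]power_right //.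
    by near: y; exact: (near_ball xc).
  by near: y; exact: lt_nbhsr.
by move=> h'; rewrite derive1E; exact: (@derive_val _ _ _ _ _ _ _ h').
Unshelve. all: by end_near. Qed.

Lemma power_derive_left x : `|x - c| < r -> x < c ->
  derive1 F x = d * (- psi x) `^ (d - 1) * dpsi x.
Proof.
move=> xc cx; have p0 := power_psi_neg xc cx.
have p1 : 0 < - psi x by rewrite oppr_gt0.
have h : is_derive x 1 (fun y => F c - (- psi y) `^ d) (d * (- psi x) `^ (d - 1) * dpsi x).
  have dn : is_derive x 1 (fun y => - psi y) (- dpsi x).
    by have h0 := dpsiE xc; apply: is_derive_eq.
  have h1 := @is_derive1_comp _ (fun y => y `^ d) (fun y => - psi y) x _ _ (is_derive1_powR d p1) dn.
  have h2 := @is_deriveB _ _ _ (cst (F c)) _ x 1 _ _ (is_derive_cst _ _ _) h1.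
  by apply: (is_derive_eq h2); rewrite sub0r mulrN opprK.
have : is_derive x 1 F (d * (- psi x) `^ (d - 1) * dpsi x).
  apply: near_eq_is_derive h; near=> y; rewrite [F y]power_left //.
    by near: y; exact: (near_ball xc).
  by near: y; exact: lt_nbhsl.
by move=> h'; rewrite derive1E; exact: (@derive_val _ _ _ _ _ _ _ h').
Unshelve. all: by end_near. Qed.

Let psi_pair a b : `|a - c| < r -> `|b - c| < r -> a < b ->
  dpsi a * dpsi b * (b - a) ^+ 2 <= (psi b - psi a) ^+ 2 * expR (2 * M / k * (b - a)).
Proof.
move=> ac bc ab; apply: (@lipschitz_pair _ psi dpsi a b k M) => //.
- by move=> x /(ball_itv ac bc); exact: dpsiE.
- by move=> x /(ball_itv ac bc); exact: dpsi_lo.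
- by move=> x y /(ball_itv ac bc) xc /(ball_itv ac bc); exact: dpsi_lip.
Qed.

(** On one side of c the power contributes no distortion ([pow_pair]) and psi only a Lipschitz one.
    Across c the left side is at most D times the squared increment, and the jump L >= D pays for
    this. At c itself the left side vanishes. *)
Lemma power_law_pair : exists2 L, 0 < L & forall a b, `|a - c| < r -> `|b - c| < r -> a < b ->
  derive1 F a * derive1 F b * (b - a) ^+ 2 <=
  (F b - F a) ^+ 2 * expR (L * (b - a) + (if a < c < b then L else 0)).
Proof.
pose D := d ^+ 2 * (K / k) ^+ 2 * 4.
pose L := 2 * M / k + D + 1.
have D0 : 0 <= D by rewrite /D; do ![exact: sqr_ge0|exact: ler0n|apply: mulr_ge0].
have Mk : 0 <= 2 * M / k by rewrite divr_ge0 ?mulr_ge0 // ltW.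
have L0 : 0 < L by rewrite /L; lra.
exists L => // a b ac bc ab.
have Lm : expR (2 * M / k * (b - a)) <= expR (L * (b - a)).
  by rewrite ler_expR ler_wpM2r ?subr_ge0 ?(ltW ab) // /L; lra.
have pp := psi_pair ac bc ab.
have kba : 0 <= k * (b - a) by apply: mulr_ge0; rewrite ?subr_ge0 ltW.
have D1 := @pow_pair R d.
have final (A B E : R) : 0 <= A -> A * (psi b - psi a) ^+ 2 <= B -> 
    A * (dpsi a * dpsi b * (b - a) ^+ 2) <= B * expR (L * (b - a)).
  move=> A0 AB.
  apply: (@le_trans _ _ (A * ((psi b - psi a) ^+ 2 * expR (2 * M / k * (b - a))))).
    by rewrite ler_wpM2l.
  rewrite mulrA; apply: ler_pM => //; rewrite ?expR_ge0 //.
  by rewrite mulr_ge0 ?sqr_ge0.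
have [ac0|ca|ac0'] := ltgtP a c; last first.
- by rewrite ac0' dFc !mul0r mulr_ge0 ?sqr_ge0 ?expR_ge0.
- have cb : c < b by exact: lt_trans ab.
  rewrite addr0 (power_derive_right ac ca) (power_derive_right bc cb) (power_right ac ca) (power_right bc cb).
  have pa := power_psi_pos ac ca; have pb := power_psi_pos bc cb.
  have pab : psi a <= psi b.
    by have := power_psi_incr ac bc (ltW ab); lra.
  have := D1 _ _ d1 pa pab => h.
  rewrite (_ : F c + psi b `^ d - (F c + psi a `^ d) = psi b `^ d - psi a `^ d); last by lra.
  rewrite [leLHS](_ : _ = (d ^+ 2 * (psi b `^ (d - 1) * psi a `^ (d - 1))) *
    (dpsi a * dpsi b * (b - a) ^+ 2)); last by ring.
  by apply: final => //; rewrite mulr_ge0 ?sqr_ge0 // mulr_ge0 ?powR_ge0.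
have na := power_psi_neg ac ac0.
have [bc0|cb|bc0] := ltgtP b c.
- rewrite addr0 (power_derive_left ac ac0) (power_derive_left bc bc0) (power_left ac ac0) (power_left bc bc0).
  have nb := power_psi_neg bc bc0.
  have pab : - psi b <= - psi a.
    by have := power_psi_incr ac bc (ltW ab); lra.
  have nb' : 0 < - psi b by rewrite oppr_gt0.
  have := D1 _ _ d1 nb' pab => h.
  rewrite (_ : F c - (- psi b) `^ d - (F c - (- psi a) `^ d) = (- psi a) `^ d - (- psi b) `^ d); last by lra.
  rewrite [leLHS](_ : _ = (d ^+ 2 * ((- psi a) `^ (d - 1) * (- psi b) `^ (d - 1))) *
    (dpsi a * dpsi b * (b - a) ^+ 2)); last by ring.
  apply: final => //; first by rewrite mulr_ge0 ?sqr_ge0 // mulr_ge0 ?powR_ge0.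
  by rewrite (_ : psi b - psi a = - psi a - - psi b) //; lra.
- have pb := power_psi_pos bc cb.
  rewrite (power_derive_left ac ac0) (power_derive_right bc cb) (power_left ac ac0) (power_right bc cb).
  have na' : 0 < - psi a by rewrite oppr_gt0.
  have h := pow_opposite d1 pb na'.
  rewrite (_ : F c + psi b `^ d - (F c - (- psi a) `^ d) = psi b `^ d + (- psi a) `^ d); last by lra.
  set A := psi b `^ (d - 1) * (- psi a) `^ (d - 1) in h.
  have A0 : 0 <= A by rewrite mulr_ge0 ?powR_ge0.
  rewrite [leLHS](_ : _ = d ^+ 2 * A * (dpsi a * dpsi b * (b - a) ^+ 2)); last by rewrite /A; ring.
  have hab := power_psi_incr ac bc (ltW ab).
  have ba : 0 <= b - a by rewrite subr_ge0 ltW.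
  have s1 : dpsi a * dpsi b * (b - a) ^+ 2 <= (K / k) ^+ 2 * (psi b - psi a) ^+ 2.
    have e1 : dpsi a * dpsi b <= K ^+ 2.
      rewrite expr2; apply: ler_pM; rewrite ?dpsi_hi //.
      - exact: le_trans (ltW k0) (dpsi_lo ac).
      - exact: le_trans (ltW k0) (dpsi_lo bc).
    have e2 : (b - a) ^+ 2 <= (psi b - psi a) ^+ 2 / k ^+ 2.
      rewrite ler_pdivlMr ?exprn_gt0 // -exprMn mulrC -subr_ge0 subr_sqr.
      by apply: mulr_ge0; [lra|have : 0 <= k * (b - a) by rewrite mulr_ge0 // ltW]; lra.
    have da : 0 <= dpsi a by exact: le_trans (ltW k0) (dpsi_lo ac).
    have db : 0 <= dpsi b by exact: le_trans (ltW k0) (dpsi_lo bc).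
    rewrite expr_div_n [leRHS]mulrAC -[leRHS]mulrA.
    by apply: ler_pM => //; [exact: mulr_ge0|exact: sqr_ge0].
  apply: (@le_trans _ _ (d ^+ 2 * A * ((K / k) ^+ 2 * (psi b - psi a) ^+ 2))).
    by apply: ler_wpM2l => //; apply: mulr_ge0 => //; exact: sqr_ge0.
  apply: (@le_trans _ _ (D * (psi b `^ d + (- psi a) `^ d) ^+ 2)).
    rewrite /D (_ : d ^+ 2 * A * _ = (d ^+ 2 * (K / k) ^+ 2) * (A * (psi b + - psi a) ^+ 2)); last by ring.
    rewrite -[leRHS]mulrA; apply: ler_wpM2l => //; apply: mulr_ge0; exact: sqr_ge0.
  rewrite mulrC ler_wpM2l ?sqr_ge0 //.
  apply: (@le_trans _ _ (1 + (L * (b - a) + L))); last exact: expR_ge1Dx.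
  have : 0 <= L * (b - a) by rewrite mulr_ge0 // ltW.
  by rewrite /L; lra.
- by rewrite bc0 dFc mulr0 mul0r mulr_ge0 ?sqr_ge0 ?expR_ge0.
Qed.

End PowerLaw.

Section MulticriticalDistorted.
Context {R : realType} (F : R -> R).
Hypotheses (hF : circle_homeo F) (C3F : C3_on setT F).
Implicit Types (a b c x y : R).

Let dF0 x : derivable F x 1. Proof. by have [H _] := C3F; exact: (H 0%N x). Qed.
Let dF1 x : derivable (derive1 F) x 1. Proof. by have [H _] := C3F; exact: (H 1%N x). Qed.
Let dF2 x : derivable (derive1 (derive1 F)) x 1. Proof. by have [H _] := C3F; exact: (H 2%N x). Qed.

Lemma derivable_continuous (f : R -> R) x : derivable f x 1 -> {for x, continuous f}.
Proof. by move=> df; apply: differentiable_continuous; apply/derivable1_diffP. Qed.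

Lemma derive1_ge0 x : 0 <= derive1 F x.
Proof.
apply: (@incr_derive1_ge0 _ F setT).
- by move=> y _; exact: dF0.
- by move=> u v _ _ uv; rewrite (homeo_lt hF).
- by rewrite interiorT.
Qed.

Let F'1 x : derive1 F (x + 1) = derive1 F x.
Proof. by apply: (@periodic_derive1 _ F 1); case: hF. Qed.

Lemma C3_cper_derive1 : cper (derive1 F).
Proof. by split=> x; [exact: derivable_continuous|exact: F'1]. Qed.

Lemma C3_cper_derive2 : cper (derive1 (derive1 F)).
Proof.
split => x; first exact: derivable_continuous.
by apply: (@periodic_derive1 _ _ 0) => y; rewrite addr0.
Qed.

Let is_d (f : R -> R) x : derivable f x 1 -> is_derive x 1 f (derive1 f x).
Proof. by move=> df; rewrite derive1E; exact: derivableP. Qed.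

Lemma is_derive_lipschitz (f df : R -> R) (M : R) a b :
  (forall x, Num.min a b <= x <= Num.max a b -> is_derive x 1 f (df x)) ->
  (forall x, Num.min a b <= x <= Num.max a b -> `|df x| <= M) -> `|f a - f b| <= M * `|a - b|.
Proof.
wlog ab : a b / a <= b.
  move=> H; have /orP[ab|ba] := le_total a b; first exact: H.
  by move=> H1 H2; rewrite distrC [X in _ * X]distrC; apply: H => // x; rewrite minC maxC;
    [exact: H1|exact: H2].
rewrite (min_idPl ab) (max_idPr ab) => H1 H2.
have [c cab E] := is_derive_MVT ab H1.
by rewrite distrC E [`|a - b|]distrC normrM ler_wpM2r // H2.
Qed.

Lemma C3_derive1_lipschitz : exists2 M, 0 < M &
  forall x y, `|derive1 F x - derive1 F y| <= M * `|x - y|.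
Proof.
have [M M0 HM] := cper_bounded C3_cper_derive2.
exists M => // x y; apply: (@is_derive_lipschitz _ (derive1 (derive1 F))).
  by move=> z _; exact: is_d.
by move=> z _; exact: HM.
Qed.

Lemma regular_local c : 0 < derive1 F c -> exists r L : R, [/\ 0 < r, 0 < L &
  forall a b, `|a - c| < r -> `|b - c| < r -> a < b ->
  derive1 F a * derive1 F b * (b - a) ^+ 2 <= (F b - F a) ^+ 2 * expR (L * (b - a))].
Proof.
move=> c0; have [M M0 HM] := C3_derive1_lipschitz.
pose k := derive1 F c / 2; have k0 : 0 < k by rewrite divr_gt0.
exists (k / M), (2 * M / k); split; rewrite ?divr_gt0 ?mulr_gt0 //.
move=> a b ac bc ab; apply: (@lipschitz_pair _ F (derive1 F) a b k M) => //; first exact: ltW.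
  by move=> x _; exact: is_d.
move=> x /andP[ax xb].
have xc : `|x - c| < k / M.
  by move: ac bc; rewrite !ltr_norml => /andP[? ?] /andP[? ?]; apply/andP; split; lra.
have := HM x c; rewrite ltr_pdivlMr // in xc.
by rewrite ler_norml => /andP[h _]; rewrite /k in xc *; lra.
Qed.

(** The order is a priori any real number. If d < 1, then |psi|^(d - 1) >= 1 near c, so F would have
    mean slope at least k to the right of c, whereas F' is continuous and vanishes at c. *)
Lemma power_exponent_ge1 (psi dpsi : R -> R) c (d r k : R) : 0 < k -> 0 < r ->
  psi c = 0 -> {for c, continuous psi} -> derive1 F c = 0 ->
  (forall x, `|x - c| < r -> is_derive x 1 psi (dpsi x)) ->
  (forall x, `|x - c| < r -> k <= dpsi x) ->
  (forall x, `|x - c| < r -> F x = F c + psi x * `|psi x| `^ (d - 1)) -> 1 <= d.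
Proof.
move=> k0 r0 psic pc Fc dpsiE lo FE; rewrite leNgt; apply/negP => d1.
have Fc' : {for c, continuous (derive1 F)} by exact: derivable_continuous.
have [s s0 Hs] := (eps_continuousP _ _).1 Fc' _ k0.
have [s' s'0 Hs'] := (eps_continuousP _ _).1 pc _ (@ltr01 R).
pose t := Num.min (r / 2) (Num.min (s / 2) (s' / 2)).
have t0 : 0 < t by rewrite !lt_min !divr_gt0.
have tr : t <= r / 2 by rewrite ge_min lexx.
have ts : t <= s / 2 by rewrite !ge_min lexx orbT.
have ts' : t <= s' / 2 by rewrite !ge_min lexx !orbT.
have tE : c + t - c = t by rewrite addrC addKr.
have tc : `|c + t - c| < r by rewrite tE gtr0_norm //; lra.
have cr : `|c - c| < r by rewrite subrr normr0.
have ct : c <= c + t by rewrite lerDl ltW.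
have [x /andP[x1 x2] E] := is_derive_MVT ct (fun x _ => is_d (@dF0 x)).
have xs : `|c - x| < s by rewrite ltr_norml; apply/andP; split; lra.
have := Hs _ xs; rewrite Fc sub0r normrN ltr_norml => /andP[_ fx].
have := @power_psi_incr R psi dpsi c r k dpsiE lo c (c + t) cr tc ct.
rewrite psic subr0 tE => p1.
have p0 : 0 < psi (c + t) by apply: lt_le_trans p1; rewrite mulr_gt0.
have p2 : psi (c + t) < 1.
  have cs : `|c - (c + t)| < s' by rewrite distrC tE gtr0_norm //; lra.
  by have := Hs' _ cs; rewrite psic sub0r normrN => /(le_lt_trans (ler_norm _)).
have pw : 1 <= psi (c + t) `^ (d - 1).
  rewrite /powR gt_eqF // -[X in X <= _]expR0 ler_expR; apply: mulr_le0; first by rewrite subr_le0 ltW.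
  by apply: ln_le0; exact: ltW.
have : k * t <= F (c + t) - F c.
  rewrite FE // (gtr0_norm p0) [F c + _]addrC addrK.
  by apply: (le_trans p1); rewrite ler_peMr // ltW.
by rewrite E tE ler_pM2r // leNgt fx.
Qed.

(** Differentiating chi (psi x) = x shows that psi' is nonzero at c, and the monotonicity of F makes
    it positive; the bounds required by [power_law_pair] then hold on a small ball. *)
Lemma power_law_local c : derive1 F c = 0 -> power_law_at F c -> exists r L : R, [/\ 0 < r, 0 < L &
  forall a b, `|a - c| < r -> `|b - c| < r -> a < b ->
  derive1 F a * derive1 F b * (b - a) ^+ 2 <=
  (F b - F a) ^+ 2 * expR (L * (b - a) + (if a < c < b then L else 0))].
Proof.
move=> Fc [d [psi [U [oU Uc [[dpsi psiC] oV [chi [[dchi _] chiK]]] FE]]]].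
have psic : psi c = 0.
  have /eqP := FE c Uc; rewrite -subr_eq0 opprD addrA subrr sub0r oppr_eq0 mulf_eq0.
  by move=> /orP[/eqP //|/eqP /powR_eq0_eq0/eqP]; rewrite normr_eq0 => /eqP.
have d0 x : U x -> derivable psi x 1 by move=> Ux; exact: (dpsi 0%N x).
have d1 x : U x -> derivable (derive1 psi) x 1 by move=> Ux; exact: (dpsi 1%N x).
have d2 x : U x -> derivable (derive1 (derive1 psi)) x 1 by move=> Ux; exact: (dpsi 2%N x).
have nz : derive1 psi c != 0.
  have dc : derivable chi (psi c) 1 by apply: (dchi 0%N) => //; exists c.
  have h := @is_derive1_comp _ chi psi c _ _ (is_d dc) (is_d (d0 _ Uc)).
  have h' : is_derive c 1 (chi \o psi) 1.
    apply: (@near_eq_is_derive _ _ _ id) => //.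
    by near=> y; rewrite /= chiK //; near: y; exact: open_nbhs_nbhs.
  have e1 := @derive_val _ _ _ _ _ _ _ h; have e2 := @derive_val _ _ _ _ _ _ _ h'.
  apply/eqP => E; move: e1; rewrite e2 E mulr0 => /eqP.
  by rewrite oner_eq0.
have [rU rU0 HU] : exists2 r, 0 < r & forall x, `|x - c| < r -> U x.
  have /nbhs_ballP[r r0 H] := open_nbhs_nbhs (conj oU Uc).
  by exists r => // x xc; apply: H; rewrite -ball_normE /= distrC.
pose m := `|derive1 psi c|; have m0 : 0 < m by rewrite normr_gt0.
have m2 : 0 < m / 2 by rewrite divr_gt0.
have [r1 r10 H1] := (eps_continuousP _ _).1 (derivable_continuous (d1 _ Uc)) _ m2.
have [r2 r20 H2] := (eps_continuousP _ _).1 (derivable_continuous (d2 _ Uc)) _ (@ltr01 R).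
pose r := Num.min rU (Num.min r1 r2).
have r0 : 0 < r by rewrite !lt_min rU0 r10.
have rrU : r <= rU by rewrite ge_min lexx.
have rr1 : r <= r1 by rewrite !ge_min lexx orbT.
have rr2 : r <= r2 by rewrite !ge_min lexx !orbT.
have inU x : `|x - c| < r -> U x by move=> xc; apply: HU; exact: lt_le_trans rrU.
have b1 x : `|x - c| < r -> `|derive1 psi c - derive1 psi x| < m / 2.
  by move=> xc; apply: H1; rewrite distrC; exact: lt_le_trans rr1.
pose M := `|derive1 (derive1 psi) c| + 1.
have b2 x : `|x - c| < r -> `|derive1 (derive1 psi) x| <= M.
  move=> xc; have h : `|c - x| < r2 by rewrite distrC; exact: lt_le_trans rr2.
  have := H2 _ h; set u := derive1 (derive1 psi) c; set v := derive1 _ x => uv.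
  rewrite (_ : v = u - (u - v)); last by lra.
  by apply: (le_trans (ler_normB _ _)); rewrite /M -/u lerD2l ltW.
have ball_itv a b x : `|a - c| < r -> `|b - c| < r -> a <= x <= b -> `|x - c| < r.
  by rewrite !ltr_norml => /andP[? ?] /andP[? ?] /andP[? ?]; apply/andP; split; lra.
have cr : `|c - c| < r by rewrite subrr normr0.
have r2' : `|c + r / 2 - c| < r by rewrite addrC addKr ger0_norm; lra.
have cr2 : c <= c + r / 2 by lra.
have psi_pos : 0 < derive1 psi c.
  rewrite lt_neqAle eq_sym nz /= leNgt; apply/negP => neg.
  have [x xc E] := is_derive_MVT cr2 (fun x h => is_d (d0 _ (inU _ (ball_itv _ _ _ cr r2' h)))).
  have xcr := ball_itv _ _ _ cr r2' xc.
  have mN : m = - derive1 psi c by rewrite /m ltr0_norm.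
  have := b1 _ xcr; rewrite ltr_norml => /andP[h _].
  have : psi (c + r / 2) < 0.
    rewrite psic subr0 in E; rewrite E nmulr_rlt0; lra.
  move=> ps; have : F c < F (c + r / 2) by rewrite (homeo_lt hF); lra.
  rewrite [F (c + _)]FE; last exact: inU.
  apply/negP; rewrite -leNgt gerDl.
  by rewrite nmulr_rle0 // powR_ge0.
have mE : m = derive1 psi c by rewrite /m gtr0_norm.
have lo x : `|x - c| < r -> m / 2 <= derive1 psi x.
  by move=> /b1; rewrite -mE ltr_norml => /andP[]; lra.
have hi x : `|x - c| < r -> derive1 psi x <= 2 * m.
  by move=> /b1; rewrite -mE ltr_norml => /andP[]; lra.
have M0 : 0 <= M by rewrite addr_ge0.
have dpsiE x : `|x - c| < r -> is_derive x 1 psi (derive1 psi x).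
  by move=> /inU Ux; exact: is_d (d0 _ Ux).
have FE' x : `|x - c| < r -> F x = F c + psi x * `|psi x| `^ (d - 1).
  by move=> /inU; exact: FE.
have incr a b := @power_psi_incr R psi (derive1 psi) c r (m / 2) dpsiE lo a b.
have dge1 : 1 <= d.
  apply: (@power_exponent_ge1 psi (derive1 psi) c d r (m / 2)) => //.
  exact: derivable_continuous (d0 _ Uc).
have lip x y : `|x - c| < r -> `|y - c| < r ->
    `|derive1 psi x - derive1 psi y| <= M * `|x - y|.
  move=> xc yc.
  have mm z : Num.min x y <= z <= Num.max x y -> `|z - c| < r.
    by have [xy|yx] := leP x y; [exact: ball_itv xc yc|exact: ball_itv yc xc].
  apply: (@is_derive_lipschitz _ (derive1 (derive1 psi))).
    by move=> z /mm/inU Uz; exact: is_d (d1 _ Uz).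
  by move=> z /mm; exact: b2.
have [L L0 HL] := power_law_pair dge1 m2 M0 psic Fc dpsiE lo hi lip FE'.
by exists r, L.
Unshelve. all: by end_near. Qed.

End MulticriticalDistorted.

(** * From the local inequalities to the whole circle *)

Section Gluing.
Context {R : realType} (F : R -> R).
Hypothesis (mF : multicritical F).
Implicit Types (a b c x y : R).
Let hF : circle_homeo F. Proof. by case: mF. Qed.
Let C3F : C3_on setT F. Proof. by case: mF. Qed.
Let dF0 x : derivable F x 1. Proof. by have [H _] := C3F; exact: (H 0%N x). Qed.

(** The increment from a to b is the number of translates c + j in ]a, b], c running over s and j
    over the integers. *)
Definition crit_count (s : seq R) x : R := \sum_(c <- s) (Num.floor (x - c))%:~R.

Lemma crit_count_homo s : {homo crit_count s : x y / x <= y}.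
Proof. by move=> x y xy; apply: ler_sum => c _; rewrite ler_int le_floor // lerB. Qed.

Lemma crit_count_period s x : crit_count s (x + 1) = crit_count s x + (size s)%:R.
Proof.
elim: s => [|c s IH]; first by rewrite /crit_count !big_nil addr0.
rewrite /crit_count !big_cons -/(crit_count s (x + 1)) IH -/(crit_count s x) /=.
rewrite addrAC -[X in Num.floor (_ + X)]/(1%:~R) floorDrz ?intr_int // intrKfloor intrD -natr1.
by rewrite -[1%:~R]/(1 : R); lra.
Qed.

Lemma crit_count_jump s a b c (j : int) : c \in s -> a < c + j%:~R <= b ->
  crit_count s a + 1 <= crit_count s b.
Proof.
move=> cs /andP[h1 h2]; rewrite /crit_count !(big_rem c cs) /=.
have ab : a <= b by apply: le_trans h2; exact: ltW.
have g1 : j%:~R <= (Num.floor (b - c))%:~R :> R.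
  by rewrite ler_int floor_ge_int_tmp lerBrDl.
have g2 : (Num.floor (a - c))%:~R + 1 <= j%:~R :> R.
  by rewrite -[X in _ + X]/(1%:~R) -intrD ler_int lezD1 floor_lt_int ltrBlDl.
have g3 : \sum_(d <- rem c s) (Num.floor (a - d))%:~R <= \sum_(d <- rem c s) (Num.floor (b - d))%:~R :> R.
  exact: crit_count_homo.
lra.
Qed.

Lemma critical_seq : exists s : seq R, forall c, critical_points F c ->
  exists2 d, d \in s & exists j : int, c = d + j%:~R.
Proof.
have [_ _ /finite_seqP[s sE] _] := mF; exists s => c Fc.
have [j [r [E r0 r1]]] := floor_dec c; exists r; last by exists j.
have : (critical_points F `&` `[0, 1[%classic) r.
  split; last by rewrite /= in_itv /= r0.
  move: Fc; rewrite /critical_points /= E => H; apply: contra_not H.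
  have := cper_int r j (C3_cper_derive1 hF C3F) => ->; exact.
by rewrite sE.
Qed.

Lemma local_pair (s : seq R) (hs : forall c, critical_points F c ->
    exists2 d, d \in s & exists j : int, c = d + j%:~R) x : exists r L : R, [/\ 0 < r, 0 < L &
  forall a b, `|a - x| < r -> `|b - x| < r -> a < b ->
  derive1 F a * derive1 F b * (b - a) ^+ 2 <=
  (F b - F a) ^+ 2 * expR (L * ((b - a) + (crit_count s b - crit_count s a)))].
Proof.
have [x0|x0] := ltP 0 (derive1 F x).
  have [r [L [r0 L0 H]]] := regular_local hF C3F x0.
  exists r, L; split=> // a b ax bx ab; apply: (le_trans (H a b ax bx ab)).
  rewrite ler_wpM2l ?sqr_ge0 // ler_expR ler_pM2l // lerDl subr_ge0.
  by apply: crit_count_homo; exact: ltW.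
have Fx : derive1 F x = 0 by apply/eqP; rewrite eq_le x0 (derive1_ge0 hF C3F).
have Cx : critical_points F x by rewrite /critical_points /= Fx ltxx.
have [_ _ _ pl] := mF.
have [r [L [r0 L0 H]]] := power_law_local hF C3F Fx (pl _ Cx).
exists r, L; split=> // a b ax bx ab; apply: (le_trans (H a b ax bx ab)).
rewrite ler_wpM2l ?sqr_ge0 // ler_expR [leRHS]mulrDr lerD2l.
case: ifPn => [/andP[h1 h2]|_]; last first.
  apply: mulr_ge0; first exact: ltW.
  by rewrite subr_ge0; apply: crit_count_homo; exact: ltW.
have [d ds [j E]] := hs _ Cx.
rewrite ler_peMr ?(ltW L0) //.
have := @crit_count_jump s a b d j ds; rewrite -E h1 (ltW h2) => /(_ isT); lra.
Qed.

(** K serves as distortion constant and 1 / K as admissible length, so that one compactness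
    argument, with the filter K -> +oo, provides both. *)
Lemma short_pair (s : seq R) (hs : forall c, critical_points F c ->
    exists2 d, d \in s & exists j : int, c = d + j%:~R) : exists2 K : R, 0 < K &
  forall a b, a < b -> b < a + K^-1 -> derive1 F a * derive1 F b * (b - a) ^+ 2 <=
  (F b - F a) ^+ 2 * expR (K * ((b - a) + (crit_count s b - crit_count s a))).
Proof.
pose P (K x : R) := forall b, x < b -> b < x + K^-1 ->
  derive1 F x * derive1 F b * (b - x) ^+ 2 <=
  (F b - F x) ^+ 2 * expR (K * ((b - x) + (crit_count s b - crit_count s x))).
have cov : \forall K \near +oo, `[0, 1]%classic `<=` P K.
  have /compact_near_coveringP/(_ _ (pinfty_nbhs R) P _) := @segment_compact R 0 1.
  apply => x _; have [r [L [r0 L0 H]]] := local_pair hs x.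
  near=> x' K => b xb bK.
  have r2 : 0 < r / 2 by rewrite divr_gt0.
  have h1 : `|x - x'| < r / 2 by near: x'; apply: (@nbhsx_ballx _ _ x (r / 2)); exact: divr_gt0.
  have KL : L <= K by near: K; apply: nbhs_pinfty_ge; exact: num_real.
  have Kr : 2 / r < K by near: K; apply: nbhs_pinfty_gt; exact: num_real.
  have K0 : 0 < K by apply: lt_trans Kr; rewrite divr_gt0.
  have Kr' : K^-1 < r / 2.
    by rewrite -[ltRHS]invrK ltf_pV2 ?posrE ?invr_gt0 // invf_div.
  rewrite /= in bK xb *.
  have ax : `|x' - x| < r by rewrite distrC; lra.
  have bx : `|b - x| < r.
    by move: h1; rewrite !ltr_norml => /andP[? ?]; apply/andP; split; lra.
  apply: (le_trans (H _ _ ax bx xb)); rewrite ler_wpM2l ?sqr_ge0 // ler_expR ler_wpM2r //.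
  by apply: addr_ge0; rewrite subr_ge0; [exact: ltW|apply: crit_count_homo; exact: ltW].
near (pinfty_nbhs R) => K.
have K0 : 0 < K by near: K; apply: nbhs_pinfty_gt; exact: num_real.
have KP : `[0, 1]%classic `<=` P K by near: K.
exists K => // a b ab bK.
have [j [r [E r0 r1]]] := floor_dec a.
have cnt x : crit_count s (x + j%:~R) = crit_count s x + j%:~R * (size s)%:R.
  have Vn (n : nat) z : crit_count s (z + n%:R) = crit_count s z + n%:R * (size s)%:R.
    elim: n z => [|n IH] z; first by rewrite addr0 mul0r addr0.
    by rewrite -natr1 !addrA crit_count_period IH; ring.
  case: j {E} => n; first exact: Vn.
  rewrite NegzE mulrNz; apply: (addIr (n.+1%:R * (size s)%:R)).
  by rewrite -[LHS]Vn subrK -[n.+1%:~R]/(n.+1%:R : R); ring.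
have cp := C3_cper_derive1 hF C3F.
have r01 : `[0, 1]%classic r by rewrite /= in_itv /= r0 ltW.
have := KP r r01 (b - j%:~R); rewrite /P E => /(_ (ltac:(lra)) (ltac:(lra))).
have -> : b = (b - j%:~R) + j%:~R by rewrite subrK.
set b' := b - j%:~R; rewrite addrK.
rewrite !(homeo_int hF) !cnt !(cper_int _ _ cp).
rewrite (_ : b' + j%:~R - (r + j%:~R) = b' - r); last by lra.
rewrite (_ : F b' + j%:~R - (F r + j%:~R) = F b' - F r); last by lra.
rewrite (_ : crit_count s b' + j%:~R * (size s)%:R - (crit_count s r + j%:~R * (size s)%:R) =
  crit_count s b' - crit_count s r) //; lra.
Unshelve. all: by end_near. Qed.

(** Points at distance below dl fall under [short_pair]. For the others F b - F a is at least a
    fixed multiple of b - a, so the left side is at most B (F b - F a)^2, and L is chosen so large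
    that L (b - a) >= B. *)
Theorem multicritical_distorted : exists V W, distorted F V W.
Proof.
have [s hs] := critical_seq.
have [K K0 HK] := short_pair hs.
pose dl := K^-1; have dl0 : 0 < dl by rewrite invr_gt0.
have cF : cper (fun x => F (x + dl) - F x).
  have [Fc _ F1] := hF; split=> x; last by rewrite addrAC !F1; lra.
  apply: cvgB; last exact: Fc.
  apply: (@continuous_comp _ _ _ (fun x => x + dl) F); last exact: Fc.
  by apply: cvgD; [exact: cvg_id|exact: cvg_cst].
have [z zmin] := cper_min cF.
pose k := F (z + dl) - F z.
have k0 : 0 < k by rewrite subr_gt0 (homeo_lt hF) ltrDl.
have [M M0 HM] := cper_bounded (C3_cper_derive1 hF C3F).
pose B := (M * (2 * dl / k)) ^+ 2.
pose L := K + B / dl.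
have B0 : 0 <= B by exact: sqr_ge0.
have L0 : 0 < L by rewrite ltr_pwDl // divr_ge0 // ltW.
have far n a : n%:R * k <= F (a + n%:R * dl) - F a.
  elim: n => [|n IH]; first by rewrite !mul0r addr0 subrr.
  have -> : a + n.+1%:R * dl = a + n%:R * dl + dl by rewrite -natr1; ring.
  by have := zmin (a + n%:R * dl); rewrite -/k -natr1 mulrDl mul1r; lra.
pose V x := L * (x + crit_count s x).
exists V, (L * (1 + (size s)%:R)); split; [exact: hF|move=> x; exact: dF0| | | |].
- by move=> x; apply: derivable_continuous; have [H _] := C3F; exact: (H 1%N x).
- move=> x y xy; rewrite /V ler_pM2l // lerD //; exact: crit_count_homo.
- by move=> x; rewrite /V crit_count_period; ring.
move=> a b ab; rewrite /V -mulrBr.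
rewrite (_ : b + crit_count s b - (a + crit_count s a) = (b - a) + (crit_count s b - crit_count s a));
  last by lra.
have cab : 0 <= crit_count s b - crit_count s a by rewrite subr_ge0; apply: crit_count_homo; exact: ltW.
have [bK|bK] := ltP b (a + dl).
  apply: (le_trans (HK _ _ ab bK)); rewrite ler_wpM2l ?sqr_ge0 // ler_expR; apply: ler_wpM2r.
    by apply: addr_ge0 => //; rewrite subr_ge0 ltW.
  by rewrite lerDl divr_ge0 // ltW.
pose y := (b - a) / dl.
have y1 : 1 <= y by rewrite ler_pdivlMr // mul1r; lra.
have /andP[n1 n2] : (Num.trunc y)%:R <= y < (Num.trunc y).+1%:R.
  by apply: truncn_itv; lra.
set n := Num.trunc y in n1 n2; rewrite -natr1 in n2.
have n0 : 1 <= n%:R :> R by rewrite ler1n truncn_gt0.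
have yE : b - a = y * dl by rewrite /y mulfVK // gt_eqF.
have nb : a + n%:R * dl <= b.
  have : n%:R * dl <= y * dl by rewrite ler_pM2r.
  by rewrite -yE; lra.
have Fab : n%:R * k <= F b - F a.
  by apply: (le_trans (far n a)); rewrite lerB // (homeo_le hF).
have slope : (b - a) * k <= 2 * dl * (F b - F a).
  apply: (@le_trans _ _ (2 * dl * (n%:R * k))); last by rewrite ler_pM2l // mulr_gt0.
  rewrite yE (_ : y * dl * k = y * (dl * k)); last by ring.
  rewrite (_ : 2 * dl * (n%:R * k) = (2 * n%:R) * (dl * k)); last by ring.
  by rewrite ler_pM2r ?mulr_gt0 //; lra.
have F0 : 0 <= F b - F a by rewrite subr_ge0 (homeo_le hF) ltW.
have d0 := derive1_ge0 hF C3F.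
have dM x : derive1 F x <= M by apply: le_trans (HM x); exact: ler_norm.
apply: (@le_trans _ _ ((F b - F a) ^+ 2 * B)).
  have s1 : derive1 F a * derive1 F b <= M ^+ 2 by rewrite expr2; apply: ler_pM.
  have s2 : (b - a) ^+ 2 <= (2 * dl / k * (F b - F a)) ^+ 2.
    rewrite -subr_ge0 subr_sqr.
    have h : b - a <= 2 * dl / k * (F b - F a) by rewrite mulrAC ler_pdivlMr.
    by apply: mulr_ge0; lra.
  rewrite (_ : (F b - F a) ^+ 2 * B = M ^+ 2 * (2 * dl / k * (F b - F a)) ^+ 2); last by rewrite /B; ring.
  by apply: ler_pM => //; [exact: mulr_ge0|exact: sqr_ge0].
rewrite ler_wpM2l ?sqr_ge0 //; apply: le_trans (expR_ge1Dx _).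
have : B <= L * (b - a).
  apply: (@le_trans _ _ (B / dl * dl)); first by rewrite mulfVK // gt_eqF.
  apply: ler_pM; rewrite ?divr_ge0 ?(ltW dl0) //; last by lra.
  by rewrite lerDr ltW.
have : 0 <= L * (crit_count s b - crit_count s a) by rewrite mulr_ge0 // ltW.
by rewrite mulrDr; lra.
Qed.

End Gluing.

(** A diffeomorphism is the case without critical points, its derivative being nonzero by the chain
    rule with the inverse; one distortion theorem thus serves the whole family. *)
Lemma circle_diffeo_multicritical (R : realType) (F : R -> R) : circle_diffeo F -> multicritical F.
Proof.
move=> [hF C3 C3i].
have pos x : 0 < derive1 F x.
  rewrite lt_neqAle (derive1_ge0 hF C3) andbT eq_sym.
  have d1 : derivable F x 1 by have [H _] := C3; exact: (H 0%N x).
  have d2 : derivable (inv_map F) (F x) 1 by have [H _] := C3i; exact: (H 0%N (F x)).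
  have := @is_derive1_comp _ (inv_map F) F x _ _ (derivableP d2) (derivableP d1).
  rewrite (_ : inv_map F \o F = id); last by apply/funext => y /=; rewrite (inv_mapE hF).
  move=> h; have e1 := @derive_val _ _ _ _ _ _ _ h.
  rewrite derive_id in e1.
  by apply/eqP => E; move: e1; rewrite derive1E in E; rewrite E mulr0 => /eqP; rewrite oner_eq0.
have nc c : ~ critical_points F c by move=> H; apply: H; exact: pos.
split => //; last by move=> c /nc.
rewrite (_ : _ `&` _ = set0); first exact: finite_set0.
by apply/seteqP; split => // c [/nc].
Qed.

(** * Riesz representation on the circle *)

Definition majorant (R : realType) (x : R) (psi : R -> R) : Prop :=
  [/\ cper psi, forall y, 0 <= psi y & forall y, 0 <= y <= x -> 1 <= psi y].

Section CircleRiesz.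
Context {R : realType} (L : (R -> R) -> R).
Hypotheses (LD : forall u w, cper u -> cper w -> L (fun x => u x + w x) = L u + L w)
  (LZ : forall c u, cper u -> L (fun x => c * u x) = c * L u)
  (Lle : forall u w, cper u -> cper w -> (forall x, u x <= w x) -> L u <= L w)
  (L1 : forall c, L (cst c) = c).

(** The mass of the arc [0, x] for the measure to be found, by outer approximation with continuous
    functions. *)
Definition arc_content (x : R) : R := inf [set c | exists2 psi, majorant x psi & c = L psi].

Lemma functional_sum (m : nat) (c : nat -> R) (w : nat -> R -> R) : (forall i, cper (w i)) ->
  L (fun y => \sum_(i < m) c i * w i y) = \sum_(i < m) c i * L (w i).
Proof.
move=> cw; elim: m => [|m IH].
  by rewrite big_ord0 -[RHS](L1 0); congr L; apply/funext => y; rewrite big_ord0.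
rewrite big_ord_recr /= -IH -LZ// -(LD _ (cperZ (c m) (cw m))).
  by congr L; apply/funext => y; rewrite big_ord_recr.
by apply: cper_sum => i; exact: cperZ.
Qed.

Lemma cper_minr (u w : R -> R) : cper u -> cper w -> cper (fun x => Num.min (u x) (w x)).
Proof.
move=> [cu pu] [cw pw]; split=> x; last by rewrite pu pw.
exact: continuous_min.
Qed.

Lemma majorant1 (x : R) : majorant x (cst 1).
Proof. by split=> //; exact: cper_cst. Qed.

Lemma arc_content_le (x : R) psi : majorant x psi -> arc_content x <= L psi.
Proof.
move=> m; apply: ge_inf; last by exists psi.
exists 0 => _ [phi [cphi phi0 _] ->]; rewrite -(L1 0); apply: Lle => //; exact: cper_cst.
Qed.

Lemma arc_content_ge (x c : R) : (forall psi, majorant x psi -> c <= L psi) -> c <= arc_content x.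
Proof.
move=> H; apply: lb_le_inf; first by exists (L (cst 1)); exists (cst 1) => //; exact: majorant1.
by move=> _ [phi m ->]; exact: H.
Qed.

Lemma arc_content_approx (x e : R) : 0 < e -> exists2 psi, majorant x psi & L psi <= arc_content x + e.
Proof.
move=> e0; apply: contrapT => H.
suff : arc_content x + e <= arc_content x by lra.
apply: arc_content_ge => psi m; rewrite leNgt; apply/negP => lt.
by apply: H; exists psi => //; exact: ltW.
Qed.

Lemma arc_content_ge0 (x : R) : 0 <= arc_content x.
Proof.
apply: arc_content_ge => psi [cpsi psi0 _].
by rewrite -(L1 0); apply: Lle => //; exact: cper_cst.
Qed.

Lemma arc_content_le1 (x : R) : arc_content x <= 1.
Proof. by rewrite -[X in _ <= X]L1; apply: arc_content_le; exact: majorant1. Qed.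

Lemma arc_content_homo (x y : R) : x <= y -> arc_content x <= arc_content y.
Proof.
move=> xy; apply: arc_content_ge => psi [cpsi p0 p1]; apply: arc_content_le; split => // z /andP[z0 zx].
by apply: p1; rewrite z0 (le_trans zx).
Qed.

Lemma majorant_nbhs (x e : R) psi : majorant x psi -> 0 <= x -> 0 < e ->
  exists2 d, 0 < d & forall y, - d <= y <= x + d -> 1 <= psi y + e.
Proof.
move=> [cpsi p0 p1] x0 e0; have [d d0 Hd] := cper_ucont cpsi e0.
exists d => // y /andP[dy yx].
pose z := Num.max 0 (Num.min x y).
have [z0 zx zy] : [/\ 0 <= z, z <= x & `|z - y| <= d].
  rewrite /z minEle maxEle; case: (lerP x y) => ?; case: ifPn => h; rewrite ?ler_distl; by split; lra.
have := p1 z; rewrite z0 zx => /(_ isT); have := Hd _ _ zy; rewrite ler_distl; lra.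
Qed.

(** If psi is a nearly optimal majorant at x, then psi + e / 2 is one at x + d, by uniform
    continuity. *)
Lemma arc_content_right (x e : R) : 0 <= x -> 0 < e ->
  exists2 d, 0 < d & arc_content (x + d) <= arc_content x + e.
Proof.
move=> x0 e0; have e20 : 0 < e / 2 by lra.
have [psi m Hpsi] := arc_content_approx x e20.
have [d d0 Hd] := majorant_nbhs m x0 e20; exists d => //.
have [cpsi p0 p1] := m.
have -> : e = e / 2 + e / 2 by field.
rewrite addrA (le_trans _ (lerD Hpsi (lexx _)))//.
rewrite -(L1 (e / 2)) -(LD cpsi (cper_cst _)).
apply: arc_content_le; split; first by apply: cperD => //; exact: cper_cst.
  by move=> y; have := p0 y; rewrite /=; lra.
by move=> y /andP[y0 yx]; apply: Hd; rewrite yx; lra.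
Qed.

(* With psi nearly optimal at 0, max (phi, psi + e) >= 1 near the whole circle whereas
   min (phi, psi + e) is a majorant at 0; the sum of the two is phi + psi + e. *)
Lemma arc_content_left1 (e : R) : 0 < e -> exists2 x, 0 < x < 1 & 1 - e <= arc_content x.
Proof.
move=> e0; have e20 : 0 < e / 2 by lra.
have [psi m Hpsi] := arc_content_approx 0 e20.
have [d d0 Hd] := majorant_nbhs m (lexx _) e20.
have [cpsi p0 p1] := m.
pose d' := Num.min d (1/2).
have d'0 : 0 < d' by rewrite lt_min d0; lra.
have [d'd d'2] : d' <= d /\ d' <= 1/2 by rewrite !ge_min !lexx ?orbT.
exists (1 - d'); first by lra.
apply: arc_content_ge => phi [cphi f0 f1].
have cc : cper (fun y => psi y + e / 2) by apply: cperD => //; exact: cper_cst.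
have cm : cper (fun y => Num.min (phi y) (psi y + e / 2)) by exact: cper_minr.
have L0 : arc_content 0 <= L (fun y => Num.min (phi y) (psi y + e / 2)).
  apply: arc_content_le; split=> // y.
    by rewrite le_min f0; have := p0 y; lra.
  move=> y0; have h1 := f1 y; have h2 := p1 y y0; rewrite le_min.
  by apply/andP; split; [apply: h1|]; lra.
have : 1 + L (fun y => Num.min (phi y) (psi y + e / 2)) <= L phi + (L psi + e / 2).
  have e1 := LD (cper_cst 1) cm; have e2 := LD cpsi (cper_cst (e / 2)).
  have e3 := LD cphi cc; rewrite L1 in e1; rewrite L1 in e2.
  rewrite -e1 -e2 -e3.
  apply: Lle; [exact: (cperD (cper_cst _) cm)|exact: (cperD cphi cc)|].
  move=> y /=; have [j [r [yE r0 r1]]] := floor_dec y.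
  rewrite yE !(cper_int _ _ cphi) !(cper_int _ _ cpsi).
  have pr1 : psi (r - 1) = psi r by exact: (cper_intB r 1 cpsi).
  case: (lerP (phi r) (psi r + e / 2)) => h.
    suff : 1 <= psi r + e / 2 by lra.
    case: (lerP r (1 - d')) => hr; first by have := f1 r; rewrite r0 hr => /(_ isT); lra.
    have := Hd (r - 1); rewrite pr1; apply; lra.
  suff : 1 <= phi r \/ 1 <= psi r + e / 2 by case; lra.
  case: (lerP r (1 - d')) => hr; first by left; apply: f1; rewrite r0 hr.
  right; have := Hd (r - 1); rewrite pr1; apply; lra.
by lra.
Qed.

(* Peel off the layers min (psi, q_n) one by one. *)
Lemma arc_content_layers (n : nat) (q x : nat -> R) psi : (forall i, 0 <= q i) ->
  {homo x : i j / (i <= j)%N >-> i <= j} -> cper psi -> (forall y, 0 <= psi y) ->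
  (forall y, 0 <= y < 1 -> \sum_(i < n) q i * (y <= x i)%R%:R <= psi y) ->
  \sum_(i < n) q i * arc_content (x i) <= L psi.
Proof.
move=> q0 hx; elim: n psi => [|n IH] psi cpsi p0 H.
  rewrite big_ord0 -(L1 0); apply: Lle => //; exact: cper_cst.
rewrite big_ord_recr /=.
have cm : cper (fun y => Num.min (psi y) (q n)) by apply: cper_minr => //; exact: cper_cst.
have cr : cper (fun y => psi y - Num.min (psi y) (q n)) by exact: cperB.
have -> : psi = (fun y => (psi y - Num.min (psi y) (q n)) + Num.min (psi y) (q n)).
  by apply/funext => y; ring.
rewrite LD//; apply: lerD.
  apply: IH => //; first by move=> y; rewrite subr_ge0 ge_min lexx.
  move=> y y01; have := H y y01; rewrite big_ord_recr /=.
  have s0 : 0 <= \sum_(i < n) q i * (y <= x i)%R%:R.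
    by apply: sumr_ge0 => i _; apply: mulr_ge0.
  case: (lerP y (x n)) => yx; last first.
    move=> _; rewrite big1 ?subr_ge0 ?ge_min ?lexx// => i _.
    rewrite leNgt (le_lt_trans _ yx) ?mulr0//; exact/hx/ltnW.
  by rewrite mulr1; case: (lerP (psi y) (q n)) => hq; lra.
have [qn0|qn0] := eqVneq (q n) 0.
  rewrite qn0 mul0r -[X in X <= _](L1 0); apply: Lle => [||y]; first exact: cper_cst.
    by apply: cper_minr => //; exact: cper_cst.
  by rewrite le_min p0 lexx.
have qn : 0 < q n by rewrite lt_neqAle eq_sym qn0 q0.
rewrite -ler_pdivlMl// -LZ//; apply: arc_content_le; split; first exact: cperZ.
  by move=> y; rewrite pmulr_rge0 ?invr_gt0// le_min p0 q0.
move=> y /andP[y0 yx]; rewrite ler_pdivlMl// mulr1 le_min lexx andbT.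
have [j [r [yE r0 r1]]] := floor_dec y.
have j0 : 0 <= (j%:~R : R).
  rewrite ler0z leNgt; apply/negP => jn.
  by have : (j + 1)%:~R <= (0 : R); [rewrite lerz0; lia|rewrite intrD; lra].
rewrite yE (cper_int _ _ cpsi); apply: le_trans (H r _); last by rewrite r0 r1.
rewrite big_ord_recr /= (_ : (r <= x n)%R = true) ?mulr1; last by lra.
by rewrite lerDr; apply: sumr_ge0 => i _; apply: mulr_ge0.
Qed.

(* u is uniformly close on [0, 1[ to the step function
   u (x_N) + \sum_i (u (x_i) - u (x_{i + 1})) 1_[0, x_i]; the two signs of the coefficients are
   put on opposite sides of the inequality. *)
Lemma arc_content_step (u : R -> R) (e : R) : cper u -> 0 < e ->
  exists (N : nat) (x p : nat -> R) (c : R),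
    [/\ forall i, 0 <= x i, forall i, (i < N)%N -> x i < 1,
        forall y, 0 <= y < 1 -> `|u y - (c + \sum_(i < N) p i * (y <= x i)%R%:R)| <= e &
        L u <= c + e + \sum_(i < N) p i * arc_content (x i)].
Proof.
move=> cu e0; have [d d0 Hd] := cper_ucont cu e0.
have [N N0 HN] : exists2 N : nat, (0 < N)%N & N%:R^-1 <= d.
  exists (Num.trunc d^-1).+1 => //.
  rewrite invf_ple ?posrE ?ltr0n//; exact/ltW/truncnS_gt.
have N0' : (0 : R) < N%:R by rewrite ltr0n.
pose x (i : nat) : R := i%:R / N%:R.
pose p i := u (x i) - u (x i.+1).
have x0 i : 0 <= x i by rewrite divr_ge0.
have xN i : (i < N)%N -> x i < 1 by move=> iN; rewrite ltr_pdivrMr// mul1r ltr_nat.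
have step y : 0 <= y < 1 -> `|u y - (u (x N) + \sum_(i < N) p i * (y <= x i)%R%:R)| <= e.
  move=> /andP[y0 y1].
  have [k [kN kE yk]] : exists k, [/\ (k <= N)%N, forall i, (y <= x i) = (k <= i)%N &
      x k - y <= N%:R^-1].
    have ex : exists k, y <= x k by exists N; rewrite /x divff ?gt_eqF// ltW.
    have := ex_minnP ex => -[k ky kmin]; exists k; split.
    - by apply: kmin; rewrite /x divff ?gt_eqF// ltW.
    - move=> i; apply/idP/idP => [/kmin//|ki]; apply: (le_trans ky).
      by rewrite ler_wpM2r ?invr_ge0 ?ler0n// ler_nat.
    case: k ky kmin => [|k] ky kmin.
      have : 0 < (N%:R : R)^-1 by rewrite invr_gt0.
      by rewrite /x mul0r; lra.
    have : x k < y by rewrite ltNge; apply/negP => /kmin; rewrite ltnn.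
    by rewrite /x -natr1 mulrDl mul1r; lra.
  have tele (m : nat) : \sum_(i < m) p i * (y <= x i)%R%:R =
      if (k <= m)%N then u (x k) - u (x m) else 0.
    elim: m => [|m IH]; first by rewrite big_ord0; case: ifP => // ; rewrite leqn0 => /eqP ->; ring.
    rewrite big_ord_recr /= IH kE; case: (ltngtP k m.+1) => km.
    - by rewrite -ltnS km mulr1 /p; ring.
    - by rewrite leqNgt (ltn_trans _ km)//= mulr0 addr0.
    - by rewrite km ltnn/= mulr0 addr0 subrr.
  rewrite tele kN; have -> : u y - (u (x N) + (u (x k) - u (x N))) = u y - u (x k) by ring.
  apply: Hd; rewrite distrC ger0_norm ?(le_trans yk)//.
  by rewrite subr_ge0 kE.
exists N, x, p, (u (x N)); split => //.
pose q i : R := Num.max 0 (- p i); pose p' i : R := Num.max 0 (p i).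
have q0 i : 0 <= q i by rewrite le_max lexx.
have p'0 i : 0 <= p' i by rewrite le_max lexx.
have pE i : p i = p' i - q i.
  by rewrite /p' /q /Num.max; case: ifPn; case: ifPn; lra.
apply/ler_addgt0Pr => t t0.
pose S := \sum_(i < N) p' i.
have S0 : 0 <= S by apply: sumr_ge0.
have [psi Hpsi] : {psi : nat -> R -> R & forall i, majorant (x i) (psi i) /\
    L (psi i) <= arc_content (x i) + t / (S + 1)}.
  have H i : {psi : R -> R | majorant (x i) psi /\ L psi <= arc_content (x i) + t / (S + 1)}.
    apply: cid; have tS : 0 < t / (S + 1) by apply: divr_gt0 => //; lra.
    by have [psi m h] := arc_content_approx (x i) tS; exists psi.
  by exists (fun i => sval (H i)) => i; case: (H i).
have cpsi i : cper (psi i) by have [[]] := Hpsi i.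
pose P := fun y => \sum_(i < N) p' i * psi i y.
have cP : cper P by apply: cper_sum => i; exact: cperZ.
have LP : L P <= \sum_(i < N) p' i * arc_content (x i) + t.
  have -> : L P = \sum_(i < N) p' i * L (psi i).
    exact: functional_sum.
  apply: (@le_trans _ _ (\sum_(i < N) p' i * (arc_content (x i) + t / (S + 1)))).
    by apply: ler_sum => i _; apply: ler_wpM2l => //; case: (Hpsi i).
  under eq_bigr do rewrite mulrDr.
  rewrite big_split /= lerD2l -mulr_suml -/S mulrA ler_pdivrMr; last by lra.
  by rewrite mulrC ler_wpM2l; lra.
have cu' : cper (fun y => - u y).
  have -> : (fun y => - u y) = (fun y => -1 * u y) by apply/funext => y; rewrite mulN1r.
  exact: cperZ.
have H : \sum_(i < N) q i * arc_content (x i) <= L (fun y => (u (x N) + e) + (P y - u y)).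
  have cf : cper (fun y => (u (x N) + e) + (P y - u y)).
    by apply: cperD; [exact: cper_cst|exact: cperB].
  have key y : 0 <= y < 1 -> \sum_(i < N) q i * (y <= x i)%R%:R <= u (x N) + e + (P y - u y).
    move=> y01; have := step y y01; rewrite ler_distl => /andP[_].
    have -> : \sum_(i < N) p i * (y <= x i)%R%:R =
        \sum_(i < N) p' i * (y <= x i)%R%:R - \sum_(i < N) q i * (y <= x i)%R%:R.
      by rewrite -sumrB; apply: eq_bigr => i _; rewrite pE mulrBl.
    suff : \sum_(i < N) p' i * (y <= x i)%R%:R <= P y by lra.
    apply: ler_sum => i _; apply: ler_wpM2l => //.
    have [[_ f0 f1] _] := Hpsi i; case: (lerP y (x i)) => // yx.
    by apply: f1; case/andP: y01 => ->.
  apply: (@arc_content_layers N q x) => //.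
    by move=> i j ij; rewrite ler_wpM2r ?invr_ge0 ?ler0n// ler_nat.
  move=> y; have [j [r [yE r0 r1]]] := floor_dec y.
  rewrite yE (cper_int r j cf).
  apply: le_trans (key r _); last by rewrite r0 r1.
  by apply: sumr_ge0 => i _; apply: mulr_ge0.
have LN : L (fun y => - u y) = - L u.
  by rewrite -[RHS]mulN1r -LZ//; congr L; apply/funext => y; rewrite mulN1r.
have e1 := LD (cper_cst (u (x N) + e)) (cperB cP cu); have e2 := LD cP cu'.
rewrite L1 /= in e1; rewrite LN /= in e2; rewrite e1 e2 in H.
have -> : \sum_(i < N) p i * arc_content (x i) =
    \sum_(i < N) p' i * arc_content (x i) - \sum_(i < N) q i * arc_content (x i).
  by rewrite -sumrB; apply: eq_bigr => i _; rewrite pE mulrBl.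
by lra.
Qed.

End CircleRiesz.

(** * Measures on the circle and their distribution functions *)

Section CircleMeasure.
Context {R : realType} (P : probability (measurableTypeR R) R).
Hypothesis P01 : P `[0, 1[%classic = 1%E.
Local Notation I01 := (`[(0 : R), 1[%classic).
Implicit Types (u : R -> R) (x : R).

Let mI : measurable (I01 : set (measurableTypeR R)).
Proof. exact: measurable_itv. Qed.

Lemma cper_measurable_fun u (D : set R) : cper u -> measurable_fun D u.
Proof.
by move=> [cu _]; apply: measurable_funTS; apply: continuous_measurable_fun => x; exact: cu.
Qed.

Lemma bounded_integrable u (B : R) : measurable_fun I01 u -> (forall x, `|u x| <= B) ->
  P.-integrable I01 (EFin \o u).
Proof.
move=> mu uB; apply: measurable_bounded_integrable => //; first by have := ltry (1 : R); rewrite -P01; exact.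
exists B; split; first exact: num_real.
by move=> M BM x _; exact: le_trans (uB x) (ltW BM).
Qed.

Lemma cper_integrable u : cper u -> P.-integrable I01 (EFin \o u).
Proof.
move=> cu; have [B B0 HB] := cper_bounded cu.
by apply: (@bounded_integrable _ B) => //; exact: cper_measurable_fun.
Qed.

Lemma ray_indicE x : (fun y => (y <= x)%R%:R) = \1_(`]-oo, x]%classic) :> (R -> R).
Proof. by apply/funext => y; rewrite indicE mem_setE in_itv. Qed.

Lemma ray_integrable x : P.-integrable I01 (EFin \o (fun y => (y <= x)%R%:R)).
Proof.
apply: (@bounded_integrable _ 1) => [|y].
  by rewrite ray_indicE; apply: measurable_funTS; exact: measurable_indic.
by case: (y <= x); rewrite ?normr1 ?normr0.
Qed.

Lemma ray_Rintegral x : \int[P]_(y in I01) ((y <= x)%R%:R) = fine (P (`]-oo, x] `&` I01)).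
Proof. by rewrite ray_indicE /Rintegral; congr fine; rewrite integral_indic. Qed.

Lemma step_Rintegral (m : nat) (p x : nat -> R) :
  P.-integrable I01 (EFin \o (fun y => \sum_(i < m) p i * (y <= x i)%R%:R)) /\
  \int[P]_(y in I01) (\sum_(i < m) p i * (y <= x i)%R%:R) =
    \sum_(i < m) p i * fine (P (`]-oo, x i] `&` I01)).
Proof.
elim: m => [|m [IH1 IH2]].
  have -> : (fun y => \sum_(i < 0) p i * (y <= x i)%R%:R) = cst 0.
    by apply/funext => y; rewrite big_ord0.
  split; first by apply: cper_integrable; exact: cper_cst.
  by rewrite Rintegral_cst// mul0r big_ord0.
have iP : P.-integrable I01 (EFin \o (fun y => p m * (y <= x m)%R%:R)).
  have := integrableZl mI (p m) (ray_integrable (x m)).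
  by congr (_ _); apply/funext => y; rewrite /= EFinM.
have -> : (fun y => \sum_(i < m.+1) p i * (y <= x i)%R%:R) =
    (fun y => \sum_(i < m) p i * (y <= x i)%R%:R + p m * (y <= x m)%R%:R).
  by apply/funext => y; rewrite big_ord_recr.
split.
  have := integrableD mI IH1 iP.
  by congr (_ _); apply/funext => y; rewrite /= EFinD.
rewrite RintegralD// IH2 RintegralZl ?big_ord_recr//=; last exact: ray_integrable.
by rewrite ray_Rintegral.
Qed.

Lemma cst_Rintegral (c : R) : \int[P]_(y in I01) c = c.
Proof.
rewrite Rintegral_cst// -[RHS]mulr1; congr (_ * _).
by transitivity (fine (1%E : \bar R)) => //; congr fine; exact: P01.
Qed.

Context (L : (R -> R) -> R).
Hypotheses (LD : forall u w, cper u -> cper w -> L (fun x => u x + w x) = L u + L w)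
  (LZ : forall c u, cper u -> L (fun x => c * u x) = c * L u)
  (Lle : forall u w, cper u -> cper w -> (forall x, u x <= w x) -> L u <= L w)
  (L1 : forall c, L (cst c) = c).

(** Both sides are odd in u, so one inequality for all u suffices; it follows from
    [arc_content_step], as the integral of a step function is known from the masses of the arcs. *)
Lemma arc_content_Rintegral :
  (forall x, 0 <= x < 1 -> fine (P (`]-oo, x] `&` I01)) = arc_content L x) ->
  forall u, cper u -> \int[P]_(x in I01) u x = L u.
Proof.
move=> HP.
have le u : cper u -> L u <= \int[P]_(x in I01) u x.
  move=> cu; apply/ler_addgt0Pr => e e0; have e20 : 0 < e / 2 by lra.
  have [N [x [p [c [x0 x1 Hs HL]]]]] := arc_content_step LD LZ Lle L1 cu e20.
  have [iS S] := step_Rintegral N p x.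
  have ic d : P.-integrable I01 (EFin \o (fun=> d)) by apply: cper_integrable; exact: cper_cst.
  have : \int[P]_(y in I01) ((c - e / 2) + \sum_(i < N) p i * (y <= x i)%R%:R) <=
         \int[P]_(y in I01) u y.
    apply: le_Rintegral => //; first exact: (integrableD mI (ic _) iS).
      exact: cper_integrable.
    move=> y /=; rewrite in_itv /= => y01; have := Hs y y01.
    by rewrite ler_distl; lra.
  rewrite RintegralD// cst_Rintegral S.
  rewrite (eq_bigr (fun i : 'I_N => p i * arc_content L (x i))); first by lra.
  by move=> i _; rewrite HP// x0 x1.
move=> u cu; apply/eqP; rewrite eq_le le// andbT.
have cu' : cper (fun x => -1 * u x) by exact: cperZ.
have := le _ cu'; rewrite LZ// RintegralZl//; first lra.
exact: cper_integrable.
Qed.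

(** Majorants give one inequality by integration. For the other, majorants that converge pointwise
    on [0, 1[ to the indicator of [0, x] are integrated by dominated convergence. *)
Lemma Rintegral_arc_content : (forall u, cper u -> \int[P]_(x in I01) u x = L u) ->
  forall x, 0 <= x < 1 -> fine (P (`]-oo, x] `&` I01)) = arc_content L x.
Proof.
move=> HP x /andP[x0 x1]; apply/eqP; rewrite eq_le; apply/andP; split.
  apply: arc_content_ge => psi [cpsi p0 p1]; rewrite -HP// -ray_Rintegral.
  apply: le_Rintegral => //; [exact: ray_integrable|exact: cper_integrable|].
  move=> y /=; rewrite in_itv /= => /andP[y0 y1].
  by case: (lerP y x) => // yx; apply: p1; rewrite y0.
(* A periodic function equal to 1 at 0 must return to 1 at 1, so it can vanish only on an interval
   inside ]x, 1[; these intervals exhaust ]x, 1[ as n grows. *)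
have bump (n : nat) : {b : R -> R | [/\ cper b, forall y, 0 <= b y <= 1,
    forall y, 0 <= y <= x -> b y = 1 &
    forall y, x + (1 - x) / n.+2%:R <= y <= 1 - (1 - x) / n.+2%:R -> b y = 0]}.
  apply: cid; have n0 : (2 : R) <= n.+2%:R by rewrite ler_nat.
  set t := (1 - x) / n.+2%:R.
  have t0 : 0 < t by rewrite divr_gt0; lra.
  have t1 : t <= (1 - x) / 2 by rewrite ler_pM2l ?lef_pV2 ?posrE; lra.
  have [|||b [cb b01 b1 b0]] := @bump_exists R (x / 2) (x / 2) (x / 2 + t); try lra.
  exists b; split => // y yx.
    by apply: (b1 y 0); rewrite addr0 ler_distl; lra.
  apply/eqP; apply: contraT => /b0[j]; rewrite ltr_distl => /andP[j1 j2].
  have : (-1)%:~R < j%:~R :> R by rewrite intrN; lra.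
  have : j%:~R < 1%:~R :> R by rewrite /=; lra.
  rewrite !ltr_int => j3 j4; have j5 : j = 0 by lia.
  by move: j1 j2; rewrite j5 addr0; lra.
pose b n := sval (bump n).
have bP n : [/\ cper (b n), forall y, 0 <= b n y <= 1, forall y, 0 <= y <= x -> b n y = 1 &
    forall y, x + (1 - x) / n.+2%:R <= y <= 1 - (1 - x) / n.+2%:R -> b n y = 0].
  by rewrite /b; case: (bump n).
have cvg : (\int[P]_(y in I01) ((b n y)%:E))%E @[n --> \oo] -->
    (\int[P]_(y in I01) ((y <= x)%R%:R)%:E)%E.
  apply: (@dominated_cvg _ (measurableTypeR R) R P I01 mI (fun n y => (b n y)%:E)
    (fun y => ((y <= x)%R%:R)%:E) (cst 1%E)) => //.
  - by move=> n; apply/measurable_EFinP; apply: cper_measurable_fun; case: (bP n).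
  - move=> y /=; rewrite in_itv /= => /andP[y0 y1].
    apply: cvg_near_cst; case: (lerP y x) => yx.
      by apply: nearW => n; case: (bP n) => _ _ -> //; rewrite y0.
    have m0 : 0 < Num.min (y - x) (1 - y) by rewrite lt_min; lra.
    near=> n; have [_ _ _ ->//] := bP n.
    suff : (1 - x) / n.+2%:R <= Num.min (y - x) (1 - y).
      by rewrite le_min; move: (_ / _) => t /andP[h1 h2]; apply/andP; split; lra.
    have h : (1 - x) / Num.min (y - x) (1 - y) <= n%:R.
      by near: n; exact: nbhs_infty_ger.
    rewrite ler_pdivrMr ?ltr0n// mulrC -ler_pdivrMr//; apply: le_trans h _.
    by rewrite ler_nat -addn2 leq_addr.
  - exact: (cper_integrable (cper_cst 1)).
  - move=> n y _; have [_ /(_ y)/andP[b0 b1] _ _] := bP n.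
    by rewrite /= lee_fin ger0_norm.
have ge n : ((arc_content L x)%:E <= \int[P]_(y in I01) ((b n y)%:E))%E.
  have [cb b01 b1 _] := bP n.
  rewrite -[leRHS]fineK; last by apply: integrable_fin_num => //; exact: cper_integrable.
  rewrite lee_fin; have := HP _ cb; rewrite /Rintegral => ->.
  by apply: arc_content_le => //; split => // y; [case/andP: (b01 y)|move=> /b1 ->].
have : ((arc_content L x)%:E <= \int[P]_(y in I01) ((y <= x)%R%:R)%:E)%E.
  by apply: (cvge_to_ge cvg); apply: nearW.
rewrite -[leRHS]fineK; last by apply: integrable_fin_num => //; exact: ray_integrable.
by rewrite lee_fin -ray_Rintegral.
Unshelve. all: by end_near. Qed.

End CircleMeasure.

Section CircleMeasureUnique.
Context {R : realType} (P Q : probability (measurableTypeR R) R).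
Hypotheses (P01 : P `[0, 1[%classic = 1%E) (Q01 : Q `[0, 1[%classic = 1%E).
Local Notation I01 := (`[(0 : R), 1[%classic).

Lemma ray_circle_measure (mu : probability (measurableTypeR R) R) : mu I01 = 1%E ->
  forall a : R, mu `]a, +oo[%classic =
    (if (a < 0)%R then 1 else if (a < 1)%R then 1 - mu (`]-oo, a] `&` I01) else 0)%E.
Proof.
move=> m01 a.
have mI : measurable (I01 : set (measurableTypeR R)) by exact: measurable_itv.
have m0 : mu (~` I01) = 0%E.
  by rewrite (probability_setC mu mI) -(@subee _ (1 : R)%:E)//; congr (_ - _)%E; exact: m01.
have mC (A : set R) : measurable A -> mu (A `&` I01) = mu A.
  move=> mA; apply/eqP; rewrite eq_le le_measure ?inE//=; last exact: measurableI.
  have e : A `<=` (A `&` I01) `|` ~` I01.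
    by move=> y Ay; case: (pselect (I01 y)) => h; [left|right].
  apply: (@le_trans _ _ (mu ((A `&` I01) `|` ~` I01))).
    by rewrite le_measure ?inE//; apply: measurableU; [exact: measurableI|exact: measurableC].
  apply: le_trans (measureU2 _ _ _) _ => //; first exact: measurableI.
    exact: measurableC.
  by rewrite [X in (_ + X)%E]m0 adde0.
have mA : measurable (`]-oo, a]%classic : set (measurableTypeR R)) by exact: measurable_itv.
case: ltP => a0; last case: ltP => a1.
- rewrite -mC// -m01; congr (mu _); apply/seteqP; split => y /=; rewrite !in_itv /=.
    by case.
  by move=> /andP[y0 y1]; split; rewrite ?y0 ?y1// andbT; lra.
- by rewrite -setCitvl (probability_setC mu mA) mC.
rewrite -mC// -(measure0 mu); congr (mu _); apply/seteqP; split => y //=.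
by rewrite !in_itv /= andbT; case=> ay /andP[_ y1]; have := lt_trans ay (lt_le_trans y1 a1); rewrite ltxx.
Qed.

(** The rays ]a, +oo[ form a generating family closed under intersection, and their masses are known
    from the arcs because the complement of [0, 1[ is null. *)
Lemma circle_measure_unique :
  (forall x, 0 <= x < 1 -> fine (P (`]-oo, x] `&` I01)) = fine (Q (`]-oo, x] `&` I01))) ->
  forall A : set R, measurable A -> P A = Q A.
Proof.
move=> H; apply: (@measure_unique _ R (measurableTypeR R) (@RGenOInfty.G R)
  (fun n => `]((- n%:R) : R), +oo[%classic) _ _ _ _ P Q) => //.
- exact: RGenOInfty.measurableE.
- move=> _ _ [x ->] [y ->]; exists (Num.max x y).
  apply/seteqP; split=> z /=; rewrite !in_itv /= !andbT gt_max; first by case=> -> ->.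
  by move/andP.
- by move=> i; exists (- i%:R).
- apply/seteqP; split=> // y _; exists (Num.trunc `|y|).+1 => //=.
  rewrite in_itv /= andbT ltrNl; apply: le_lt_trans (truncnS_gt _).
  by rewrite -normrN ler_norm.
- move=> _ [a ->]; apply: (etrans (ray_circle_measure P01 a)).
  apply: (etrans _ (esym (ray_circle_measure Q01 a))); case: ltP => // a0; case: ltP => // a1.
  have mA : measurable ((`]-oo, a] `&` I01)%classic : set (measurableTypeR R)).
    by apply: measurableI; exact: measurable_itv.
  have a01 : 0 <= a < 1 by rewrite a0.
  have := congr1 EFin (H a a01); rewrite !fineK ?fin_num_measure// => h.
  by congr (1 - _)%E; exact: h.
- by move=> k; rewrite -ge0_fin_numE// fin_num_measure.
Qed.

End CircleMeasureUnique.

Section CircleRieszMeasure.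
Context {R : realType} (L : (R -> R) -> R).
Hypotheses (LD : forall u w, cper u -> cper w -> L (fun x => u x + w x) = L u + L w)
  (LZ : forall c u, cper u -> L (fun x => c * u x) = c * L u)
  (Lle : forall u w, cper u -> cper w -> (forall x, u x <= w x) -> L u <= L w)
  (L1 : forall c, L (cst c) = c).

(** Distribution function of the future measure. It may jump at 0, by the mass of that point, but
    not at 1, by [arc_content_left1], so no mass is lost at the excluded end. *)
Let G (x : R) : R := if x < 0 then 0 else if x < 1 then arc_content L x else 1.

Let G_nd : nondecreasing G.
Proof.
move=> x y xy; rewrite /G; case: (ltP x 0) => x0; case: (ltP y 0) => y0.
- by [].
- by case: ifP => // _; exact: arc_content_ge0.
- by have := le_lt_trans (le_trans x0 xy) y0; rewrite ltxx.
case: (ltP x 1) => x1; case: (ltP y 1) => y1 //; first exact: arc_content_homo.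
  exact: arc_content_le1.
by have := le_lt_trans (le_trans x1 xy) y1; rewrite ltxx.
Qed.

Let G_rc : right_continuous G.
Proof.
move=> x; apply/cvgrPdist_le => e e0 /=.
case: (ltP x 0) => x0.
  near=> y; have y0 : y < 0 by near: y; exact: nbhs_right_lt.
  by rewrite /G x0 y0 subrr normr0 ltW.
case: (ltP x 1) => x1; last first.
  near=> y; have xy : x < y by near: y; exact: nbhs_right_gt.
  rewrite /G !ltNge x0 x1 (le_trans x1 (ltW xy)) (le_trans x0 (ltW xy))/=.
  by rewrite subrr normr0 ltW.
have [d d0 Hd] := arc_content_right LD Lle L1 x0 e0.
near=> y; have xy : x < y by near: y; exact: nbhs_right_gt.
have y1 : y < 1 by near: y; exact: nbhs_right_lt.
have yd : y <= x + d.
  near: y; apply: nbhs_right_le; lra.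
have y0 : 0 <= y := le_trans x0 (ltW xy).
have h : arc_content L x <= arc_content L y by apply: arc_content_homo => //; exact: ltW.
have h' : arc_content L y <= arc_content L (x + d) by exact: arc_content_homo.
rewrite /G !(ltNge _ 0) x0 y0 /= x1 y1 distrC ger0_norm; lra.
Unshelve. all: by end_near. Qed.

#[local] HB.instance Definition _ := isCumulative.Build R _ R G G_nd G_rc.

Let G_Ny0 : G @ -oo --> (0 : R).
Proof.
apply: cvg_near_cst; near=> y; have y0 : y < 0 by near: y; exact: nbhs_ninfty_lt.
by rewrite /G y0.
Unshelve. all: by end_near. Qed.

Let G_y1 : G @ +oo --> (1 : R).
Proof.
apply: cvg_near_cst; near=> y; have y1 : 1 < y by near: y; exact: nbhs_pinfty_gt.
by rewrite /G !ltNge (ltW y1) (le_trans ler01 (ltW y1)).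
Unshelve. all: by end_near. Qed.

#[local] HB.instance Definition _ := isCumulativeBounded.Build R 0 1 G G_Ny0 G_y1.

Let P0 := lebesgue_stieltjes_measure G.

Let P0_ray (x : R) : P0 `]-oo, x]%classic = (G x)%:E.
Proof.
by have := cdf_lebesgue_stieltjes_id G x; rewrite /cdf /distribution /pushforward preimage_id.
Qed.

(* Moves the null set of negative numbers into the fundamental domain. *)
Let X (x : measurableTypeR R) : measurableTypeR R := Num.max 0 x.

Let mX : measurable_fun setT X.
Proof. by apply: (@measurable_maxr _ (measurableTypeR R) R) => //; exact: measurable_id. Qed.

#[local] HB.instance Definition _ := @isMeasurableFun.Build _ _ _ _ X mX.

Lemma arc_content_measure : exists P : probability (measurableTypeR R) R,
  P `[0, 1[%classic = 1%E /\ forall u, cper u -> \int[P]_(x in `[0, 1[%classic) u x = L u.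
Proof.
have P01 : distribution P0 X `[0, 1[%classic = 1%E.
  have -> : distribution P0 X `[0, 1[%classic = P0 `]-oo, 1[%classic.
    rewrite /distribution /pushforward; congr (P0 _); apply/seteqP; split=> y /=.
      by rewrite !in_itv /= /X gt_max => /andP[_ /andP[]].
    by rewrite !in_itv /= /X gt_max le_max lexx => ->; rewrite ltr01.
  apply/eqP; rewrite eq_le probability_le1//=; apply/lee_addgt0Pr => e e0.
  have [x /andP[x0 x1] Hx] := arc_content_left1 LD Lle L1 e0.
  apply: (@le_trans _ _ (P0 `]-oo, x]%classic + e%:E)%E).
    by rewrite P0_ray -EFinD lee_fin /G ltNge (ltW x0) x1/=; lra.
  rewrite leeD2r// le_measure ?inE// => y /=.
  by rewrite !in_itv /= => /le_lt_trans; exact.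
exists (distribution P0 X); split => //.
apply: (arc_content_Rintegral P01 LD LZ Lle L1) => x x01.
transitivity (fine (P0 `]-oo, x]%classic)).
  congr fine.
  rewrite /distribution /pushforward; congr (P0 _); apply/seteqP; split=> y /=.
    by rewrite !in_itv /= /X ge_max => -[/andP[]].
  rewrite !in_itv /= /X !ge_max gt_max le_max lexx => yx /=; split; lra.
by rewrite P0_ray /= /G ltNge; case/andP: x01 => -> ->.
Qed.

End CircleRieszMeasure.

(** * The (-1)-measure *)

Section MinusOneMeasure.
Context {R : realType} (F V : R -> R) (W : R).
Hypotheses (dF : distorted F V W) (irr : irrational (rotation_number F)).

(** Coboundaries integrate to 0 against a (-1)-measure, so its integral respects domination and is
    squeezed between mean_functional F u - e and mean_functional F u + e. Conversely, invariance is
    [mean_functional_transfer]. *)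
Lemma minus_one_measure_Rintegral (P : probability (measurableTypeR R) R) :
  minus_one_measure F P <-> P `[0, 1[%classic = 1%E /\
    forall u, cper u -> \int[P]_(x in `[0, 1[%classic) u x = mean_functional F u.
Proof.
split=> -[P01 H]; split=> //; last first.
  move=> phi cphi pphi; have cp : cper phi by split.
  by rewrite H// -(mean_functional_transfer dF irr cp) -H//; exact: (cper_transfer dF cp).
have mono u w : cper u -> cper w -> dominated F u w ->
    \int[P]_(x in `[0, 1[%classic) u x <= \int[P]_(x in `[0, 1[%classic) w x.
  move=> cu cw [h ch Hh].
  have cT := cper_transfer dF ch.
  have ci := cper_integrable P01.
  have <- : \int[P]_(x in `[0, 1[%classic) (w x + (h x - transfer F h x)) =
      \int[P]_(x in `[0, 1[%classic) w x.
    rewrite RintegralD//; [|exact: ci|by apply: ci; exact: cperB].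
    rewrite RintegralB//; [|exact: ci|exact: ci].
    by have [ch1 ch2] := ch; rewrite (H h)// subrr addr0.
  apply: le_Rintegral => //; first exact: ci.
  by apply: ci; apply: cperD => //; exact: cperB.
move=> u cu; apply/eqP; rewrite eq_le; apply/andP; split; apply/ler_addgt0Pr => e e0.
  rewrite -[leRHS](cst_Rintegral P01); apply: mono => //; first exact: cper_cst.
  exact: mean_functional_upper dF irr _ _ cu e0.
rewrite -lerBlDr -[leLHS](cst_Rintegral P01); apply: mono => //; first exact: cper_cst.
exact: mean_functional_lower dF irr _ _ cu e0.
Qed.

Lemma unique_minus_one_measure_exists : exists P : probability (measurableTypeR R) R,
  unique_minus_one_measure F P /\
  forall u, cper u -> \int[P]_(x in `[0, 1[%classic) u x = mean_functional F u.
Proof.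
have LD := @mean_functionalD _ _ _ _ dF irr.
have LZ := @mean_functionalZ _ _ _ _ dF irr.
have Lle := @mean_functional_le _ _ _ _ dF irr.
have L1 := @mean_functional_cst _ _ _ _ dF irr.
have [P [P01 HP]] := arc_content_measure LD LZ Lle L1.
exists P; split => //; split; first exact/minus_one_measure_Rintegral.
move=> nu /minus_one_measure_Rintegral[nu01 Hnu].
apply: circle_measure_unique => // x x01.
by rewrite !(@Rintegral_arc_content _ _ _ (mean_functional F)).
Qed.

End MinusOneMeasure.

(** * Families of circle maps *)

Lemma within_nbhsP (R : realType) (V : normedModType R) (H : set V) (x : V) (P : V -> Prop) :
  (\forall y \near within H (nbhs x), P y) <->
  exists2 d : R, 0 < d & forall y, H y -> `|y - x| < d -> P y.
Proof.
rewrite near_withinE; split.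
  move=> /nbhs_ballP[d d0 Hd]; exists d => // y Hy yx; apply: Hd => //.
  by rewrite -ball_normE /= distrC.
move=> [d d0 Hd]; apply/nbhs_ballP; exists d => // y; rewrite -ball_normE /= distrC => yx Hy.
exact: Hd.
Qed.

Section RowNorm.
Context {R : realType} (m : nat).
Implicit Types (u v : 'rV[R]_m).

Lemma row_norm_ge u j : `|u 0 j| <= `|u|.
Proof.
rewrite /Num.norm /= mx_normrE.
exact: (@le_bigmax _ _ _ _ (fun ij : 'I_1 * 'I_m => `|u ij.1 ij.2|) (0, j)).
Qed.

Lemma row_norm_le u (c : R) : 0 <= c -> (forall j, `|u 0 j| <= c) -> `|u| <= c.
Proof.
move=> c0 H; rewrite [`|u|]/Num.norm /= mx_normrE; apply: bigmax_le => // -[i j] _ /=.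
by rewrite (ord1 i).
Qed.

End RowNorm.

Section C3Norm.
Context {R : realType}.
Implicit Types (f g : R -> R).

(** Periodicity makes the i-th supremum a true bound; the other summands are nonnegative, [sup]
    being 0 when there is no supremum. *)
Lemma C3norm_ge f (i : 'I_4) : cper (derive1n i f) -> forall x, `|derive1n i f x| <= C3norm f.
Proof.
move=> ci x; rewrite /C3norm (bigD1 i)//=.
have [B B0 HB] := cper_bounded ci.
have h : `|derive1n i f x| <= sup (range (fun x => `|derive1n i f x|)).
  apply: ub_le_sup; last by exists x.
  by exists B => _ [y _ <-].
apply: (le_trans h); rewrite lerDl; apply: sumr_ge0 => j _.
have [[_ hub]|] := pselect (has_sup (range (fun x => `|derive1n j f x|))).
  by apply: le_trans (ub_le_sup hub _); last by exists 0; [|reflexivity].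
by move/sup_out => ->.
Qed.

Lemma C3norm_sup f : cper f -> forall x, `|f x| <= C3norm f.
Proof. exact: (C3norm_ge (i := 0)). Qed.

Lemma C3norm_sup_derive1 f : cper (derive1 f) -> forall x, `|derive1 f x| <= C3norm f.
Proof. exact: (C3norm_ge (i := 1)). Qed.

End C3Norm.

Lemma cper_finite_ucont (R : realType) (I : finType) (g : I -> R -> R) (e : R) :
  (forall i, cper (g i)) -> 0 < e ->
  exists2 d, 0 < d & forall i x y, `|x - y| <= d -> `|g i x - g i y| <= e.
Proof.
move=> cg e0; pose d i := projT1 (cid2 (cper_ucont (cg i) e0)).
have dP i : 0 < d i /\ forall x y, `|x - y| <= d i -> `|g i x - g i y| <= e.
  by rewrite /d; case: cid2.
exists (\big[Num.min/1]_i d i); first by apply: lt_bigmin => // i _; case: (dP i).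
move=> i x y xy; apply: (dP i).2; apply: le_trans xy _.
exact: bigmin_le_cond.
Qed.

Lemma cper_finite_bounded (R : realType) (I : finType) (g : I -> R -> R) :
  (forall i, cper (g i)) -> exists2 B, 0 < B & forall i x, `|g i x| <= B.
Proof.
move=> cg; pose b i := projT1 (cid2 (cper_bounded (cg i))).
have bP i : 0 < b i /\ forall x, `|g i x| <= b i by rewrite /b; case: cid2.
exists (1 + \sum_i b i).
  by rewrite ltr_pwDl//; apply: sumr_ge0 => i _; case: (bP i) => /ltW.
move=> i x; apply: le_trans ((bP i).2 x) _; rewrite (bigD1 i)//= addrCA lerDl.
by rewrite addr_ge0//; apply: sumr_ge0 => j _; case: (bP j) => /ltW.
Qed.

Section Combination.
Context {R : realType} (V : normedModType R) (I : finType) (g : I -> R -> R) (H : V -> R -> R)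
  (a : V -> I -> R).
Hypotheses (cg : forall j, cper (g j)) (aV : forall v j, `|a v j| <= `|v|)
  (HE : forall v x, H v x = \sum_j a v j * g j x).

Lemma combination_cper v : cper (H v).
Proof.
have -> : H v = fun x => \sum_j a v j * g j x by exact/funext.
by apply: cper_sum => j; exact: cperZ.
Qed.

(** Applied both to the velocities, with the coordinates of v as coefficients, and to the
    correctors, with their positive and negative parts: finitely many functions give bounds
    proportional to |v|, uniform in the direction. *)
Lemma combination_bounded : exists2 B, 0 < B & forall v x, `|H v x| <= B * `|v|.
Proof.
have [B B0 HB] := cper_finite_bounded cg.
exists (1 + B *+ #|I|); first by rewrite ltr_pwDl// mulrn_wge0// ltW.
move=> v x; rewrite HE; apply: le_trans (ler_norm_sum _ _ _) _.
apply: (@le_trans _ _ (\sum_(j : I) `|v| * B)).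
  by apply: ler_sum => j _; rewrite normrM ler_pM.
rewrite sumr_const -mulrnAr mulrC ler_wpM2r//; lra.
Qed.

Lemma combination_ucont (e : R) : 0 < e -> exists2 d, 0 < d &
  forall v x y, `|x - y| <= d -> `|H v x - H v y| <= e * `|v|.
Proof.
move=> e0; have e1 : 0 < e / #|I|.+1%:R by apply: divr_gt0.
have [d d0 Hd] := cper_finite_ucont cg e1; exists d => // v x y xy.
rewrite !HE -sumrB; apply: le_trans (ler_norm_sum _ _ _) _.
apply: (@le_trans _ _ (\sum_(j : I) `|v| * (e / #|I|.+1%:R))).
  by apply: ler_sum => j _; rewrite -mulrBr normrM ler_pM// Hd.
rewrite sumr_const -mulrnAr mulrC ler_wpM2r// -mulr_natr -mulrA ler_piMr//; first exact: ltW.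
by rewrite ler_pdivrMl// mulr1 ler_nat.
Qed.

End Combination.

Section Family.
Context {R : realType} (m : nat) (L : set 'rV[R]_m) (F : 'rV[R]_m -> R -> R)
  (DF : 'rV[R]_m -> 'rV[R]_m -> R -> R).
Hypothesis C1F : C1_family L F DF.
Hypothesis disF : forall l, L l -> exists V W, distorted (F l) V W.
Implicit Types (l v : 'rV[R]_m) (x y : R).

Lemma family_homeo l : L l -> circle_homeo (F l).
Proof. by move=> /disF[V [W dF]]; exact: distortion_homeo dF. Qed.

Lemma family_cper_derive1 l : L l -> cper (derive1 (F l)).
Proof. by move=> /disF[V [W dF]]; exact: cper_derive1 dF. Qed.

Lemma family_derivable l x : L l -> derivable (F l) x 1.
Proof. by move=> /disF[V [W dF]]; exact: (distortion_derivable dF). Qed.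

Lemma variation_derivable l v x : L l -> derivable (DF l v) x 1.
Proof. by case: C1F => _ H _ /H -/(_ v)[[d _] _]; exact: (d 0). Qed.

Lemma variation_cper l v : L l -> cper (DF l v).
Proof.
move=> Ll; split=> x; first by apply: derivable_continuous; exact: variation_derivable.
by case: C1F => _ H _; case: (H l v Ll).
Qed.

Lemma variation_cper_derive1 l v : L l -> cper (derive1 (DF l v)).
Proof.
move=> Ll; have [_ H _] := C1F; have [[d _] p] := H l v Ll; split=> x.
  by apply: derivable_continuous; exact: (d 1).
by apply: (@periodic_derive1 _ _ 0) => y; rewrite addr0.
Qed.

Lemma variation_linear l (a : R) u v x : L l -> DF l (a *: u + v) x = a * DF l u x + DF l v x.
Proof. by move=> Ll; have [_ _ [H _ _]] := C1F; rewrite (H l Ll a u v). Qed.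

Lemma variation_sum l v : L l -> DF l v = \sum_j v 0 j *: DF l 'e_j.
Proof.
move=> Ll.
have D0 : DF l 0 = 0.
  apply/funext => x; rewrite /= [RHS]/GRing.zero /=.
  by have := @variation_linear l 1 0 0 x Ll; rewrite scaler0 addr0; lra.
rewrite {1}(row_sum_delta v); apply: (big_rec2 (fun a b => DF l a = b)) => // j a b _ <-.
by apply/funext => x; rewrite variation_linear.
Qed.

Lemma variationE l v x : L l -> DF l v x = \sum_j v 0 j * DF l 'e_j x.
Proof. by move=> Ll; rewrite {1}variation_sum// fct_sumE. Qed.

Lemma variation_derive1E l v x : L l ->
  derive1 (DF l v) x = \sum_j v 0 j * derive1 (DF l 'e_j) x.
Proof.
move=> Ll; rewrite variation_sum// derive1E.
have H j : is_derive x 1 (v 0 j *: DF l 'e_j) (v 0 j *: derive1 (DF l 'e_j) x).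
  apply: is_deriveZ; rewrite derive1E; apply: derivableP; exact: variation_derivable.
by apply: derive_val; exact: is_derive_sum.
Qed.

Lemma variation_bounded l : L l -> exists2 B, 0 < B & forall v x, `|DF l v x| <= B * `|v|.
Proof.
move=> Ll; apply: (@combination_bounded _ _ _ (fun j => DF l 'e_j) _ (fun v j => v 0 j)).
- by move=> j; exact: variation_cper.
- by move=> v j; exact: row_norm_ge.
- by move=> v x; exact: variationE.
Qed.

Lemma variation_ucont l (e : R) : L l -> 0 < e -> exists2 d, 0 < d &
  forall v x y, `|x - y| <= d -> `|DF l v x - DF l v y| <= e * `|v|.
Proof.
move=> Ll; apply: (@combination_ucont _ _ _ (fun j => DF l 'e_j) _ (fun v j => v 0 j)).
- by move=> j; exact: variation_cper.
- by move=> v j; exact: row_norm_ge.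
- by move=> v x; exact: variationE.
Qed.

Lemma variation_derive1_bounded l : L l ->
  exists2 B, 0 < B & forall v x, `|derive1 (DF l v) x| <= B * `|v|.
Proof.
move=> Ll; apply: (@combination_bounded _ _ _ (fun j => derive1 (DF l 'e_j)) _ (fun v j => v 0 j)).
- by move=> j; exact: variation_cper_derive1.
- by move=> v j; exact: row_norm_ge.
- by move=> v x; exact: variation_derive1E.
Qed.

(** The C^3 norm of the remainder dominates the supremum of the remainder and of its derivative,
    once both are known to be continuous and periodic. *)
Lemma family_approx l (e : R) : L l -> 0 < e -> exists2 d, 0 < d &
  forall l', L l' -> `|l' - l| < d -> forall x,
    `|F l' x - F l x - DF l (l' - l) x| <= e * `|l' - l| /\
    `|derive1 (F l') x - derive1 (F l) x - derive1 (DF l (l' - l)) x| <= e * `|l' - l|.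
Proof.
move=> Ll e0; have [_ _ [_ H _]] := C1F.
have /within_nbhsP[d d0 Hd] := H l Ll e e0; exists d => // l' Ll' l'l x.
have := Hd l' Ll' l'l; set g := (X in C3norm X) => gN.
have dg y : is_derive y 1 g (derive1 (F l') y - derive1 (F l) y - derive1 (DF l (l' - l)) y).
  apply: is_deriveB; first apply: is_deriveB; rewrite derive1E; apply: derivableP.
  - exact: family_derivable.
  - exact: family_derivable.
  exact: variation_derivable.
have g'E : derive1 g = fun y => derive1 (F l') y - derive1 (F l) y - derive1 (DF l (l' - l)) y.
  by apply/funext => y; rewrite derive1E derive_val.
have cg : cper g.
  split=> y; first by apply: derivable_continuous; exact: ex_derive.
  have [[_ _ p] [_ _ p']] := (family_homeo Ll, family_homeo Ll').
  have [_ p''] := variation_cper (l' - l) Ll.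
  by rewrite /g /= !fctE p p' p''; ring.
have cg' : cper (derive1 g).
  rewrite g'E; apply: cperB; last exact: variation_cper_derive1.
  by apply: cperB; exact: family_cper_derive1.
split; first exact: le_trans (C3norm_sup cg x) gN.
by have := C3norm_sup_derive1 cg' x; rewrite g'E => h; exact: le_trans h gN.
Qed.

Lemma family_C1_cont l (e : R) : L l -> 0 < e -> exists2 d, 0 < d &
  forall l', L l' -> `|l' - l| < d -> forall x,
    `|F l' x - F l x| <= e /\ `|derive1 (F l') x - derive1 (F l) x| <= e.
Proof.
move=> Ll e0; have [d d0 Hd] := family_approx Ll ltr01.
have [B B0 HB] := variation_bounded Ll; have [B' B'0 HB'] := variation_derive1_bounded Ll.
have c0 : 0 < e / (1 + B + B') by apply: divr_gt0 => //; lra.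
exists (Num.min d (e / (1 + B + B'))); first by rewrite lt_min d0.
move=> l' Ll'; rewrite lt_min => /andP[l1 l2] x.
have [h1 h2] := Hd l' Ll' l1 x; have h3 := HB (l' - l) x; have h4 := HB' (l' - l) x.
have : `|l' - l| * (1 + B + B') <= e by rewrite -ler_pdivlMr ?ltW//; lra.
have n0 : 0 <= `|l' - l| by [].
have p1 : 0 <= B * `|l' - l| by rewrite mulr_ge0// ltW.
have p2 : 0 <= B' * `|l' - l| by rewrite mulr_ge0// ltW.
by move=> h5; split; move: h1 h2 h3 h4; rewrite !ler_norml; lra.
Qed.

Lemma variation_cont l (e : R) : L l -> 0 < e -> exists2 d, 0 < d &
  forall l', L l' -> `|l' - l| < d -> forall v x, `|DF l' v x - DF l v x| <= e * `|v|.
Proof.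
move=> Ll e0; have [_ _ [_ _ H]] := C1F.
have /within_nbhsP[d d0 Hd] := H l Ll e e0; exists d => // l' Ll' l'l v x.
apply: le_trans _ (Hd l' Ll' l'l v).
apply: (@C3norm_sup _ (DF l' v - DF l v)).
exact: (cperB (variation_cper v Ll') (variation_cper v Ll)).
Qed.

End Family.

(* The (-1)-measure average of the velocity field of the family in the direction v. *)
Definition mean_variation (R : realType) (m : nat) (F : 'rV[R]_m -> R -> R)
    (DF : 'rV[R]_m -> 'rV[R]_m -> R -> R) (l v : 'rV[R]_m) : R :=
  mean_functional (F l) (fun x => DF l v (inv_map (F l) x)).

(** * First-order perturbation of the rotation number *)

Section MeanVariation.
Context {R : realType} (m : nat) (L : set 'rV[R]_m) (F : 'rV[R]_m -> R -> R)
  (DF : 'rV[R]_m -> 'rV[R]_m -> R -> R).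
Hypothesis C1F : C1_family L F DF.
Hypothesis disF : forall l, L l -> exists V W, distorted (F l) V W.
Implicit Types (l v : 'rV[R]_m) (x y : R).
Local Notation lam := (mean_variation F DF).
Local Notation irr l := (irrational (rotation_number (F l))).

Lemma velocity_cper l v : L l -> cper (fun x => DF l v (inv_map (F l) x)).
Proof.
move=> Ll; apply: cper_comp; first exact: (variation_cper C1F).
exact/homeo_inv/(family_homeo disF).
Qed.

Lemma mean_variationD l (a : R) u v : L l -> irr l -> lam l (a *: u + v) = a * lam l u + lam l v.
Proof.
move=> Ll irrl; have [V [W dF]] := disF Ll; have cv w := velocity_cper w Ll.
rewrite -(mean_functionalZ dF irrl)// -(mean_functionalD dF irrl)//; last exact: cperZ.
by congr (mean_functional _ _); apply/funext => x; rewrite (variation_linear C1F).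
Qed.

Lemma mean_variationZ l (a : R) v : L l -> irr l -> lam l (a *: v) = a * lam l v.
Proof.
move=> Ll irrl; have h := mean_variationD 1 0 0 Ll irrl.
have := mean_variationD a v 0 Ll irrl; rewrite scaler0 !addr0 in h *; lra.
Qed.

Lemma mean_variationN l v : L l -> irr l -> lam l (- v) = - lam l v.
Proof. by move=> Ll irrl; rewrite -scaleN1r mean_variationZ// mulN1r. Qed.

Lemma mean_variation_sum l v : L l -> irr l -> lam l v = \sum_j v 0 j * lam l 'e_j.
Proof.
move=> Ll irrl; rewrite {1}(row_sum_delta v).
apply: (big_rec2 (fun a b => lam l a = b)) => [|j a b _ <-]; last exact: mean_variationD.
by rewrite -(scale0r 0) mean_variationZ// mul0r.
Qed.

Lemma mean_variation_bounded l : L l -> irr l -> exists2 B, 0 < B & forall v, `|lam l v| <= B * `|v|.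
Proof.
move=> Ll irrl; have [V [W dF]] := disF Ll; have [B B0 HB] := variation_bounded C1F Ll.
exists B => // v; have cv := velocity_cper v Ll.
have H (c : R) := mean_functional_cst dF irrl c.
apply/ler_normlP; split; last first.
  rewrite -[leRHS]H; apply: (mean_functional_le dF irrl) => // [|x]; first exact: cper_cst.
  by have /ler_normlP[] := HB v (inv_map (F l) x).
rewrite lerNl -[leLHS]H; apply: (mean_functional_le dF irrl) => // [|x]; first exact: cper_cst.
by rewrite lerNl; have /ler_normlP[] := HB v (inv_map (F l) x).
Qed.

(* Splitting the coordinates of v into positive and negative parts reduces to the 2 m vectors
   +- e_j, for which the one-sided estimate is that of mean_functional_lower. *)
Lemma corrector l (e : R) : L l -> irr l -> 0 < e ->
  exists H : 'rV[R]_m -> R -> R, [/\ forall v, cper (H v),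
    exists2 B, 0 < B & forall v x, `|H v x| <= B * `|v|,
    forall t, 0 < t -> exists2 d, 0 < d &
      forall v x y, `|x - y| <= d -> `|H v x - H v y| <= t * `|v| &
    forall v x, lam l v - e * `|v| <= DF l v x + H v (F l x) - derive1 (F l) x * H v x].
Proof.
move=> Ll irrl e0; have [V [W dF]] := disF Ll; have hF := family_homeo disF Ll.
pose I : finType := ('I_m * bool)%type; pose s (b : bool) : R := if b then 1 else -1.
pose a v (i : I) := Num.max (s i.2 * v 0 i.1) 0.
have aE v (phi : 'I_m -> R) : \sum_(i : I) a v i * (s i.2 * phi i.1) = \sum_j v 0 j * phi j.
  rewrite -(pair_bigA _ (fun j b => a v (j, b) * (s b * phi j)))/=.
  apply: eq_bigr => j _; rewrite big_bool /a /s /= mul1r mulN1r.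
  have /orP[v0|v0] := le_total 0 (v 0 j); first by rewrite max_l// max_r ?oppr_le0//; ring.
  by rewrite max_r// max_l ?oppr_ge0//; ring.
have a0 v i : 0 <= a v i by rewrite le_max lexx orbT.
have aV v i : `|a v i| <= `|v|.
  rewrite ger0_norm// ge_max normr_ge0 andbT; apply: le_trans (row_norm_ge v i.1).
  by rewrite /s; case: i.2; rewrite ?mul1r ?mulN1r ?ler_norm// -normrN ler_norm.
pose e' := e / #|I|.+1%:R; have e'0 : 0 < e' by apply: divr_gt0.
have [h Hh] : {h : I -> R -> R & forall i, cper (h i) /\ forall x,
    s i.2 * lam l 'e_(i.1) - e' <=
      s i.2 * DF l 'e_(i.1) x + h i (F l x) - derive1 (F l) x * h i x}.
  have ex (i : I) : {k : R -> R | cper k /\ forall x, s i.2 * lam l 'e_(i.1) - e' <=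
      s i.2 * DF l 'e_(i.1) x + k (F l x) - derive1 (F l) x * k x}.
    apply: cid; have cv := velocity_cper (s i.2 *: 'e_(i.1)) Ll.
    have [k ck Hk] := mean_functional_lower dF irrl cv e'0.
    exists k; split => // x; have := Hk (F l x).
    rewrite -/(lam l _) mean_variationZ// /transfer (inv_mapE hF).
    have := variation_linear C1F (s i.2) 'e_(i.1) 0 x Ll; have := variation_linear C1F 1 0 0 x Ll.
    by rewrite !scaler0 !addr0 /cst => ? -> ; lra.
  by exists (fun i => sval (ex i)) => i; case: (ex i).
have ch i : cper (h i) by case: (Hh i).
pose H v x := \sum_i a v i * h i x.
have HE v x : H v x = \sum_i a v i * h i x by [].
exists H; split.
- exact: (combination_cper ch HE).
- exact: (combination_bounded ch aV HE).
- by move=> t t0; exact: (combination_ucont ch aV HE t0).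
move=> v x; rewrite mean_variation_sum// (variationE C1F)//.
rewrite -(aE v (fun j => lam l 'e_j)) -(aE v (fun j => DF l 'e_j x)) /H.
rewrite mulr_sumr -big_split/= -sumrB.
apply: (@le_trans _ _ (\sum_i a v i * (s i.2 * lam l 'e_(i.1) - e'))).
  under [leRHS]eq_bigr do rewrite mulrBr.
  rewrite sumrB lerD2l lerN2 -mulr_suml.
  apply: (@le_trans _ _ (`|v| *+ #|I| * e')).
    rewrite ler_wpM2r ?(ltW e'0)// -sumr_const; apply: ler_sum => i _.
    by apply: le_trans (aV v i); exact: ler_norm.
  rewrite mulrnAl -mulrnAr mulrC ler_wpM2r// -mulr_natl /e' mulrCA.
  by rewrite ler_piMr ?(ltW e0)// ler_pdivrMr// mul1r ler_nat.
apply: ler_sum => i _; have [_ /(_ x) h1] := Hh i.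
by have := ler_wpM2l (a0 v i) h1; lra.
Qed.

(** For phi x = x - H v x with v = l' - l, the first-order part of F l' (phi x) - phi (F l x) is DF
    l v x + H v (F l x) - F'(x) H v x, at least lam l v - (e / 2) |v|. The approximation of the
    family, the linearisation of F and the shift of the velocity from phi x to x cost (e / 8) |v|
    each, so the difference stays nonnegative. *)
Lemma rotation_number_perturb_ge l (e : R) : L l -> irr l -> 0 < e -> exists2 d, 0 < d &
  forall l', L l' -> `|l' - l| < d -> e * `|l' - l| <= lam l (l' - l) ->
    rotation_number (F l) <= rotation_number (F l').
Proof.
move=> Ll irrl e0; have [V [W dF]] := disF Ll; have hF := family_homeo disF Ll.
have e2 : 0 < e / 2 by lra.
have [H [cH [B B0 HB] _ HH]] := corrector Ll irrl e2.
have e8 : 0 < e / 8 by lra.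
have eB : 0 < e / (8 * B) by rewrite divr_gt0// mulr_gt0.
have [d1 d10 H1] := family_approx C1F disF Ll e8.
have [d2 d20 H2] := unif_derive dF eB.
have [d3 d30 H3] := variation_ucont C1F Ll e8.
exists (Num.min d1 (Num.min d2 d3 / B)).
  by rewrite lt_min d10 divr_gt0// lt_min d20.
move=> l' Ll'; rewrite lt_min => /andP[l1]; rewrite ltr_pdivlMr// lt_min => /andP[l2 l3] lamE.
set v := l' - l in l1 l2 l3 lamE *; have hF' := family_homeo disF Ll'.
apply: (@rotation_number_semiconj _ _ _ hF hF' (fun x => x - H v x) (B * `|v|)) => x.
  by rewrite addrAC subrr add0r normrN.
have h0 := HB v x; have s2 : `|- H v x| <= d2 by rewrite normrN; lra.
have s3 : `|(x - H v x) - x| <= d3 by rewrite addrAC subrr add0r normrN; lra.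
have [h1 _] := H1 l' Ll' l1 (x - H v x); have h2 := H2 x _ s2; have h3 := H3 v _ _ s3.
have h4 := HH v x.
have h5 : e / (8 * B) * `|- H v x| <= e / 8 * `|v|.
  rewrite normrN; apply: le_trans (ler_wpM2l (ltW eB) h0) _.
  by rewrite le_eqVlt; apply/orP; left; apply/eqP; field; rewrite gt_eqF.
have en : 0 <= e * `|v| by rewrite mulr_ge0// ltW.
move: h1 h3 (le_trans h2 h5) h4 lamE en; rewrite -/v !ler_norml mulrN.
move: (derive1 (F l) x * H v x) (`|v|) => c n /andP[h1 _] /andP[h3 _] /andP[h7 _] h4 h6 en; lra.
Qed.

(** Correctors give lower bounds only, so the upper bound for the direction v uses the corrector of
    - v. *)
Lemma rotation_number_perturb_le l (e : R) : L l -> irr l -> 0 < e -> exists2 d, 0 < d &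
  forall l', L l' -> `|l' - l| < d -> lam l (l' - l) <= - (e * `|l' - l|) ->
    rotation_number (F l') <= rotation_number (F l).
Proof.
move=> Ll irrl e0; have [V [W dF]] := disF Ll; have hF := family_homeo disF Ll.
have e2 : 0 < e / 2 by lra.
have [H [cH [B B0 HB] _ HH]] := corrector Ll irrl e2.
have e8 : 0 < e / 8 by lra.
have eB : 0 < e / (8 * B) by rewrite divr_gt0// mulr_gt0.
have [d1 d10 H1] := family_approx C1F disF Ll e8.
have [d2 d20 H2] := unif_derive dF eB.
have [d3 d30 H3] := variation_ucont C1F Ll e8.
exists (Num.min d1 (Num.min d2 d3 / B)).
  by rewrite lt_min d10 divr_gt0// lt_min d20.
move=> l' Ll'; rewrite lt_min => /andP[l1]; rewrite ltr_pdivlMr// lt_min => /andP[l2 l3] lamE.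
set v := l' - l in l1 l2 l3 lamE *; have hF' := family_homeo disF Ll'.
have HBN x : `|H (- v) x| <= B * `|v| by have := HB (- v) x; rewrite normrN.
apply: (@rotation_number_semiconj_ge _ _ _ hF hF' (fun x => x + H (- v) x) (B * `|v|)) => x.
  by rewrite addrAC subrr add0r.
have h0 := HBN x; have s2 : `|H (- v) x| <= d2 by lra.
have s3 : `|(x + H (- v) x) - x| <= d3 by rewrite addrAC subrr add0r; lra.
have [h1 _] := H1 l' Ll' l1 (x + H (- v) x); have h2 := H2 x _ s2; have h3 := H3 v _ _ s3.
have h4 := HH (- v) x; rewrite normrN mean_variationN// in h4.
have vN : DF l (- v) x = - DF l v x.
  have := variation_linear C1F (-1) v 0 x Ll; have := variation_linear C1F 1 0 0 x Ll.
  by rewrite !scaler0 !addr0 scaleN1r => ? ->; lra.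
have h5 : e / (8 * B) * `|H (- v) x| <= e / 8 * `|v|.
  apply: le_trans (ler_wpM2l (ltW eB) h0) _.
  by rewrite le_eqVlt; apply/orP; left; apply/eqP; field; rewrite gt_eqF.
have en : 0 <= e * `|v| by rewrite mulr_ge0// ltW.
move: h1 h3 (le_trans h2 h5) h4 lamE en; rewrite -/v !ler_norml vN.
move: (derive1 (F l) x * H (- v) x) (`|v|) => c n /andP[_ h1] /andP[_ h3] /andP[_ h7] h4 h6 en; lra.
Qed.

(** The correctors chosen at l, with bounds proportional to |v|, still prove a lower bound at a
    nearby l', where the map, its derivative and the velocity have changed little. As lam is odd in
    v, this semicontinuity already yields continuity. *)
Lemma mean_variation_lower l (e : R) : L l -> irr l -> 0 < e -> exists2 d, 0 < d &
  forall l', L l' -> irr l' -> `|l' - l| < d -> forall v, lam l v - e * `|v| <= lam l' v.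
Proof.
move=> Ll irrl e0; have [V [W dF]] := disF Ll; have hF := family_homeo disF Ll.
have e4 : 0 < e / 4 by lra.
have [H [cH [B B0 HB] HU HH]] := corrector Ll irrl e4.
have [d1 d10 H1] := HU _ e4.
have eB : 0 < Num.min d1 (e / (4 * B)) by rewrite lt_min d10 divr_gt0// mulr_gt0.
have [d2 d20 H2] := family_C1_cont C1F disF Ll eB.
have [d3 d30 H3] := variation_cont C1F Ll e4.
exists (Num.min d2 d3); first by rewrite lt_min d20.
move=> l' Ll' irrl'; rewrite lt_min => /andP[l2 l3] v.
have [V' [W' dF']] := disF Ll'; have hF' := family_homeo disF Ll'.
have cv := velocity_cper v Ll'.
apply: (mean_functional_ub dF' irrl' cv); exists (H v); first exact: cH.
move=> x; rewrite /transfer /cst; set y := inv_map (F l') x.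
have -> : x = F l' y by rewrite (inv_mapK hF').
have [h1 h2] := H2 l' Ll' l2 y; have h3 := H3 l' Ll' l3 v y.
have h4 : `|H v (F l' y) - H v (F l y)| <= e / 4 * `|v|.
  by apply: H1; apply: le_trans h1 _; rewrite ge_min lexx.
have h5 : `|(derive1 (F l') y - derive1 (F l) y) * H v y| <= e / 4 * `|v|.
  rewrite normrM; apply: le_trans (_ : e / (4 * B) * (B * `|v|) <= _).
    by apply: ler_pM => //; apply: le_trans h2 _; rewrite ge_min lexx orbT.
  by rewrite le_eqVlt; apply/orP; left; apply/eqP; field; rewrite gt_eqF.
have h6 := HH v y.
have en : 0 <= e * `|v| by rewrite mulr_ge0// ltW.
move: h3 h4 h5 h6 en; rewrite !ler_norml mulrBl.
move: (derive1 (F l') y * H v y) (derive1 (F l) y * H v y) (`|v|) => c c' n.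
by move=> /andP[h3 _] /andP[h4 _] /andP[_ h5] h6 en; lra.
Qed.

Lemma mean_variation_cont l (e : R) : L l -> irr l -> 0 < e -> exists2 d, 0 < d &
  forall l', L l' -> irr l' -> `|l' - l| < d -> forall v, `|lam l' v - lam l v| <= e * `|v|.
Proof.
move=> Ll irrl e0; have [d d0 Hd] := mean_variation_lower Ll irrl e0.
exists d => // l' Ll' irrl' l'l v.
have := Hd l' Ll' irrl' l'l v; have := Hd l' Ll' irrl' l'l (- v).
by rewrite !mean_variationN// normrN ler_distl => ? ?; apply/andP; split; lra.
Qed.

End MeanVariation.

(** * The tongue *)

Lemma irrationalD_int (R : realType) (a : R) (k : int) : irrational a -> irrational (a + k%:~R).
Proof.
move=> irr [q _ qE]; apply: irr; exists (q - k%:~R) => //.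
by rewrite rmorphB /= ratr_int qE addrK.
Qed.

Lemma eps_is_derive (R : realType) (f : R -> R) (x df : R) :
  (forall e, 0 < e -> exists2 d, 0 < d &
    forall h, `|h| < d -> `|f (x + h) - f x - df * h| <= e * `|h|) -> is_derive x 1 f df.
Proof.
move=> H; have cvg : h^-1 *: ((f \o shift x) (h *: 1) - f x) @[h --> 0^'] --> df.
  apply/cvgrPdist_le => e e0; have [d d0 Hd] := H e e0.
  near=> h; have h0 : h != 0 by near: h; exact: nbhs_dnbhs_neq.
  have hd : `|h| < d by near: h; exact: dnbhs0_lt.
  have -> : df - h^-1 *: ((f \o shift x) (h *: 1) - f x) = - ((f (x + h) - f x - df * h) / h).
    by rewrite /GRing.scale /= mulr1 (addrC h); field.
  by rewrite normrN normrM normfV ler_pdivrMr ?normr_gt0//; exact: Hd.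
split; first by apply/cvg_ex; exists df.
exact: cvg_lim cvg.
Unshelve. all: by end_near. Qed.

Section Param.
Context {R : realType} (n : nat).
Implicit Types (s w : 'rV[R]_n.+1) (t : R).

Lemma paramE t s (j : 'I_(1 + n.+1)) :
  param t s 0 j = match fintype.split j with inl _ => t | inr i => s 0 i end.
Proof. by rewrite /param mxE; case: fintype.split => // i; rewrite (ord1 i) mxE eqxx mulr1n. Qed.

Lemma paramZ (a t : R) s : a *: param t s = param (a * t) (a *: s).
Proof.
apply/rowP => j; rewrite [LHS]mxE !paramE.
by case: fintype.split => // i; rewrite !mxE.
Qed.

Lemma paramD t t' s s' : param t s + param t' s' = param (t + t') (s + s').
Proof.
apply/rowP => j; rewrite [LHS]mxE !paramE.
by case: fintype.split => // i; rewrite !mxE.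
Qed.

Lemma paramB t t' s s' : param t s - param t' s' = param (t - t') (s - s').
Proof. by rewrite -scaleN1r paramZ paramD mulN1r scaleN1r. Qed.

Lemma param01 t s : param t s 0 1 = s 0 0.
Proof.
rewrite paramE (_ : (1 : 'I_(1 + n.+1)) = rshift 1 0); last exact: val_inj.
by rewrite -[rshift _ _]/(unsplit (inr _)) unsplitK.
Qed.

Lemma param_norm_le t s (c : R) : `|t| <= c -> `|s| <= c -> `|param t s| <= c.
Proof.
move=> tc sc; apply: row_norm_le => [|j]; first exact: le_trans tc.
by rewrite paramE; case: fintype.split => // i; exact: le_trans (row_norm_ge s i) sc.
Qed.

End Param.

Section Tongue.
Context {R : realType} (n : nat) (Om : set 'rV[R]_n.+2) (F : 'rV[R]_n.+2 -> R -> R)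
  (DF : 'rV[R]_n.+2 -> 'rV[R]_n.+2 -> R -> R).
Local Notation L := (Om `&` @half_space R n).
Hypotheses (openOm : open Om) (convexOm : convex_set Om) (C1F : C1_family L F DF)
  (monoF : forall l, L l -> forall x, 0 < DF l (param 1 0) x)
  (disF : forall l, L l -> exists V W, distorted (F l) V W).
Implicit Types (s w : 'rV[R]_n.+1) (t : R).
Local Notation rho t s := (rotation_number (F (param t s))).

Lemma half_space_param t s : half_space (param t s) <-> half_space' s.
Proof. by rewrite /half_space /half_space' /= param01. Qed.

(** Convexity of Om keeps the segment between two points of a fibre in the domain, so that
    monotonicity in lambda_1 applies along it and each irrational value is taken at most once per
    fibre. *)
Lemma fibre_convex t1 t2 t s : L (param t1 s) -> L (param t2 s) -> t1 <= t <= t2 -> L (param t s).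
Proof.
move=> [U1 h1] [U2 h2] /andP[t1t tt2]; split; last exact/half_space_param/(half_space_param t1).
have [t12|t12] := eqVneq t1 t2; first by rewrite (_ : t = t1)//; lra.
have d0 : 0 < t2 - t1 by rewrite subr_gt0 lt_neqAle t12; lra.
have p0 : 0 <= (t2 - t) / (t2 - t1) by rewrite divr_ge0; lra.
have p1 : (t2 - t) / (t2 - t1) <= 1 by rewrite ler_pdivrMr// mul1r; lra.
have := convexOm (Itv01 p0 p1) (mem_set U1) (mem_set U2); move/set_mem.
congr (Om _); rewrite /conv /= !paramZ paramD -scalerDl unstable.add_onemK scale1r.
by congr param; rewrite /unstable.onem; field; rewrite gt_eqF.
Qed.

Lemma fibre_is_derive t s x : L (param t s) ->
  is_derive t 1 (fun t => F (param t s) x) (DF (param t s) (param 1 0) x).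
Proof.
move=> Ll; apply: eps_is_derive => e e0; have [Ol hl] := Ll.
have [d d0 Hd] := family_approx C1F disF Ll e0.
have /nbhs_ballP[r r0 Hr] : nbhs (param t s) Om by exact: open_nbhs_nbhs.
exists (Num.min d r) => [|h]; first by rewrite lt_min d0.
rewrite lt_min => /andP[hd hr].
have hE : param (t + h) s - param t s = h *: param 1 0.
  by rewrite paramB paramZ mulr1 scaler0 subrr addrAC subrr add0r.
have hN : `|h *: (param 1 0 : 'rV[R]_n.+2)| <= `|h|.
  by rewrite paramZ mulr1 scaler0; apply: param_norm_le => //; rewrite normr0.
have Ll' : L (param (t + h) s).
  split; last exact/half_space_param/(half_space_param t).
  apply: Hr; rewrite -ball_normE /= -normrN opprB hE; exact: le_lt_trans hr.
have [] := Hd _ Ll' _ x; first by rewrite hE; exact: le_lt_trans hd.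
rewrite hE => h1 _.
suff D : DF (param t s) (h *: param 1 0) x = DF (param t s) (param 1 0) x * h.
  by rewrite D in h1; apply: le_trans h1 _; rewrite ler_wpM2l// ltW.
have := variation_linear C1F h (param 1 0) 0 x Ll; have := variation_linear C1F 1 0 0 x Ll.
by rewrite !scaler0 !addr0 => ? ->; rewrite mulrC; lra.
Qed.

(** The pointwise increment is periodic, continuous and positive; its minimum is the uniform e that
    strict monotonicity of the rotation number asks for. *)
Lemma fibre_gap t1 t2 s : L (param t1 s) -> L (param t2 s) -> t1 < t2 ->
  exists2 e, 0 < e & forall x, F (param t1 s) x + e <= F (param t2 s) x.
Proof.
move=> L1 L2 t12; pose g x := F (param t2 s) x - F (param t1 s) x.
have cg : cper g.
  have [[c1 _ p1] [c2 _ p2]] := (family_homeo disF L1, family_homeo disF L2).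
  split=> x; last by rewrite /g p1 p2; ring.
  by apply: cvgB; [exact: c2|exact: c1].
have g0 x : 0 < g x.
  have [|c /andP[c1 c2] E] := @is_derive_MVT R (fun t => F (param t s) x)
      (fun t => DF (param t s) (param 1 0) x) t1 t2 (ltW t12).
    by move=> t t12'; apply: fibre_is_derive; exact: fibre_convex L1 L2 t12'.
  rewrite /g E mulr_gt0 ?subr_gt0//; apply: monoF; apply: fibre_convex L1 L2 _.
  by rewrite c1 c2.
have [z Hz] := cper_min cg; exists (g z); first exact: g0.
by move=> x; have := Hz x; rewrite {2}/g; lra.
Qed.

Lemma fibre_rotation_number_gt t1 t2 s : L (param t1 s) -> L (param t2 s) -> t1 < t2 ->
  irrational (rho t1 s) -> rho t1 s < rho t2 s.
Proof.
move=> L1 L2 t12 irr; have [e e0 He] := fibre_gap L1 L2 t12; have [V [W dF]] := disF L1.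
exact: (rotation_number_strict_gt dF irr (family_homeo disF L2) e0 He).
Qed.

Lemma fibre_rotation_number_lt t1 t2 s : L (param t1 s) -> L (param t2 s) -> t1 < t2 ->
  irrational (rho t2 s) -> rho t1 s < rho t2 s.
Proof.
move=> L1 L2 t12 irr; have [e e0 He] := fibre_gap L1 L2 t12; have [V [W dF]] := disF L2.
apply: (rotation_number_strict_lt dF irr (family_homeo disF L1) e0) => x.
by have := He x; lra.
Qed.

Lemma family_rotation_number_cont l (e : R) : L l -> 0 < e -> exists2 d, 0 < d &
  forall l', L l' -> `|l' - l| < d -> `|rotation_number (F l') - rotation_number (F l)| <= e.
Proof.
move=> Ll e0; have [d d0 Hd] := rotation_number_continuous (family_homeo disF Ll) e0.
have [d' d'0 Hd'] := family_C1_cont C1F disF Ll d0; exists d' => // l' Ll' l'l.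
rewrite distrC; apply: Hd; first exact: (family_homeo disF).
by move=> y; rewrite distrC; case: (Hd' l' Ll' l'l y).
Qed.

End Tongue.

Definition tongue_set (R : realType) (n : nat) (L : set 'rV[R]_n.+2) (F : 'rV[R]_n.+2 -> R -> R)
    (beta : R) : set 'rV[R]_n.+1 :=
  [set s | exists t, L (param t s) /\ rotation_number (F (param t s)) = beta].

Definition tongue_fun (R : realType) (n : nat) (L : set 'rV[R]_n.+2) (F : 'rV[R]_n.+2 -> R -> R)
    (beta : R) (s : 'rV[R]_n.+1) : R :=
  xget 0 [set t | L (param t s) /\ rotation_number (F (param t s)) = beta].

(** The slope of the hyperplane [mean_variation F DF l v = 0], solved for the first coordinate of
    v. *)
Definition tongue_slope (R : realType) (n : nat) (F : 'rV[R]_n.+2 -> R -> R)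
    (DF : 'rV[R]_n.+2 -> 'rV[R]_n.+2 -> R -> R) (l : 'rV[R]_n.+2) (w : 'rV[R]_n.+1) : R :=
  - mean_variation F DF l (param 0 w) / mean_variation F DF l (param 1 0).

Section TongueFunction.
Context {R : realType} (n : nat) (Om : set 'rV[R]_n.+2) (F : 'rV[R]_n.+2 -> R -> R)
  (DF : 'rV[R]_n.+2 -> 'rV[R]_n.+2 -> R -> R).
Local Notation L := (Om `&` @half_space R n).
Hypotheses (openOm : open Om) (convexOm : convex_set Om) (C1F : C1_family L F DF)
  (monoF : forall l, L l -> forall x, 0 < DF l (param 1 0) x)
  (disF : forall l, L l -> exists V W, distorted (F l) V W).
Context (beta : R).
Hypothesis irr : irrational beta.
Implicit Types (s w : 'rV[R]_n.+1) (t : R).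
Local Notation rho t s := (rotation_number (F (param t s))).
Local Notation A := (tongue_set L F beta).
Local Notation a := (tongue_fun L F beta).
Local Notation l_ s := (param (a s) s).
Local Notation lam := (mean_variation F DF).
Local Notation Da s := (tongue_slope F DF (l_ s)).

Lemma tongue_funP s : A s -> L (l_ s) /\ rho (a s) s = beta.
Proof. by move=> As; exact: (xgetPex (0 : R) As). Qed.

Lemma tongue_fun_irr s : A s -> irrational (rho (a s) s).
Proof. by move=> /tongue_funP[_ ->]. Qed.

Lemma tongue_fun_le t s : A s -> L (param t s) -> beta <= rho t s -> a s <= t.
Proof.
move=> As Lt; have [La raE] := tongue_funP As.
move=> le; rewrite leNgt; apply/negP => ta; have irra := tongue_fun_irr As.
have := fibre_rotation_number_lt openOm convexOm C1F monoF disF Lt La ta irra.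
by rewrite raE; lra.
Qed.

Lemma tongue_fun_ge t s : A s -> L (param t s) -> rho t s <= beta -> t <= a s.
Proof.
move=> As Lt; have [La raE] := tongue_funP As.
move=> le; rewrite leNgt; apply/negP => ta; have irra := tongue_fun_irr As.
have := fibre_rotation_number_gt openOm convexOm C1F monoF disF La Lt ta irra.
by rewrite raE; lra.
Qed.

Lemma tongue_fun_eq t s : L (param t s) -> rho t s = beta -> a s = t.
Proof.
move=> Lt rE; have As : A s by exists t.
by apply/le_anti/andP; split; [apply: tongue_fun_le|apply: tongue_fun_ge] => //; rewrite rE.
Qed.

Lemma param_Om_ball t s : Om (param t s) -> exists2 r, 0 < r &
  forall t' s', half_space' s' -> `|t' - t| < r -> `|s' - s| < r -> L (param t' s').
Proof.
move=> Ol; have /nbhs_ballP[r r0 Hr] : nbhs (param t s) Om by exact: open_nbhs_nbhs.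
exists r => // t' s' hs' tr sr; split; last exact/half_space_param.
apply: Hr; rewrite -ball_normE /= distrC paramB.
apply: (@le_lt_trans _ _ (Num.max `|t' - t| `|s' - s|)); last by rewrite gt_max tr.
by apply: param_norm_le; rewrite le_max lexx ?orbT.
Qed.

Lemma fibre_rotation_number_continuous t s : L (param t s) -> {for t, continuous (fun t => rho t s)}.
Proof.
move=> Lt; have [Ot /half_space_param ht] := Lt; apply/eps_continuousP => e e0.
have e2 : 0 < e / 2 by lra.
have [d d0 Hd] := family_rotation_number_cont C1F disF Lt e2.
have [r r0 Hr] := param_Om_ball Ot; exists (Num.min d r); first by rewrite lt_min d0.
move=> t'; rewrite lt_min distrC => /andP[td tr]; rewrite distrC.
apply: (@le_lt_trans _ _ (e / 2)); last by lra.
apply: Hd; first by apply: Hr; rewrite ?subrr ?normr0.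
rewrite paramB subrr; apply: le_lt_trans td; apply: param_norm_le => //.
by rewrite normr0.
Qed.

(** The rotation numbers at a s0 - d and a s0 + d lie strictly on either side of beta. This persists
    for nearby s, and the intermediate value theorem then gives a point of the tongue in between;
    hence also the relative openness of A. *)
Lemma tongue_fun_cont s0 (e : R) : A s0 -> 0 < e -> exists2 d, 0 < d &
  forall s, half_space' s -> `|s - s0| < d -> A s /\ `|a s - a s0| <= e.
Proof.
move=> As e0; have [L0 r0E] := tongue_funP As; have [U0 /half_space_param h0] := L0.
have irr0 := tongue_fun_irr As.
have [r r0 Hr] := param_Om_ball U0.
pose d := Num.min e (r / 2); have d0 : 0 < d by rewrite lt_min e0; lra.
have [de dr] : d <= e /\ d < r by rewrite /d minEle; case: ifPn; rewrite -?ltNge; lra.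
have Lp : L (param (a s0 + d) s0).
  by apply: Hr => //; rewrite ?subrr ?normr0// addrAC subrr add0r gtr0_norm.
have Lm : L (param (a s0 - d) s0).
  by apply: Hr => //; rewrite ?subrr ?normr0// addrAC subrr add0r normrN gtr0_norm.
have rp : beta < rho (a s0 + d) s0.
  have lt : a s0 < a s0 + d by lra.
  by have := fibre_rotation_number_gt openOm convexOm C1F monoF disF L0 Lp lt irr0; rewrite r0E.
have rm : rho (a s0 - d) s0 < beta.
  have lt : a s0 - d < a s0 by lra.
  by have := fibre_rotation_number_lt openOm convexOm C1F monoF disF Lm L0 lt irr0; rewrite r0E.
have ep : 0 < rho (a s0 + d) s0 - beta by lra.
have em : 0 < beta - rho (a s0 - d) s0 by lra.
have [dp dp0 Hp] := family_rotation_number_cont C1F disF Lp ep.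
have [dm dm0 Hm] := family_rotation_number_cont C1F disF Lm em.
exists (Num.min r (Num.min dp dm)); first by rewrite !lt_min r0 dp0.
move=> s hs; rewrite !lt_min => /and3P[sr sp sm].
have Ls t : a s0 - d <= t <= a s0 + d -> L (param t s).
  by move=> ts; apply: Hr => //; rewrite ltr_distl; lra.
have nrm t : `|param t s - param t s0| <= `|s - s0|.
  by rewrite paramB subrr; apply: param_norm_le; rewrite ?normr0.
have tp : a s0 - d <= a s0 + d <= a s0 + d by lra.
have tm : a s0 - d <= a s0 - d <= a s0 + d by lra.
have := Hp _ (Ls _ tp) (le_lt_trans (nrm _) sp); rewrite ler_distl => /andP[hp _].
have := Hm _ (Ls _ tm) (le_lt_trans (nrm _) sm); rewrite ler_distl => /andP[_ hm].
have [|||t] := @IVT R (fun t => rho t s) (a s0 - d) (a s0 + d) beta.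
- lra.
- apply: continuous_in_subspaceT => t; rewrite inE /= in_itv /= => ts.
  exact/fibre_rotation_number_continuous/Ls.
- rewrite ge_min le_max; apply/andP; split; apply/orP; [left|right].
    by move: hm; move: (rho _ s) => x; lra.
  by move: hp; move: (rho _ s) => x; lra.
rewrite in_itv /= => ts tE; rewrite (tongue_fun_eq (Ls _ ts) tE); split.
  by exists t; split => //; exact: Ls.
by rewrite ler_distl; lra.
Qed.

Lemma mean_variation_monotone_gt0 l : L l -> irrational (rotation_number (F l)) ->
  0 < lam l (param 1 0).
Proof.
move=> Ll irrl; have [V [W dF]] := disF Ll.
apply: (mean_functional_gt0 dF irrl); first exact: (velocity_cper C1F disF).
by move=> x; exact: monoF.
Qed.

Lemma tongue_slope_linear s : A s -> linear (Da s : _ -> R^o).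
Proof.
move=> As; have [Ll _] := tongue_funP As; have irrl := tongue_fun_irr As => k u v.
rewrite /tongue_slope (_ : param 0 (k *: u + v) = k *: param 0 u + param 0 v).
  by rewrite (mean_variationD C1F disF)// opprD mulrDl -mulrN -mulrA.
by rewrite paramZ paramD mulr0 addr0.
Qed.

(** The vector (Da s w, w) is in the kernel of lam, so only the offset c in lambda_1 contributes. *)
Lemma tongue_slopeE s w (c : R) : A s ->
  lam (l_ s) (param (Da s w + c) w) = c * lam (l_ s) (param 1 0).
Proof.
move=> As; have [Ll _] := tongue_funP As; have irrl := tongue_fun_irr As.
have D0 := mean_variation_monotone_gt0 Ll irrl.
have -> : param (Da s w + c) w = (Da s w + c) *: param 1 0 + param 0 w.
  by rewrite paramZ paramD scaler0 mulr1 addr0 add0r.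
rewrite (mean_variationD C1F disF)// /tongue_slope mulrDl -mulrA mulVf ?gt_eqF// mulr1.
ring.
Qed.

Lemma tongue_slope_bounded s : A s -> exists2 B, 0 < B & forall w, `|Da s w| <= B * `|w|.
Proof.
move=> As; have [Ll _] := tongue_funP As; have irrl := tongue_fun_irr As.
have D0 := mean_variation_monotone_gt0 Ll irrl.
have [B B0 HB] := mean_variation_bounded C1F disF Ll irrl.
exists (B / lam (l_ s) (param 1 0)); first exact: divr_gt0.
move=> w; rewrite normrM normrN normfV (gtr0_norm D0) mulrAC ler_wpM2r ?invr_ge0 ?(ltW D0)//.
apply: le_trans (HB _) _; rewrite ler_wpM2l ?(ltW B0)//.
by apply: param_norm_le; rewrite ?normr0.
Qed.

(** Points of the tangent hyperplane shifted by e |w| up or down in lambda_1 have mean variation e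
    |w| D or its opposite, comparable with their distance to the base point. The perturbation lemmas
    place them on the two sides of the tongue, and a s lies between them. *)
Lemma tongue_fun_diff s0 (e : R) : A s0 -> 0 < e -> exists2 d, 0 < d &
  forall s, A s -> `|s - s0| < d -> `|a s - a s0 - Da s0 (s - s0)| <= e * `|s - s0|.
Proof.
move=> As0 e0; have [L0 r0E] := tongue_funP As0; have [U0 /half_space_param h0] := L0.
have irr0 := tongue_fun_irr As0; have D0 := mean_variation_monotone_gt0 L0 irr0.
have [B B0 HB] := tongue_slope_bounded As0; have [r r0 Hr] := param_Om_ball U0.
(* C |w| bounds the displacement (Da s0 w + c, w) for |c| <= e |w|, and e' C = e D makes the mean
   variation meet the threshold of the perturbation lemmas. *)
pose C := B + e + 1; have C0 : 0 < C by rewrite /C; lra.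
pose D := lam (l_ s0) (param 1 0); pose e' := e * D / C.
have e'0 : 0 < e' by rewrite divr_gt0// mulr_gt0.
have [d1 d10 H1] := rotation_number_perturb_ge C1F disF L0 irr0 e'0.
have [d2 d20 H2] := rotation_number_perturb_le C1F disF L0 irr0 e'0.
exists (Num.min r (Num.min d1 d2) / C); first by rewrite divr_gt0// !lt_min r0 d10.
move=> s As; rewrite ltr_pdivlMr// !lt_min => /and3P[sr s1 s2].
have [[_ /half_space_param hs] _] := tongue_funP As.
set w := s - s0; have hB := HB w.
have n0 : 0 <= `|w| by [].
have H (c : R) : `|c| <= e * `|w| -> [/\ L (param (a s0 + Da s0 w + c) s),
    param (a s0 + Da s0 w + c) s - l_ s0 = param (Da s0 w + c) w &
    `|param (Da s0 w + c) w| <= `|w| * C].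
  move=> hc; have ht : `|Da s0 w + c| <= `|w| * C.
    by apply: le_trans (ler_normD _ _) _; rewrite /C; lra.
  split.
  - apply: Hr => //; last by apply: le_lt_trans sr; rewrite ler_peMr// /C; lra.
    by apply: le_lt_trans sr; rewrite (_ : _ - _ = Da s0 w + c)//; ring.
  - by rewrite paramB; congr param; ring.
  by apply: param_norm_le => //; rewrite ler_peMr// /C; lra.
have ne : `|(e * `|w|)| <= e * `|w| by rewrite ger0_norm// mulr_ge0// ltW.
have e'E : e' * (`|w| * C) = e * `|w| * D by rewrite /e'; field; rewrite gt_eqF.
have [Lp Ep Np] := H (e * `|w|) ne.
have hp : a s <= a s0 + Da s0 w + e * `|w|.
  apply: tongue_fun_le => //; apply: le_trans (H1 _ Lp _ _); first by rewrite r0E.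
    by rewrite Ep; exact: le_lt_trans Np s1.
  by rewrite Ep tongue_slopeE// -/D -e'E ler_wpM2l// ltW.
have ne' : `|- (e * `|w|)| <= e * `|w| by rewrite normrN.
have [Lm Em Nm] := H _ ne'.
have hm : a s0 + Da s0 w - e * `|w| <= a s.
  apply: tongue_fun_ge => //; apply: (le_trans (H2 _ Lm _ _)); last by rewrite r0E.
    by rewrite Em; exact: le_lt_trans Nm s2.
  by rewrite Em tongue_slopeE// mulNr lerN2 -/D -e'E ler_wpM2l// ltW.
by rewrite ler_norml; lra.
Qed.

(** The vector (Da s0 w, w) lies in the kernel of lam at s0, while at s its mean variation is Da s0
    w - Da s w times that of (1, 0). Continuity of lam makes this small. *)
Lemma tongue_slope_cont s0 (e : R) : A s0 -> 0 < e -> exists2 d, 0 < d &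
  forall s, A s -> `|s - s0| < d -> forall w, `|Da s w - Da s0 w| <= e * `|w|.
Proof.
move=> As0 e0; have [L0 _] := tongue_funP As0; have irr0 := tongue_fun_irr As0.
have D0 := mean_variation_monotone_gt0 L0 irr0.
have [B B0 HB] := tongue_slope_bounded As0.
pose D := lam (l_ s0) (param 1 0); pose C := B + 1; have C0 : 0 < C by rewrite /C; lra.
(* The first term keeps the denominator at s above D / 2; the second is what e becomes after
   division by it, for a vector of norm at most C |w|. *)
pose h := Num.min (D / 2) (e * D / (2 * C)).
have hp : 0 < h by rewrite lt_min !divr_gt0// mulr_gt0.
have [hD hC] : h <= D / 2 /\ h <= e * D / (2 * C) by rewrite !ge_min !lexx ?orbT.
have [d1 d10 H1] := mean_variation_cont C1F disF L0 irr0 hp.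
have d12 : 0 < d1 / 2 by lra.
have [d2 d20 H2] := tongue_fun_cont As0 d12.
exists (Num.min d2 (d1 / 2)); first by rewrite lt_min d20.
move=> s As; rewrite lt_min => /andP[s2 s1] w.
have [Ls _] := tongue_funP As; have irrs := tongue_fun_irr As.
have hs : half_space' s by case: Ls => _ /half_space_param.
have [_ as0] := H2 s hs s2.
have ls : `|l_ s - l_ s0| < d1.
  apply: (@le_lt_trans _ _ (d1 / 2)); last by lra.
  by rewrite paramB; apply: param_norm_le => //; exact: ltW.
have hv := H1 _ Ls irrs ls (param (Da s0 w) w).
have h1 := H1 _ Ls irrs ls (param 1 0).
have n1 : `|param 1 0 : 'rV[R]_n.+2| <= 1 by apply: param_norm_le; rewrite ?normr0 ?normr1.
have nv : `|param (Da s0 w) w| <= C * `|w|.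
  have n0 : 0 <= `|w| by []; have := HB w.
  by move=> hB; apply: param_norm_le; rewrite /C mulrDl mul1r; [lra|rewrite lerDr mulr_ge0// ltW].
have := tongue_slopeE w 0 As0; rewrite addr0 mul0r => v0; rewrite v0 subr0 in hv.
set Ds := lam (l_ s) (param 1 0) in h1.
have DsD : D / 2 <= Ds.
  have h2 : h * `|param 1 0 : 'rV[R]_n.+2| <= h by rewrite ler_piMr// ltW.
  by move: (le_trans h1 h2); rewrite ler_distl -/D => /andP[? _]; lra.
have Ds0 : 0 < Ds by move: D0; rewrite -/D; lra.
have vE : lam (l_ s) (param (Da s0 w) w) = (Da s0 w - Da s w) * Ds.
  by rewrite -[RHS](tongue_slopeE w _ As) addrCA subrr addr0.
rewrite distrC -(ler_pM2r Ds0) -[X in _ * X <= _](gtr0_norm Ds0) -normrM -vE.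
apply: le_trans hv _; apply: (@le_trans _ _ (e * D / (2 * C) * (C * `|w|))).
  by apply: ler_pM => //; exact: ltW.
have -> : e * D / (2 * C) * (C * `|w|) = e * `|w| * (D / 2) by field; rewrite gt_eqF.
by rewrite ler_wpM2l// mulr_ge0// ltW.
Qed.

End TongueFunction.

Theorem corollary21 (R : realType) (n : nat) (Om : set 'rV[R]_n.+2)
    (F : 'rV[R]_n.+2 -> R -> R) (DF : 'rV[R]_n.+2 -> 'rV[R]_n.+2 -> R -> R)
    (openOm : open Om) (convexOm : convex_set Om)
    (C1F : C1_family (Om `&` @half_space R n) F DF)
    (monoF : forall l, (Om `&` @half_space R n) l ->
       forall x, 0 < DF l (param 1 0) x)
    (critF : forall l, (Om `&` @half_space R n) l -> l 0 1 = 0 ->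
       multicritical (F l))
    (diffF : forall l, (Om `&` @half_space R n) l -> l 0 1 < 0 ->
       circle_diffeo (F l))
    (alpha : R) (irr : irrational alpha) :
  exists (U : int -> set 'rV[R]_n.+1) (a : int -> 'rV[R]_n.+1 -> R)
         (Da : int -> 'rV[R]_n.+1 -> 'rV[R]_n.+1 -> R),
    [/\ forall t s, tongue (Om `&` @half_space R n) F alpha (param t s) <->
          exists k : int, (U k `&` @half_space' R n) s /\ t = a k s,
        forall k s, (U k `&` @half_space' R n) s ->
          rotation_number (F (param (a k s) s)) = alpha + k%:~R,
        forall k, open (U k) /\
          C1_on (W := R^o) (fun x : R => `|x|) (U k `&` @half_space' R n)
            (a k) (Da k) &
        forall k s, (U k `&` @half_space' R n) s ->
          let l := param (a k s) s in
          exists mu : probability (measurableTypeR R) R,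
            unique_minus_one_measure (F l) mu /\
            forall w : 'rV[R]_n.+1,
              Da k s w *
                \int[mu]_(x in `[0, 1[%classic) DF l (param 1 0) (inv_map (F l) x) =
              - \int[mu]_(x in `[0, 1[%classic) DF l (param 0 w) (inv_map (F l) x)].
Proof.
set L := Om `&` _ in C1F monoF critF diffF *.
have disF l : L l -> exists V W, distorted (F l) V W.
  move=> Ll; apply: multicritical_distorted; have [_ l0] := Ll.
  move: (l0 : l 0 1 <= 0); rewrite le_eqVlt => /orP[/eqP|] h; first exact: critF.
  exact/circle_diffeo_multicritical/diffF.
(* A lift has a real rotation number, whereas the tongue prescribes it modulo 1: each integer k
   gives a branch, on which the rotation number is still irrational. *)
pose beta (k : int) := alpha + k%:~R.
have irrb k : irrational (beta k) by exact: irrationalD_int.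
pose A k := tongue_set L F (beta k); pose a k := tongue_fun L F (beta k).
have AH k s : A k s -> half_space' s by move=> [t [[_ /half_space_param]]].
(* An open set with trace A k on the half-space: adjoining the complement of the half-space makes
   the points of A k on its boundary interior. *)
pose U k := (A k `|` ~` @half_space' R n)°.
have UA k s : (U k `&` @half_space' R n) s <-> A k s.
  split; first by move=> [/interior_subset[]].
  move=> As; split; last exact: AH As.
  have [d d0 Hd] := tongue_fun_cont openOm convexOm C1F monoF disF (irrb k) As ltr01.
  apply/nbhs_ballP; exists d => // s'; rewrite -ball_normE /= distrC => s's.
  by have [hs|] := pselect (half_space' s'); [left; case: (Hd s' hs s's)|right].
exists U, a, (fun k s => tongue_slope F DF (param (a k s) s)); split.
- move=> t s; split.
    move=> [Lt [k rE]]; exists k; split; first by apply/UA; exists t.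
    by rewrite /a (tongue_fun_eq openOm convexOm C1F monoF disF (irrb k) Lt rE).
  by move=> [k [/UA/tongue_funP[La raE] ->]]; split => //; exists k.
- by move=> k s /UA/tongue_funP[].
- move=> k; split; first exact: open_interior.
  split=> [s /UA As|s /UA As e e0|s /UA As e e0].
  + exact: (tongue_slope_linear C1F disF (irrb k) As).
  + have [d d0 Hd] := tongue_fun_diff openOm convexOm C1F monoF disF (irrb k) As e0.
    by apply/within_nbhsP; exists d => // s' /UA; exact: Hd.
  + have [d d0 Hd] := tongue_slope_cont openOm convexOm C1F monoF disF (irrb k) As e0.
    by apply/within_nbhsP; exists d => // s' /UA; exact: Hd.
move=> k s /UA As /=; set l := param _ _.
have [Ll rE] := tongue_funP As; have irrl := tongue_fun_irr (irrb k) As.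
have [V [W dF]] := disF _ Ll.
have [mu [umu Emu]] := unique_minus_one_measure_exists dF irrl.
exists mu; split => // w; rewrite !Emu; [|exact: (velocity_cper C1F disF)..].
rewrite /tongue_slope -/(mean_variation F DF l _) -/(mean_variation F DF l _) -mulrA mulVf ?mulr1//.
by rewrite gt_eqF//; exact: (mean_variation_monotone_gt0 C1F monoF disF).
Qed.
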